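(* Let $\mathcal{O}\subset\mathbb{R}^d$ be a bounded admissible domain, let $\sigma:\bar{\mathcal{O}}\to\mathrm{Hom}(\mathbb{R}^r;\mathbb{R}^d)$ be uniformly Lipschitz continuous, let $x_0\in\bar{\mathcal{O}}$, and let $w:[0,\infty)\to\mathbb{R}^r$ be a fixed continuous, piecewise smooth path. If $(x_\cdot,\ell_\cdot)$ is the unique solution of the reflected ODE with input $w$ and starting point $x_0$, then $$\dot{x}_t=\mathrm{proj}_{T_{\bar{\mathcal{O}}}(x_t)}\big(\sigma(x_t)\dot{w}_t\big)\quad\text{for almost every }t\ge 0.\qquad( * )$$ Conversely, given a solution $x_\cdot$ of $( * )$ (a locally absolutely continuous path $x:[0,\infty)\to\bar{\mathcal{O}}$ starting at $x_0$ and satisfying $( * )$), there exists $\ell_\cdot$ such that $(x_\cdot,\ell_\cdot)$ is a solution of the reflected ODE with input $w$ and starting point $x_0$.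
   Context: A domain is a nonempty connected open set. For a domain $\mathcal{O}\subset\mathbb{R}^d$ and $x\in\partial\mathcal{O}$, let $$\nu(x)=\{\nu\in\mathbb{S}^{d-1}:\exists C>0\ \forall x'\in\bar{\mathcal{O}}\ (x'-x)\cdot\nu+C|x-x'|^2\ge 0\}.$$ $\mathcal{O}$ is admissible if: (1) $\nu(x)\ne\emptyset$ for all $x\in\partial\mathcal{O}$, and there is $C_0\ge 0$ with $(x'-x)\cdot\nu+C_0|x-x'|^2\ge 0$ for all $x'\in\mathcal{O}$, $x\in\partial\mathcal{O}$, $\nu\in\nu(x)$; (2) there are $\phi\in C^2(\mathbb{R}^d;\mathbb{R})$ and $\alpha>0$ with $\nabla\phi(x)\cdot\nu\ge\alpha$ for all $x\in\partial\mathcal{O}$, $\nu\in\nu(x)$; (3) there are $n\ge 1$, $\lambda>0$, $R>0$, $a_1,\dots,a_n\in\mathbb{S}^{d-1}$, $x_1,\dots,x_n\in\partial\mathcal{O}$ with $\partial\mathcal{O}\subseteq\bigcup_{i=1}^n B(x_i,R)$ and, for each $i$, $\nu\cdot a_i\ge\lambda$ for all $x\in\partial\mathcal{O}\cap B(x_i,2R)$ and $\nu\in\nu(x)$. A solution of the reflected ODE with input $w$ and starting point $x_0$ is a pair $(x_\cdot,\ell_\cdot)$ with $x_\cdot\in C([0,\infty);\bar{\mathcal{O}})$ and $\ell:[0,\infty)\to\mathbb{R}^d$ continuous of locally bounded variation (total variation $|\ell|_t$ on $[0,t]$) such that $$x_t=x_0+\int_0^t\sigma(x_s)\,dw_s+\ell_t,\qquad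 |\ell|_t=\int_0^t 1_{\partial\mathcal{O}}(x_s)\,d|\ell|_s,\qquad \frac{d\ell_t}{d|\ell|_t}\in\nu(x_t)\ \text{ for } d|\ell|\text{-a.e. }t.$$ In this setting the solution exists and is unique. For a closed set $D\subseteq\mathbb{R}^d$ let $d_D(z)=\inf_{y\in D}|y-z|$, and let the tangent cone to $D$ at $z$ be $T_D(z)=\{v\in\mathbb{R}^d:\liminf_{h\searrow 0}\frac{d_D(z+hv)}{h}=0\}$. $\mathrm{proj}_D(z)$ is the nearest-point projection of $z$ onto $D$. For admissible $\mathcal{O}$ and $z\in\bar{\mathcal{O}}$ the cone $T_{\bar{\mathcal{O}}}(z)$ is closed and convex, so $\mathrm{proj}_{T_{\bar{\mathcal{O}}}(z)}$ is single valued. *)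

(* Defs.v *)
(* [R^d] is ['cV[R]_d] and Hom(R^r; R^d) is ['M[R]_(d, r)]. *)
From mathcomp Require Import all_boot all_order all_algebra.
From mathcomp Require Import all_classical all_reals all_analysis.

Set Implicit Arguments.
Unset Strict Implicit.
Unset Printing Implicit Defensive.

Import Order.TTheory GRing.Theory Num.Theory.
Import numFieldNormedType.Exports.

Local Open Scope classical_set_scope.
Local Open Scope ring_scope.

(* The library norm on matrices is the sup norm: it has the right topology and
   the right bounded sets, but balls, spheres, distances, projections and total
   variations have to be taken for the Euclidean norm. *)
Definition dot (R : realType) (d : nat) (u v : 'cV[R]_d) : R :=
  \sum_(i < d) u i 0 * v i 0.

Definition enorm (R : realType) (d : nat) (u : 'cV[R]_d) : R :=
  Num.sqrt (dot u u).

Definition eball (R : realType) (d : nat) (x : 'cV[R]_d) (r : R) :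
  set 'cV[R]_d := [set y | enorm (y - x) < r].

Definition usphere (R : realType) (d : nat) : set 'cV[R]_d :=
  [set u | enorm u = 1].
Arguments usphere {R d}.

Definition boundary (T : topologicalType) (A : set T) : set T :=
  closure A `\` interior A.

Definition domain (T : topologicalType) (A : set T) : Prop :=
  [/\ A !=set0, connected A & open A].

Definition normals (R : realType) (d : nat) (O : set 'cV[R]_d)
    (x : 'cV[R]_d) : set 'cV[R]_d :=
  [set n | usphere n /\ exists2 C : R, 0 < C &
    forall x', closure O x' -> 0 <= dot (x' - x) n + C * enorm (x - x') ^+ 2].

Definition basis (R : realType) (d : nat) (i : 'I_d) : 'cV[R]_d :=
  delta_mx i 0.
Arguments basis {R d}.

Definition grad (R : realType) (d : nat) (f : 'cV[R]_d -> R)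
    (x : 'cV[R]_d) : 'cV[R]_d :=
  \col_(i < d) 'D_(basis i) f x.

Definition C2 (R : realType) (d : nat) (f : 'cV[R]_d -> R) : Prop :=
  [/\ continuous f,
      forall (i : 'I_d) (x : 'cV[R]_d), derivable f x (basis i),
      forall i : 'I_d, continuous ('D_(basis i) f),
      forall (i j : 'I_d) (x : 'cV[R]_d),
        derivable ('D_(basis i) f) x (basis j)
    & forall i j : 'I_d, continuous ('D_(basis j) ('D_(basis i) f))].

Definition admissible (R : realType) (d : nat) (O : set 'cV[R]_d) : Prop :=
  [/\ (forall x, boundary O x -> normals O x !=set0) /\
      (exists2 C0 : R, 0 <= C0 & forall x' x n,
         O x' -> boundary O x -> normals O x n ->
         0 <= dot (x' - x) n + C0 * enorm (x - x') ^+ 2),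
      (exists (phi : 'cV[R]_d -> R) (alpha : R),
        [/\ C2 phi, 0 < alpha & forall x n,
            boundary O x -> normals O x n -> alpha <= dot (grad phi x) n])
    & exists (n : nat) (lam rad : R) (a y : 'I_n -> 'cV[R]_d),
        [/\ (1 <= n)%N, 0 < lam, 0 < rad,
            forall i, usphere (a i) /\ boundary O (y i)
          & boundary O `<=` \bigcup_i eball (y i) rad /\
            forall i x nu, boundary O x -> eball (y i) (2 * rad) x ->
              normals O x nu -> lam <= dot nu (a i)]].

(* The bound for all [v] is a bound on the operator norm of [sigma x - sigma y]. *)
Definition lipschitz_opnorm (R : realType) (d r : nat) (A : set 'cV[R]_d)
    (sigma : 'cV[R]_d -> 'M[R]_(d, r)) : Prop :=
  exists K : R, forall x y v, A x -> A y ->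
    enorm ((sigma x - sigma y) *m v) <= K * enorm (x - y) * enorm v.

Definition smooth (R : realType) (r : nat) (f : R -> 'cV[R]_r) : Prop :=
  forall (n : nat) (t : R), derivable (f^`(n))%classic t 1.

(* On every [0, T] there is a finite partition on each closed piece of which
   [w] is smooth up to the endpoints, i.e. coincides with a smooth function. *)
Definition piecewise_smooth (R : realType) (r : nat) (w : R -> 'cV[R]_r) :
    Prop :=
  forall T : R, 0 < T -> exists2 s : seq R, itv_partition 0 T s &
    let p := nth T (0 :: s) in
    forall i : nat, (i < size s)%N -> exists2 f : R -> 'cV[R]_r, smooth f &
      forall t, p i <= t <= p i.+1 -> w t = f t.

(* Riemann-Stieltjes integral: limit of tagged sums as the mesh tends to 0. *)
Definition is_RS_integral (R : realType) (d r : nat) (F : R -> 'M[R]_(d, r))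
    (w : R -> 'cV[R]_r) (a b : R) (I : 'cV[R]_d) : Prop :=
  forall eps : R, 0 < eps -> exists2 delta : R, 0 < delta &
    forall (s : seq R) (xi : nat -> R), itv_partition a b s ->
      let p := nth b (a :: s) in
      (forall i, (i < size s)%N ->
         p i <= xi i <= p i.+1 /\ p i.+1 - p i < delta) ->
      enorm (\sum_(0 <= i < size s) F (xi i) *m (w (p i.+1) - w (p i)) - I)
        < eps.

(* Total variation for the Euclidean norm; compare [total_variation], which is
   for real-valued functions. *)
Definition etotal_variation (R : realType) (d : nat) (a b : R)
    (f : R -> 'cV[R]_d) : \bar R :=
  ereal_sup [set (let p := nth b (a :: s) in
                  \sum_(0 <= i < size s) enorm (f (p i.+1) - f (p i)))%:E
            | s in itv_partition a b].

(* [L t] is the total variation of [l] on [0, t] for [t >= 0] and is extended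
   by 0 to [t < 0], so that [lebesgue_stieltjes_measure L] is the measure
   d|l|, carried by [0, +oo). *)
Definition variation_function (R : realType) (d : nat) (l : R -> 'cV[R]_d)
    (L : R -> R) : Prop :=
  forall t : R, (L t)%:E = etotal_variation 0 (Num.max 0 t) l.

(* [g] is a Radon-Nikodym derivative dl/dmu on [0, +oo). *)
Definition stieltjes_density (R : realType) (d : nat)
    (mu : {measure set (measurableTypeR R) -> \bar R})
    (l g : R -> 'cV[R]_d) : Prop :=
  forall (t : R) (i : 'I_d), 0 <= t ->
    mu.-integrable `[0, t] (fun s => (g s i 0)%:E) /\
    l t i 0 - l 0 i 0 = \int[mu]_(s in `[0, t]) (g s i 0).

Definition reflected_ode_solution (R : realType) (d r : nat)
    (O : set 'cV[R]_d) (sigma : 'cV[R]_d -> 'M[R]_(d, r))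
    (w : R -> 'cV[R]_r) (x0 : 'cV[R]_d) (x l : R -> 'cV[R]_d) : Prop :=
  [/\ {within `[0, +oo[, continuous x} /\
      (forall t, 0 <= t -> closure O (x t)),
      {within `[0, +oo[, continuous l} /\
      (forall t, 0 <= t -> (etotal_variation 0 t l < +oo)%E),
      x 0 = x0 /\
      (forall t, 0 <= t -> exists2 I : 'cV[R]_d,
         is_RS_integral (sigma \o x) w 0 t I & x t = x0 + I + l t)
    & exists L : cumulative R R, let dL := lebesgue_stieltjes_measure L in
        [/\ variation_function l L,
            (forall t, 0 <= t ->
               (L t)%:E = (\int[dL]_(s in `[0%R, t]) (\1_(boundary O) (x s))%:E)%E)
          & exists2 g : R -> 'cV[R]_d, stieltjes_density dL l g &
              {ae dL, forall t, 0 <= t -> normals O (x t) (g t)}]].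

Definition edist_to (R : realType) (d : nat) (D : set 'cV[R]_d)
    (z : 'cV[R]_d) : R := inf [set enorm (y - z) | y in D].

Definition tangent_cone (R : realType) (d : nat) (D : set 'cV[R]_d)
    (z : 'cV[R]_d) : set 'cV[R]_d :=
  [set v | limf_einf (fun h : R => (edist_to D (z + h *: v) / h)%:E) 0^'+
           = 0%E].

(* [p] is a nearest point of [z] in [D]: [p = proj_D z] when the projection is
   single valued. *)
Definition is_proj (R : realType) (d : nat) (D : set 'cV[R]_d)
    (z p : 'cV[R]_d) : Prop :=
  D p /\ forall y, D y -> enorm (p - z) <= enorm (y - z).

Definition projected_ode (R : realType) (d r : nat)
    (O : set 'cV[R]_d) (sigma : 'cV[R]_d -> 'M[R]_(d, r))
    (w : R -> 'cV[R]_r) (x : R -> 'cV[R]_d) : Prop :=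
  {ae @lebesgue_measure R, forall t, 0 <= t ->
    derivable x t 1 /\
    is_proj (tangent_cone (closure O) (x t)) (sigma (x t) *m w^`()%classic t)
            (x^`()%classic t)}.

Definition locally_abs_continuous (R : realType) (d : nat)
    (x : R -> 'cV[R]_d) : Prop :=
  forall T eps : R, 0 < eps -> exists2 delta : R, 0 < delta &
    forall (n : nat) (a b : nat -> R),
      (forall i, (i < n)%N -> [/\ 0 <= a i, a i <= b i & b i <= T]) ->
      trivIset `I_n (fun i => `]a i, b i[%classic) ->
      \sum_(0 <= i < n) (b i - a i) < delta ->
      \sum_(0 <= i < n) enorm (x (b i) - x (a i)) < eps.

(* Main.v *)
(** The unit normals in [normals O q] and [0] generate the cone of proximal
    normals at [q]; by condition (1) this cone is convex and closed, and its dual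
    is the tangent cone.  By Moreau's decomposition, [p] is the projection of
    [z] on the tangent cone exactly when [p] is tangent and [p - z] is a
    proximal normal orthogonal to [p].

    From the reflected equation: conditions (1) and (3) bound the variation of
    [l] locally by its increments, so it is locally small, and an energy estimate
    for [|x_t - x_s|^2] gives that [x] and [l] are locally Lipschitz.  At a.e.
    [t], [x' - sigma w'] is the derivative of [l] and a proximal normal; both
    [x'] and [- x'] are tangent because [x] stays in the closed domain before
    and after [t], hence [x'] is orthogonal to this normal.

    From the projected equation: as [0] is tangent, [|x'| <= 2 |sigma w'|] and
    [x] is locally Lipschitz.  Then [l = x - x0 - int sigma dw] has the a.e.
    derivative [k = x' - sigma w'], a multiple of a normal that vanishes off the
    boundary; its variation is the integral of [|k|], with density [k / |k|]. *)

Require Import Defs.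
From HB Require Import structures.
From mathcomp Require Import all_boot all_order all_algebra.
From mathcomp Require Import all_classical all_reals all_analysis measurable_realfun.
From mathcomp Require Import ring lra.
Import Order.TTheory GRing.Theory Num.Theory.
Import numFieldNormedType.Exports.
Local Open Scope classical_set_scope.
Local Open Scope ring_scope.

Set Implicit Arguments.
Unset Strict Implicit.
Unset Printing Implicit Defensive.

(** * Absolute continuity and comparison *)

Section real_induction.
Context {R : realType}.

(** Increments replace chain rules and integration by parts. The estimates for [x], [l] and [L] are
    proved for increments [F v - F u] over short intervals straddling a point, then chained by real
    induction; a Lebesgue-null set of bad points is tolerated when [F] is absolutely continuous.
    Null sets are the delicate point: the normal condition holds for d|l|-almost every time, the
    projected equation for Lebesgue-almost every time. In the forward direction the condition is
    integrated against d|l| over []t, s]], with [L s - L t] of order [s - t], so that it passes to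
    the derivative of [l] at every time where this exists. In the converse direction d|l| is [|k|]
    times Lebesgue measure. Differentiability almost everywhere of Lipschitz functions comes from
    Radon-Nikodym derivatives of Stieltjes measures, identified by Lebesgue differentiation. The
    integral of sigma against [w] is carried by a locally Lipschitz [Y], a primitive of [sigma w'];
    piecewise smoothness of [w] is used as a local Lipschitz bound. *)

Lemma real_induction (Q : R -> Prop) (a b : R) : a <= b -> Q a ->
  (forall t, a <= t <= b -> exists2 e : R, 0 < e & forall u v,
     a <= u <= b -> a <= v <= b -> t - e < u -> u <= t -> t <= v -> v < t + e ->
     Q u -> Q v) -> Q b.
Proof.
move=> ab Qa step.
pose S := [set t | a <= t <= b /\ Q t].
have Sa : S a by split=> //; rewrite lexx ab.
have ubS : ubound S b by move=> t [/andP[]].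
have hsS : has_sup S by split; [exists a | exists b].
have as_ : a <= sup S by apply: sup_upper_bound.
have sb : sup S <= b by apply: ge_sup => //; exists a.
(* Applied at the supremum, with [u] in [S] within [e] to its left, the step puts the points of
   [[sup S, sup S + e[] up to [b] into [S]; [sup S + e / 2] is then a contradiction unless [b] comes
   first. *)
have [e e0 he] := step (sup S) (introT andP (conj as_ sb)).
have [u [/andP[au ub] Qu] su] := sup_adherent e0 hsS.
have us : u <= sup S by apply: sup_upper_bound => //; split => //; rewrite au.
have Qv v : sup S <= v -> v < sup S + e -> v <= b -> Q v.
  move=> sv ve vb; apply: (he u v) => //; first by rewrite au.
  by rewrite (le_trans as_ sv).
have [bs|bs] := leP b (sup S + e / 2).
  by apply: Qv => //; rewrite (le_lt_trans bs)// ltrD2l ltr_pdivrMr// ltr_pMr// ltr1n.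
have : S (sup S + e / 2).
  split; last by apply: Qv; [rewrite lerDl divr_ge0// ltW | rewrite ltrD2l ltr_pdivrMr// ltr_pMr// ltr1n | exact: ltW].
  by rewrite (ltW bs) andbT (le_trans as_)// lerDl divr_ge0// ltW.
move=> /(sup_upper_bound hsS); rewrite gerDl leNgt divr_gt0//.
Qed.

Lemma local_to_global_le (F G : R -> R) (a b : R) : a <= b ->
  (forall t, a <= t <= b -> exists2 e : R, 0 < e & forall u v,
     a <= u <= b -> a <= v <= b -> t - e < u -> u <= t -> t <= v -> v < t + e ->
     F v - F u <= G v - G u) -> F b - F a <= G b - G a.
Proof.
move=> ab h.
apply: (@real_induction (fun t => F t - F a <= G t - G a) a b) => //.
  by rewrite !subrr.
move=> t /h[e e0 he]; exists e => // u v hu hv tu ut tv ve.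
have := he _ _ hu hv tu ut tv ve; lra.
Qed.

Definition abs_continuous_on (F : R -> R) (a b : R) :=
  forall eps : R, 0 < eps -> exists2 delta : R, 0 < delta &
    forall (n : nat) (p q : nat -> R),
      (forall i, (i < n)%N -> [/\ a <= p i, p i <= q i & q i <= b]) ->
      trivIset `I_n (fun i => `]p i, q i[%classic) ->
      \sum_(0 <= i < n) (q i - p i) < delta ->
      \sum_(0 <= i < n) `|F (q i) - F (p i)| < eps.

Lemma lipschitz_abs_continuous (F : R -> R) (a b K : R) :
  (forall u v, a <= u -> u <= v -> v <= b -> `|F v - F u| <= K * (v - u)) ->
  abs_continuous_on F a b.
Proof.
move=> lipF eps eps0; pose K' := Num.max K 1.
have K'0 : 0 < K' by rewrite lt_max ltr01 orbT.
exists (eps / K'); first by rewrite divr_gt0.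
move=> n p q pq _ sd.
apply: (@le_lt_trans _ _ (K' * \sum_(0 <= i < n) (q i - p i))).
  rewrite mulr_sumr big_seq_cond [leRHS]big_seq_cond.
  apply: ler_sum => i; rewrite mem_index_iota andbT => /pq[? pqi ?].
  apply: (le_trans (lipF _ _ _ _ _)) => //.
  by rewrite ler_wpM2r ?subr_ge0// le_max lexx.
by rewrite mulrC -ltr_pdivlMr.
Qed.

Lemma sum_itv_le_measure (U : set R) n (p q : nat -> R) : measurable U ->
  (forall i, (i < n)%N -> p i <= q i) ->
  trivIset `I_n (fun i => `]p i, q i[%classic) ->
  (forall i, (i < n)%N -> `]p i, q i[%classic `<=` U) ->
  ((\sum_(0 <= i < n) (q i - p i))%:E <= @lebesgue_measure R U)%E.
Proof.
move=> mU pq tpq sub.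
rewrite -sumEFin.
rewrite (_ : (\sum_(0 <= i < n) (q i - p i)%:E)%E =
   (\sum_(i < n) @lebesgue_measure R `]p i, q i[%classic)%E); last first.
  rewrite big_mkord; apply: eq_bigr => i _.
  rewrite lebesgue_measure_itv/= lte_fin; case: ltP => //= qp.
  have -> : p i = q i by apply/eqP; rewrite eq_le qp pq.
  by rewrite subrr.
rewrite -[leLHS](@measure_semi_additive_ord_I _ _ _ (@lebesgue_measure R) (fun i => `]p i, q i[%classic))//; last first.
  by apply: bigsetU_measurable.
apply: le_measure; rewrite ?inE//.
  by apply: bigsetU_measurable.
move=> x; rewrite -(bigcup_mkord n (fun i => `]p i, q i[%classic)).
by move=> [i /= ni]; exact: sub.
Qed.


(** The bad null set is covered by an open set [U] of measure below [delta]. Intervals around bad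
    points are kept inside [U], where absolute continuity bounds the total increment of [F] and the
    increment of [G] is dropped by monotonicity; the other intervals use the local hypothesis. *)
Lemma abs_continuous_local_to_global_le (F G : R -> R) (a b : R) : a <= b ->
  abs_continuous_on F a b ->
  {homo G : u v / u <= v} ->
  {ae @lebesgue_measure R, forall t, a <= t <= b -> forall eps, 0 < eps ->
    exists2 e : R, 0 < e & forall u v,
     a <= u <= b -> a <= v <= b -> t - e < u -> u <= t -> t <= v -> v < t + e ->
     F v - F u <= G v - G u + eps * (v - u)} -> F b - F a <= G b - G a.
Proof.
move=> ab acF homoG [N [mN N0 subN]].
apply/ler_addgt0Pr => eps1 eps10.
(* The error is at most [eps * (b - a)] from the good intervals plus [eps] from those in [U],
   together [eps1]. *)
pose eps := eps1 / (b - a + 1).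
have ba1 : 0 < b - a + 1 by rewrite ltr_wpDl// subr_ge0.
have eps0 : 0 < eps by rewrite divr_gt0.
have [delta delta0 hdelta] := acF _ eps0.
have Nfin : (@lebesgue_measure R N < +oo)%E by rewrite (_ : lebesgue_measure N = 0%E).
have [U [oU NU]] : exists U : set R, [/\ open U, N `<=` U &
    (@lebesgue_measure R U < delta%:E)%E].
  have [U [oU NU UN]] := lebesgue_regularity_outer mN Nfin delta0.
  exists U; split => //.
  apply: le_lt_trans UN; rewrite -{1}(setDUK NU).
  apply: (le_trans (measureU2 _ _ _)) => //.
    by apply: measurableD => //; exact: open_measurable.
  by rewrite -[leRHS]add0e leeD2r// le_eqVlt; apply/orP; left; apply/eqP; exact: N0.
move=> Udelta.
(* Invariant of the induction at time [t]: the intervals spent so far around bad points, with their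
   increments charged on the right-hand side. *)
pose fam n (p q : nat -> R) t := [/\
   (forall i, (i < n)%N -> [/\ a <= p i, p i <= q i & q i <= t]),
   trivIset `I_n (fun i => `]p i, q i[%classic),
   (forall i, (i < n)%N -> `]p i, q i[%classic `<=` U) &
   F t - F a <= G t - G a + eps * (t - a) +
     \sum_(0 <= i < n) `|F (q i) - F (p i)|].
have [n [p [q [pq tpq pqU Fb]]]] : exists n p q, fam n p q b.
  apply: (@real_induction (fun t => exists n p q, fam n p q t) a b) => //.
    exists 0%N, (fun=> 0), (fun=> 0); split=> //.
    by rewrite big_geq// !subrr mulr0 !addr0.
  move=> t tab; have [tN|tN] := pselect (N t).
    have /open_subball : open U by [].
    move=> /(_ t (NU _ tN)) [e0 /= e00 he0].
    exists (e0 / 4); first by rewrite divr_gt0.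
    move=> u v uab vab tu ut tv ve [n [p [q [pq tpq pqU Fu]]]].
    have uv : u <= v by exact: le_trans tv.
    exists n.+1, (fun i => if (i < n)%N then p i else u),
      (fun i => if (i < n)%N then q i else v); split.
    - move=> i; rewrite ltnS leq_eqVlt => /orP[/eqP ->|/[dup] ni -> ].
        by rewrite ltnn; case/andP: uab.
      by have [? ? ?] := pq _ ni; split => //; exact: le_trans uv.
    - apply/trivIsetP => i j /=.
      wlog ij : i j / (i < j)%N.
        move=> wl ni nj; rewrite neq_ltn => /orP[] ij.
          by apply: wl => //; rewrite neq_ltn ij.
        by rewrite setIC; apply: wl => //; rewrite neq_ltn ij.
      move=> ni; rewrite ltnS leq_eqVlt => /orP[/eqP jn _|nj ij'].
        rewrite jn in ij *; rewrite ij ltnn.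
        have [_ _ qu] := pq _ ij.
        apply/seteqP; split => // x [/=]; rewrite !in_itv/= => /andP[_ xq] /andP[ux _].
        by move: (lt_le_trans xq qu); rewrite ltNge (ltW ux).
      rewrite nj (ltn_trans ij nj).
      by move/trivIsetP : tpq; apply => //; exact: ltn_trans ij nj.
    - move=> i; rewrite ltnS leq_eqVlt => /orP[/eqP ->|/[dup] ni -> ]; last exact: pqU.
      rewrite ltnn => x /=; rewrite in_itv/= => /andP[ux xv].
      apply: (he0 (e0 / 2)) => //=.
      + by rewrite sub0r normrN gtr0_norm ?divr_gt0// ltr_pdivrMr// ltr_pMr// ltr1n.
      + by rewrite divr_gt0.
      + rewrite /ball/= ltr_distlC; apply/andP; split; lra.
    - rewrite big_nat_recr//= ltnn.
      rewrite (@eq_big_nat _ _ _ _ _ _ (fun i => `|F (q i) - F (p i)|)); last first.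
        by move=> i /andP[_ ->].
      have Guv := homoG _ _ uv.
      have := ler_norm (F v - F u).
      have : 0 <= eps * (v - u) by rewrite mulr_ge0 ?subr_ge0// ltW.
      lra.
  have [e e0 he] : exists2 e : R, 0 < e & forall u v,
     a <= u <= b -> a <= v <= b -> t - e < u -> u <= t -> t <= v -> v < t + e ->
     F v - F u <= G v - G u + eps * (v - u).
    apply: contrapT => nex; apply: tN; apply: subN => /= h.
    by apply: nex; apply: h.
  exists e => // u v uab vab tu ut tv ve [n [p [q [pq tpq pqU Fu]]]].
  exists n, p, q; split => //.
    by move=> i /pq[? ? ?]; split => //; rewrite (le_trans _ tv)// (le_trans _ ut).
  have := he _ _ uab vab tu ut tv ve; lra.
have sd : \sum_(0 <= i < n) (q i - p i) < delta.
  rewrite -lte_fin; apply: le_lt_trans Udelta.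
  apply: sum_itv_le_measure => //; first exact: open_measurable.
  by move=> i /pq[].
have := hdelta n p q pq tpq sd.
have -> : eps1 = eps * (b - a) + eps by rewrite /eps; field; rewrite gt_eqF.
lra.
Qed.

End real_induction.

(** * Stieltjes measures with Lipschitz distribution function *)

Section stieltjes.
Context {R : realType}.
Local Notation mu := (@lebesgue_measure R).
Local Notation LS := lebesgue_stieltjes_measure.

Lemma lebesgue_stieltjes_itv_oc (h : cumulative R R) (a b : R) : a <= b ->
  LS h `]a, b]%classic = (h b - h a)%:E.
Proof.
move=> ab; rewrite /LS /measure_extension measurable_mu_extE/=; last exact: is_ocitv.
by rewrite wlength_itv_bnd.
Qed.

(** Composition with [clamp T] freezes a function outside [[0, T]], turning a Lipschitz bound on
    [[0, T]] into one on the whole line. *)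
Definition clamp (T t : R) := Num.max 0 (Num.min t T).

Lemma clamp_id T t : 0 <= t <= T -> clamp T t = t.
Proof. by move=> /andP[t0 tT]; rewrite /clamp (min_idPl tT) (max_idPr t0). Qed.

Lemma clamp_in T t : 0 <= T -> 0 <= clamp T t <= T.
Proof. by move=> T0; rewrite /clamp le_max lexx/= ge_max T0 ge_min lexx orbT. Qed.

Lemma clamp_lip T u v : 0 <= T -> u <= v -> 0 <= clamp T v - clamp T u <= v - u.
Proof.
move=> T0 uv; rewrite /clamp.
by case: (leP u T) => ?; case: (leP v T) => ?; case: (leP 0 u) => ?;
  case: (leP 0 v) => ?; case: (leP 0 T) => ?; apply/andP; split; lra.
Qed.

Lemma right_continuous_lip (h : R -> R) K :
  (forall u v, u <= v -> 0 <= h v - h u <= K * (v - u)) ->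
  right_continuous h.
Proof.
move=> hl; apply: right_continuousW => x; apply/cvgrPdist_le => e e0.
pose K' := Num.max K 1.
have K'0 : 0 < K' by rewrite lt_max ltr01 orbT.
exists (e / K') => /=; first by rewrite divr_gt0.
move=> y /=; rewrite ltr_pdivlMr// => xy.
have KK' : K <= K' by rewrite le_max lexx.
wlog : x y xy / x <= y.
  move=> wl; have [/(wl _ _ xy)//|/ltW yx] := leP x y.
  by rewrite distrC; apply: wl => //; rewrite distrC.
move=> lxy; have /andP[h0 h1] := hl _ _ lxy.
rewrite distrC ger0_norm//; apply: (le_trans h1).
apply: le_trans (ltW xy); rewrite distrC ger0_norm ?subr_ge0// mulrC.
by rewrite ler_wpM2l ?subr_ge0.
Qed.

Section mk_cumulative.
Variables (h : R -> R) (K : R).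
Hypothesis hl : forall u v, u <= v -> 0 <= h v - h u <= K * (v - u).
Let nd : nondecreasing h.
Proof. by move=> u v /hl /andP[]; rewrite subr_ge0. Qed.
Definition lipschitz_cumulative : cumulative R R :=
  HB.pack h (isCumulative.Build R _ R h nd (right_continuous_lip hl)).
End mk_cumulative.

Section restricted.
Variables (h : cumulative R R) (T K : R).
Hypotheses (T0 : 0 <= T).
Hypothesis hlip : forall u v, 0 <= u -> u <= v -> v <= T -> h v - h u <= K * (v - u).


Let finT : (LS h `]0%R, T]%classic < +oo)%E.
Proof. by rewrite lebesgue_stieltjes_itv_oc// ltry. Qed.

(** Cut down to []0, T]] the measure is finite, so that it becomes a finite charge with a
    Radon-Nikodym derivative. *)
Definition lsm_restr : {finite_measure set (measurableTypeR R) -> \bar R} :=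
  @mfrestr _ (measurableTypeR R) R `]0%R, T]%classic (LS h)
    (measurable_itv `]0%R, T]) finT.

Lemma lsm_restrE A : lsm_restr A = LS h (A `&` `]0, T]).
Proof. by []. Qed.

Let hnd u v : u <= v -> 0 <= h v - h u.
Proof. by move=> uv; rewrite subr_ge0; exact: cumulative_is_nondecreasing. Qed.

Let K0 : 0 < T -> 0 <= K.
Proof.
move=> T0'; have := hlip (lexx 0) T0 (lexx T); have := hnd T0.
by rewrite subr0 => h1 h2; have := le_trans h1 h2; rewrite pmulr_lge0.
Qed.

Let h1lip u v : u <= v -> 0 <= h (clamp T v) - h (clamp T u) <= `|K| * (v - u).
Proof.
move=> uv; have /andP[c0 c1] := clamp_lip T0 uv; rewrite subr_ge0 in c0.
have /andP[cu0 cuT] := clamp_in u T0; have /andP[cv0 cvT] := clamp_in v T0.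
rewrite hnd//=.
apply: (le_trans (hlip cu0 c0 cvT)).
have cuv : 0 <= clamp T v - clamp T u by rewrite subr_ge0.
by rewrite (le_trans (ler_wpM2r cuv (ler_norm K)))// ler_wpM2l.
Qed.

Let h2lip u v : u <= v ->
  0 <= (`|K| * v - h (clamp T v)) - (`|K| * u - h (clamp T u)) <= `|K| * (v - u).
Proof. by move=> /h1lip /andP[? ?]; apply/andP; split; lra. Qed.

Let h3lip u v : u <= v -> 0 <= `|K| * v - `|K| * u <= `|K| * (v - u).
Proof. by move=> uv; rewrite -mulrBr mulr_ge0 ?subr_ge0//=. Qed.

Let H1 := lipschitz_cumulative h1lip.
Let H2 := lipschitz_cumulative h2lip.
Let H3 := lipschitz_cumulative h3lip.

Let lsm_restr_clamp A : measurable A -> lsm_restr A = LS H1 A.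
Proof.
move=> mA; apply/esym; apply: lebesgue_stieltjes_measure_unique => // X [[x y] _ <-]/=.
have [yx|xy] := leP y x.
  by rewrite set_itv_ge ?bnd_simp -?leNgt// !measure0.
rewrite lsm_restrE (lebesgue_stieltjes_itv_oc _ (ltW xy)) /=.
have -> : `]x, y]%classic `&` `]0, T]%classic =
    `]Num.max x 0, Num.min y T]%classic :> set R.
  apply/seteqP; split => z /=; rewrite !in_itv/= gt_max le_min.
    by case=> /andP[-> ->] /andP[-> ->].
  by move=> /andP[/andP[-> ->] /andP[-> ->]].
rewrite /H1/=.
have [l|l] := leP (Num.max x 0) (Num.min y T).
  rewrite lebesgue_stieltjes_itv_oc//.
  have m0 : 0 <= Num.min y T by apply: le_trans l; rewrite le_max lexx orbT.
  have xT : x <= T.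
    by apply: le_trans (le_trans l _); rewrite ?le_max ?ge_min ?lexx ?orbT.
  by rewrite /clamp (max_r m0) (min_l xT) maxC.
rewrite set_itv_ge ?measure0; last by rewrite bnd_simp -leNgt ltW.
suff -> : clamp T y = clamp T x by rewrite subrr.
move: l; rewrite lt_max !gt_min [T < 0]ltNge T0 orbF => /orP[/orP[yx|Tx]|y0].
- by move: xy; rewrite ltNge (ltW yx).
- by rewrite /clamp (min_r (ltW Tx)) (min_r (ltW (lt_trans Tx xy))).
- have x0 := lt_trans xy y0.
  by rewrite /clamp !min_l ?max_l// ltW// (lt_le_trans _ T0).
Qed.

(** [H1] is the clamped [h], [H2] is [|K| t] minus it, and [H3] is [|K| t]. The first two are
    nondecreasing, so their measures add up to [|K|] times Lebesgue measure, which therefore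
    dominates the measure of [H1], that is, the restricted one. *)
Lemma lsm_restr_dominates : lsm_restr `<< mu.
Proof.
apply/null_content_dominatesP => A mA A0.
rewrite lsm_restr_clamp//.
have E3 : LS H3 A = (`|K|%:E * mu A)%E.
  transitivity (mscale (NngNum (normr_ge0 K)) mu A); last by [].
  apply: lebesgue_stieltjes_measure_unique => // X [[x y] _ <-]/=.
  have [yx|xy] := leP y x.
    by rewrite set_itv_ge ?bnd_simp -?leNgt// !measure0.
  rewrite (lebesgue_stieltjes_itv_oc _ (ltW xy))/= /mscale/=.
  by rewrite lebesgue_measure_itv/= lte_fin xy -EFinB -EFinM mulrBr.
have E12 : LS H3 A = measure_add (LS H1) (LS H2) A.
  apply: lebesgue_stieltjes_measure_unique => // X [[x y] _ <-]/=.
  have [yx|xy] := leP y x.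
    by rewrite set_itv_ge ?bnd_simp -?leNgt// !measure0.
  have e k := @lebesgue_stieltjes_itv_oc k _ _ (ltW xy).
  apply: etrans (e H3) (etrans _ (esym (etrans (measure_addE _ _ _)
    (f_equal2 +%E (e H1) (e H2))))).
  by rewrite -EFinD/=; congr _%:E; ring.
apply/eqP; rewrite eq_le measure_ge0 andbT.
apply: (@le_trans _ _ (LS H3 A)); last by rewrite E3 A0 mule0.
by rewrite E12; rewrite (_ : measure_add _ _ A = LS H1 A + LS H2 A)%E ?leeDl//; exact: measure_addE.
Qed.

End restricted.
End stieltjes.

(** * Differentiability in terms of increments *)

Section straddle.
Context {R : realType}.
Implicit Types (f : R -> R) (c t : R).

Lemma is_derive_approx f t c : is_derive t 1 f c -> forall eps, 0 < eps ->
  exists2 e : R, 0 < e & forall s, `|s - t| < e ->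
    `|f s - f t - c * (s - t)| <= eps * `|s - t|.
Proof.
move=> [df dfc] eps eps0.
have /cvgrPdist_le : h^-1 *: (f (h *: 1 + t) - f t) @[h --> 0^'] --> c.
  by rewrite -dfc; exact: df.
move=> /(_ _ eps0) [e /= e0 he]; exists e => // s st.
have [->|sn] := eqVneq s t; first by rewrite !subrr mulr0 subr0 normr0 mulr0.
have st0 : s - t != 0 by rewrite subr_eq0.
have := he (s - t); rewrite /ball_/= sub0r normrN => /(_ st st0).
rewrite -[_ *: 1]/(_ * _) mulr1 subrK -[_ *: _]/(_ * _) => h.
have -> : f s - f t - c * (s - t) = - (s - t) * (c - (s - t)^-1 * (f s - f t)).
  by field.
by rewrite normrM normrN mulrC ler_wpM2r.
Qed.

Lemma approx_is_derive f t c : (forall eps, 0 < eps ->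
  exists2 e : R, 0 < e & forall s, `|s - t| < e ->
    `|f s - f t - c * (s - t)| <= eps * `|s - t|) -> is_derive t 1 f c.
Proof.
move=> H.
have cv : h^-1 *: (f (h *: 1 + t) - f t) @[h --> 0^'] --> c.
  apply/cvgrPdist_le => eps /H[e e0 he]; exists e => //= h.
  rewrite /ball_/= sub0r normrN => hre h0.
  have := he (h + t); rewrite addrK => /(_ hre) le.
  rewrite -[_ *: 1]/(_ * _) mulr1 -[_ *: _]/(_ * _).
  have -> : c - h^-1 * (f (h + t) - f t) = - (f (h + t) - f t - c * h) / h by field.
  by rewrite normrM normrN normfV ler_pdivrMr// normr_gt0.
split; [by apply/cvg_ex; exists c | exact: cvg_lim].
Qed.

(** With [u <= t <= v] the errors [eps |v - t|] and [eps |u - t|] add up to [eps (v - u)]; for [u]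
    and [v] on one side of [t] they would not be controlled by [v - u]. *)
Lemma is_derive_straddle f t c : is_derive t 1 f c -> forall eps, 0 < eps ->
  exists2 e : R, 0 < e & forall u v, t - e < u -> u <= t -> t <= v -> v < t + e ->
    `|f v - f u - c * (v - u)| <= eps * (v - u).
Proof.
move=> /is_derive_approx H eps /H[e e0 he]; exists e => // u v tu ut tv ve.
have hu : `|u - t| < e by rewrite ltr_distl tu/=; lra.
have hv : `|v - t| < e by rewrite ltr_distl ve andbT; lra.
have := he _ hu; have := he _ hv.
rewrite (ger0_norm (_ : 0 <= v - t)) ?subr_ge0//.
rewrite (ler0_norm (_ : u - t <= 0)) ?subr_le0//.
move=> h1 h2; rewrite (_ : f v - f u - _ = (f v - f t - c * (v - t)) - (f u - f t - c * (u - t))); last by ring.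
rewrite (le_trans (ler_normB _ _))// (_ : v - u = (v - t) - (u - t)); last by ring.
by move: h1 h2; lra.
Qed.

Lemma is_derive_near f g t c (e : R) : 0 < e ->
  (forall s, t - e < s -> s < t + e -> f s = g s) ->
  is_derive t 1 f c -> is_derive t 1 g c.
Proof.
move=> e0 fg /is_derive_approx df; apply: approx_is_derive => eps /df[e1 e10 he].
exists (Num.min e e1); first by rewrite lt_min e0.
move=> s; rewrite lt_min => /andP[se se1].
rewrite -!fg; first exact: he.
- by rewrite ltrBlDr ltrDl.
- by rewrite ltrDl.
- by move: se; rewrite ltr_distl => /andP[].
- by move: se; rewrite ltr_distl => /andP[].
Qed.

End straddle.

(** * Radon-Nikodym densities and differentiability almost everywhere *)

Section ae_derivable.
Context {R : realType}.
Local Notation mu := (@lebesgue_measure R).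
Local Notation LS := lebesgue_stieltjes_measure.

(** [rho] is the Radon-Nikodym derivative of the restricted measure. Its integral over []0, s]] is
    [h s - h 0], so Lebesgue differentiation identifies it with the derivative of [h] almost
    everywhere. *)
Lemma lsm_density (h : cumulative R R) (T K : R) : 0 < T ->
  (forall u v, 0 <= u -> u <= v -> v <= T -> h v - h u <= K * (v - u)) ->
  exists rho : R -> R, [/\
    mu.-integrable `]0, T] (EFin \o rho),
    (forall E, measurable E -> E `<=` `]0, T]%classic ->
       LS h E = (\int[mu]_(t in E) (rho t)%:E)%E),
    (forall (E : set R) (f : R -> \bar R), measurable E -> E `<=` `]0, T]%classic ->
       (LS h).-integrable E f ->
       (\int[LS h]_(t in E) f t = \int[mu]_(t in E) (f t * (rho t)%:E))%E) &
    {ae mu, forall t, 0 < t < T -> is_derive t 1 (h : R -> R) (rho t)}].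
Proof.
move=> T0 hlip.
have T0' := ltW T0.
pose nu := lsm_restr h T0'.
have dom : nu `<< mu := lsm_restr_dominates T0' hlip.
pose r := Radon_Nikodym (charge_of_finite_measure nu) mu.
have rfin t : r t \is a fin_num by exact: Radon_Nikodym_fin_num.
have rint : mu.-integrable setT r by exact: Radon_Nikodym_integrable.
pose rho := fine \o r.
have rhoE : EFin \o rho = r by apply/funext => t /=; rewrite fineK.
have nuE E : measurable E -> nu E = (\int[mu]_(t in E) (rho t)%:E)%E.
  move=> mE.
  rewrite -[LHS]/(charge_of_finite_measure nu E).
  rewrite (@Radon_Nikodym_integral _ _ _ (charge_of_finite_measure nu) mu E dom mE).
  by apply: eq_integral => t _; rewrite /= fineK.
have nuS E : E `<=` `]0, T]%classic -> nu E = LS h E.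
  by move=> ET; rewrite /nu lsm_restrE (setIidl ET).
have rhoint : mu.-integrable `]0, T] (EFin \o rho).
  by rewrite rhoE; apply: (integrableS measurableT).
exists rho; split.
- exact: rhoint.
- by move=> E mE ET; rewrite -nuS// nuE.
- move=> E f mE ET fint.
  have eqm A : measurable A -> A `<=` E -> nu A = LS h A.
    by move=> mA AE; apply: nuS; exact: subset_trans ET.
  have fint' : nu.-integrable E f.
    move/integrableP : fint => [mf intf]; apply/integrableP; split => //.
    by rewrite (eq_measure_integral (LS h)).
  rewrite (eq_measure_integral nu); last by move=> A mA AE; exact: esym (eqm A mA AE).
  rewrite -(@Radon_Nikodym_change_of_variables _ _ _ nu mu dom f E mE fint').
  by apply: eq_integral => t _; rewrite /= fineK.
- have : locally_integrable setT (rho \_ `]0, T]).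
    by apply: integrable_locally => //; exact: measurable_itv.
  move/lebesgue_differentiation.
  apply: filterS; first exact: (ae_filter_ringOfSetsType mu).
  move=> t lt /andP[t0 tT].
  pose F y := (\int[mu]_(s in [set` `]0%R, y]]) (rho s))%R.
  have Irho : mu.-integrable `]0, T] (EFin \o (rho \_ `]0%R, T])).
    apply: (eq_integrable _ _ _ _ rhoint) => // s sT.
    by rewrite /= patchE sT.
  pose F1 y := (\int[mu]_(s in [set` `]0%R, y]]) ((rho \_ `]0%R, T]) s))%R.
  have [dF eF] := @FTC1_lebesgue_pt _ _ (BRight 0) t T tT Irho t0 lt.
  have dF1 : is_derive t 1 F1 (rho t).
    split => //; rewrite -derive1E eF patchE mem_set//=.
    by rewrite in_itv/= t0 ltW.
  have hF1 s : 0 <= s <= T -> F1 s = h s - h 0.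
    move=> /andP[s0 sT].
    have sub : `]0, s]%classic `<=` `]0, T]%classic by apply: subset_itvl.
    apply: EFin_inj; rewrite -(lebesgue_stieltjes_itv_oc h s0) -nuS// nuE//.
    rewrite /F1 /Rintegral fineK; last first.
      apply: integrable_fin_num => //; apply: integrableS Irho => //.
    apply: eq_integral => z; rewrite inE => zs.
    by rewrite patchE mem_set//; exact: sub.
  pose e := Num.min t (T - t).
  have e0 : 0 < e by rewrite lt_min t0 subr_gt0.
  have et : e <= t by rewrite ge_min lexx.
  have eT : e <= T - t by rewrite ge_min lexx orbT.
  have near_h s : t - e < s -> s < t + e -> F1 s + h 0 = h s.
    by move=> s1 s2; rewrite hF1 ?subrK//; lra.
  apply: (is_derive_near e0 near_h).
  rewrite -[rho t]addr0; apply: is_deriveD.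
Qed.
End ae_derivable.

(** * Locally Lipschitz functions *)

Section ae.
Context d (T : measurableType d) (R : realType) (m : {measure set T -> \bar R}).

Lemma ae_imply (P Q : T -> Prop) : {ae m, forall t, P t} ->
  (forall t, P t -> Q t) -> {ae m, forall t, Q t}.
Proof. by move=> aeP PQ; apply: negligibleS aeP => t /= nQ /PQ. Qed.

Lemma ae_imply2 (P P' Q : T -> Prop) :
  {ae m, forall t, P t} -> {ae m, forall t, P' t} ->
  (forall t, P t -> P' t -> Q t) -> {ae m, forall t, Q t}.
Proof.
move=> aeP aeP' PQ; apply: negligibleS (negligibleU aeP aeP') => t /= nQ.
by apply: contrapT => /not_orP[/contrapT Pt /contrapT P't]; exact/nQ/PQ.
Qed.

End ae.

Section loclip.
Context {R : realType}.
Local Notation mu := (@lebesgue_measure R).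
Implicit Types f g : R -> R.

Definition loclip f := forall T : R, exists K : R, forall u v,
  0 <= u -> u <= v -> v <= T -> `|f v - f u| <= K * (v - u).

Lemma loclip_ge0 f : loclip f -> forall T : R, exists2 K : R, 0 <= K & forall u v,
  0 <= u -> u <= v -> v <= T -> `|f v - f u| <= K * (v - u).
Proof.
move=> lf T; have [K hK] := lf T; exists `|K| => // u v u0 uv vT.
by rewrite (le_trans (hK _ _ u0 uv vT))// ler_wpM2r ?subr_ge0// ler_norm.
Qed.

Lemma loclip_cst c : loclip (fun=> c).
Proof. by move=> T; exists 0 => u v _ _ _; rewrite subrr normr0 mul0r. Qed.

Lemma loclipD f g : loclip f -> loclip g -> loclip (fun t => f t + g t).
Proof.
move=> lf lg T; have [K hK] := lf T; have [K' hK'] := lg T.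
exists (K + K') => u v u0 uv vT.
rewrite (_ : _ - _ = (f v - f u) + (g v - g u)); last by ring.
by rewrite mulrDl (le_trans (ler_normD _ _))// lerD ?hK ?hK'.
Qed.

Lemma loclipN f : loclip f -> loclip (fun t => - f t).
Proof.
move=> lf T; have [K hK] := lf T; exists K => u v u0 uv vT.
by rewrite -opprD normrN hK.
Qed.

Lemma loclipB f g : loclip f -> loclip g -> loclip (fun t => f t - g t).
Proof. by move=> lf /loclipN; exact: loclipD. Qed.

Lemma loclipZ c f : loclip f -> loclip (fun t => c * f t).
Proof.
move=> lf T; have [K hK] := lf T; exists (`|c| * K) => u v u0 uv vT.
by rewrite -mulrBr normrM -mulrA ler_wpM2l ?hK.
Qed.

Lemma loclip_sum n (f : 'I_n -> R -> R) : (forall i, loclip (f i)) ->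
  loclip (fun t => \sum_(i < n) f i t).
Proof.
move=> lf T; pose K i := sval (cid (lf i T)).
exists (\sum_(i < n) K i) => u v u0 uv vT.
rewrite -sumrB mulr_suml (le_trans (ler_norm_sum _ _ _))//; apply: ler_sum => i _.
exact: (svalP (cid (lf i T))).
Qed.

Lemma loclip_near f t : loclip f -> 0 <= t -> exists2 K : R, 0 < K &
  forall s, 0 <= s -> s <= t + 1 -> `|f s - f t| <= K * `|s - t|.
Proof.
move=> /loclip_ge0 lf t0; have [K K0 hK] := lf (t + 1).
exists (K + 1) => [|s s0 st]; first by rewrite ltr_wpDl.
apply: (@le_trans _ _ (K * `|s - t|)); last by rewrite ler_wpM2r// lerDl.
have [ts|/ltW ts] := leP t s.
  by rewrite (ger0_norm (_ : 0 <= s - t)) ?subr_ge0//; exact: hK.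
rewrite distrC (distrC s) (ger0_norm (_ : 0 <= t - s)) ?subr_ge0//; apply: hK => //.
by rewrite lerDl.
Qed.

Lemma loclip_continuous f : loclip f -> continuous (fun t : R => f (Num.max 0 t)).
Proof.
move=> lf x; apply/cvgrPdist_le => e e0.
have x0 : 0 <= Num.max 0 x by rewrite le_max lexx.
have [K K0 hK] := loclip_near lf x0.
exists (Num.min 1 (e / K)) => /=; first by rewrite lt_min ltr01 divr_gt0.
move=> y /=; rewrite lt_min => /andP[y1 ye].
have mm : `|Num.max 0 y - Num.max 0 x| <= `|x - y|.
  rewrite (distrC x); case: (leP 0 y) => ?; case: (leP 0 x) => ?;
  rewrite ?subrr ?normr0// ?subr0 ?sub0r ?normrN.
    by rewrite (ger0_norm (_ : 0 <= y))//; have := ler_norm (y - x); lra.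
  by rewrite (ger0_norm (_ : 0 <= x))// distrC; have := ler_norm (x - y); lra.
rewrite distrC (le_trans (hK _ _ _))//.
- by rewrite le_max lexx.
- have := le_lt_trans mm y1; rewrite ltr_distl => /andP[_ /ltW]; lra.
- by rewrite mulrC -ler_pdivlMr// (le_trans mm)// ltW.
Qed.

Lemma ae_neq (c : R) : {ae mu, forall t, t != c}.
Proof.
exists [set c]; split; [exact: measurable_set1 | exact: lebesgue_measure_set1|].
by move=> t /= /negP; rewrite negbK => /eqP.
Qed.

(** Rademacher in dimension one: adding [K t] to [f] and freezing outside [[0, T]] gives a
    nondecreasing function with Lipschitz constant [2 K], which [lsm_density] differentiates. *)
Lemma loclip_ae_derivable f : loclip f -> {ae mu, forall t, 0 < t -> derivable f t 1}.
Proof.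
move=> lf.
have : forall n : nat, {ae mu, forall t, 0 < t < n.+1%:R -> derivable f t 1}.
  move=> n; pose T : R := n.+1%:R.
  have T0 : 0 < T by rewrite ltr0n.
  have [K K0 hK] := loclip_ge0 lf T.
  pose h t := f (clamp T t) + K * clamp T t.
  have hlip u v : u <= v -> 0 <= h v - h u <= (2 * K) * (v - u).
    move=> uv; have /andP[c0 c1] := clamp_lip (ltW T0) uv; rewrite subr_ge0 in c0.
    have /andP[cu0 cuT] := clamp_in u (ltW T0); have /andP[cv0 cvT] := clamp_in v (ltW T0).
    have := hK _ _ cu0 c0 cvT; rewrite ler_norml => /andP[l1 l2].
    have := ler_wpM2l K0 c1.
    by rewrite /h; move: l1 l2; set x := clamp T u; set y := clamp T v; lra.
  have [//|u v _ uv _|rho [_ _ _ ae]] := @lsm_density _ (lipschitz_cumulative hlip) T (2 * K).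
    by have /andP[_] := hlip u v uv.
  apply: (ae_imply ae) => t ae_t ht; have dh := ae_t ht; move: ht => /andP[t0 tT].
  have : is_derive t 1 f (rho t - K * 1).
    pose e := Num.min t (T - t).
    have e0 : 0 < e by rewrite lt_min t0 subr_gt0.
    have et : e <= t by rewrite ge_min lexx.
    have eT : e <= T - t by rewrite ge_min lexx orbT.
    have near_h s : t - e < s -> s < t + e -> h s - K * s = f s.
      by move=> s1 s2; rewrite /h clamp_id ?addrK//; lra.
    by apply: (is_derive_near e0 near_h).
  by case.
move=> /ae_foralln aeN.
apply: (ae_imply aeN) => t ht t0; apply: (ht (Num.trunc t)).
by rewrite t0 /=; have /andP[_] := Num.Theory.truncn_itv (ltW t0).
Qed.

(** The comparison principle is applied to [f - g] against the zero function; the end points join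
    the exceptional null set. *)
Lemma loclip_le_itv f g (a b : R) : loclip f -> loclip g -> 0 <= a -> a <= b ->
  {ae mu, forall t : R, a < t < b ->
    exists c c', [/\ is_derive t 1 f c, is_derive t 1 g c' & c <= c']} ->
  f b - f a <= g b - g a.
Proof.
move=> lf lg a0 ab h.
suff : (f b - g b) - (f a - g a) <= 0 - 0 by lra.
apply: (@abs_continuous_local_to_global_le _ (fun t => f t - g t) (fun=> 0)) => //.
  have [K hK] := loclipB lf lg b.
  apply: (@lipschitz_abs_continuous _ _ _ _ K) => u v au uv vb.
  by apply: hK => //; exact: le_trans au.
have hab : {ae mu, forall t : R, t != a /\ t != b}.
  by apply: (ae_imply2 (ae_neq a) (ae_neq b)).
apply: (ae_imply2 h hab) => t {}h [ta tb] /andP[at_ bt] eps eps0.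
have tab : a < t < b by rewrite !lt_neqAle at_ bt eq_sym ta tb.
have [c [c' [dc dc' cc']]] := h tab.
have d : is_derive t 1 (fun t => f t - g t) (c - c') by exact: is_deriveB.
have [e e0 he] := is_derive_straddle d eps0.
exists e => // u v _ _ tu ut tv ve.
have := he _ _ tu ut tv ve; rewrite ler_norml => /andP[_ h2].
have : (c - c') * (v - u) <= 0.
  by rewrite mulr_le0_ge0 ?subr_le0// subr_ge0 (le_trans ut).
lra.
Qed.

Lemma loclip_le f g : loclip f -> loclip g ->
  {ae mu, forall t : R, 0 < t -> exists c c', [/\ is_derive t 1 f c, is_derive t 1 g c' & c <= c']} ->
  forall a b, 0 <= a -> a <= b -> f b - f a <= g b - g a.
Proof.
move=> lf lg h a b a0 ab; apply: loclip_le_itv => //.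
by apply: (ae_imply h) => t {}h /andP[at_ _]; apply: h; exact: le_lt_trans at_.
Qed.

Lemma loclip_eq f g : loclip f -> loclip g ->
  {ae mu, forall t : R, 0 < t -> exists2 c, is_derive t 1 f c & is_derive t 1 g c} ->
  forall a b, 0 <= a -> a <= b -> f b - f a = g b - g a.
Proof.
move=> lf lg h a b a0 ab; apply/eqP; rewrite eq_le; apply/andP; split;
  apply: loclip_le => //; apply: (ae_imply h) => t {}h /h[c ? ?]; by exists c, c.
Qed.

End loclip.

(** * Primitives of locally bounded functions *)

Section primitive.
Context {R : realType}.
Local Notation mu := (@lebesgue_measure R).
Implicit Types f g : R -> R.

Definition locbdd g := forall T : R, exists K : R, forall t : R, 0 <= t <= T -> `|g t| <= K.

Lemma locbdd_integrable g (i : interval R) T : measurable_fun setT g -> locbdd g ->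
  [set` i] `<=` `[0, T]%classic -> mu.-integrable [set` i] (EFin \o g).
Proof.
move=> mg bg sub; have [K hK] := bg T.
have muT : (mu `[0%R, T]%classic < +oo)%E.
  by rewrite lebesgue_measure_itv/=; case: ifP => // _; rewrite -EFinB ltry.
apply: (@integrableS _ (measurableTypeR R) R mu `[0, T]%classic) => //.
apply: measurable_bounded_integrable => //.
- exact: measurable_funTS.
- exists K; split; first exact: num_real.
  move=> M KM t /=; rewrite in_itv/= => tT.
  by rewrite (le_trans (hK _ tT))// ltW.
Qed.

Section primitive_fixed.
Variable g : R -> R.
Hypotheses (mg : measurable_fun setT g) (bg : locbdd g).

Definition primitive t : R := (\int[mu]_(s in `[0, t]) g s)%R.

Lemma primitive_loclip : loclip primitive.
Proof.
move=> T; have [K hK] := bg T; exists K => u v u0 uv vT.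
have intv : mu.-integrable `[0, v] (EFin \o g) by exact: (locbdd_integrable mg bg (fun _ => id)).
have sub : `]u, v]%classic `<=` `[0, v]%classic.
  by apply: subset_itvr; rewrite bnd_simp.
have intuv : mu.-integrable `]u, v] (EFin \o g) by exact: (locbdd_integrable mg bg sub).
have muuv : mu `]u, v]%classic = (v - u)%:E.
  rewrite lebesgue_measure_itv/= lte_fin; case: ltP => //= vu.
  have -> : v = u by apply/le_anti/andP; split.
  by rewrite subrr.
rewrite /primitive Rintegral_itvB// ?bnd_simp//.
apply: (le_trans (le_normr_Rintegral _ intuv)) => //.
apply: (@le_trans _ _ (\int[mu]_(s in `]u, v]) K)).
  apply: le_Rintegral => //.
  - exact: integrable_norm.
  - apply: measurable_bounded_integrable => //.
      by rewrite (_ : (_ < _)%E = (mu `]u, v]%classic < +oo)%E)// muuv ltry.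
    by exists `|K|; split; [exact: num_real | move=> M /ltW KM t _ /=].
  - move=> s /=; rewrite in_itv/= => /andP[us sv].
    by apply: hK; rewrite (le_trans sv vT) andbT (le_trans u0)// ltW.
by rewrite Rintegral_cst// [X in fine X](_ : _ = (v - u)%:E).
Qed.

Lemma primitive0 : primitive 0 = 0.
Proof. by rewrite /primitive set_itv1 Rintegral_set1. Qed.

Lemma primitive_lt0 t : t < 0 -> primitive t = 0.
Proof.
by move=> t0; rewrite /primitive set_itv_ge ?Rintegral_set0// bnd_simp -ltNge.
Qed.

Lemma primitive_is_derive : {ae mu, forall t : R, 0 < t -> is_derive t 1 primitive (g t)}.
Proof.
have : forall n : nat, {ae mu, forall t : R, 0 < t < n.+1%:R -> is_derive t 1 primitive (g t)}.
  move=> n; pose T : R := n.+1%:R.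
  have T0 : 0 < T by rewrite ltr0n.
  have gint : mu.-integrable `[0, T] (EFin \o g) by exact: (locbdd_integrable mg bg (fun _ => id)).
  have : locally_integrable setT (g \_ `[0, T]).
    by apply: integrable_locally => //; exact: measurable_itv.
  move/lebesgue_differentiation => ae; apply: (ae_imply ae) => t lt /andP[t0 tT].
  have Ig : mu.-integrable `[0, T] (EFin \o (g \_ `[0%R, T])).
    apply: (eq_integrable _ _ _ _ gint) => // s sT.
    by rewrite /= patchE sT.
  pose F1 y := (\int[mu]_(s in [set` `[0%R, y]]) ((g \_ `[0%R, T]) s))%R.
  have [dF eF] := @FTC1_lebesgue_pt _ _ (BLeft 0) t T tT Ig t0 lt.
  have dF1 : is_derive t 1 F1 (g t).
    split => //; rewrite -derive1E eF patchE mem_set//=.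
    by rewrite in_itv/= !ltW.
  have hF1 s : s <= T -> F1 s = primitive s.
    move=> sT; apply: eq_Rintegral => z; rewrite inE => zs.
    rewrite patchE mem_set//; move: zs => /=; rewrite !in_itv/= => /andP[-> zs].
    exact: le_trans sT.
  have e0 : 0 < T - t by rewrite subr_gt0.
  apply: (is_derive_near e0 _ dF1) => s s1 s2; apply: hF1; lra.
move=> /ae_foralln aeN; apply: (ae_imply aeN) => t ht t0; apply: (ht (Num.trunc t)).
by rewrite t0 /=; have /andP[_] := Num.Theory.truncn_itv (ltW t0).
Qed.

End primitive_fixed.

Lemma is_derive_bound f (t c K e : R) : 0 < e -> is_derive t 1 f c ->
  (forall s, t <= s -> s < t + e -> `|f s - f t| <= K * (s - t)) -> `|c| <= K.
Proof.
move=> e0 dc h; apply/ler_addgt0Pr => eps eps0.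
have [d d0 hd] := is_derive_approx dc eps0.
pose s := t + Num.min e d / 2.
have m0 : 0 < Num.min e d by rewrite lt_min e0.
have me : Num.min e d <= e by rewrite ge_min lexx.
have md : Num.min e d <= d by rewrite ge_min lexx orbT.
have st : s - t = Num.min e d / 2 by rewrite /s; ring.
have st0 : 0 < s - t by rewrite st divr_gt0.
have l1 : `|f s - f t - c * (s - t)| <= eps * (s - t).
  by rewrite -{2}(gtr0_norm st0); apply: hd; rewrite gtr0_norm// st; lra.
have l2 : `|f s - f t| <= K * (s - t) by apply: h; rewrite /s; lra.
rewrite -(ler_pM2r st0) -{1}(gtr0_norm st0) -normrM.
rewrite (_ : c * (s - t) = (f s - f t) - (f s - f t - c * (s - t))); last by ring.
by rewrite (le_trans (ler_normB _ _))// mulrDl lerD.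
Qed.

(** [g] is the derivative off a measurable null set and 0 on it. It is measurable as a limit of
    difference quotients, and its primitive has almost everywhere the same derivative as [f]. *)
Lemma loclip_density f : loclip f -> exists g : R -> R, [/\
  measurable_fun setT g, locbdd g,
  {ae mu, forall t : R, 0 < t -> is_derive t 1 f (g t)} &
  forall t, 0 <= t -> f t - f 0 = primitive g t].
Proof.
move=> lf; have [N [mN N0 subN]] := loclip_ae_derivable lf.
pose A : set R := `]0, +oo[%classic `\` N.
have mA : measurable A by apply: measurableD.
pose g t := \1_A t * 'D_1 f t.
have Ad t : A t -> 0 < t /\ derivable f t 1.
  move=> [/=]; rewrite in_itv/= andbT => t0 Nt; split => //.
  by apply: contrapT => nd; apply: Nt; apply: subN => /= /(_ t0).
have gA t : A t -> is_derive t 1 f (g t).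
  by move=> At; have [_ dt] := Ad t At; rewrite /g indicE mem_set// mul1r; exact/derivableP.
have nA t : ~ A t -> g t = 0.
  by move=> nAt; rewrite /g indicE memNset// mul0r.
have mg : measurable_fun setT g.
  (* Forward difference quotients with step [1 / (n + 1)]; [Num.max 0] extends [f] continuously to
     the whole line. *)
  pose u (n : nat) t := \1_A t * (n.+1%:R * (f (Num.max 0 (t + n.+1%:R^-1)) - f (Num.max 0 t))).
  apply: (@measurable_fun_cvg _ _ _ _ u) => [n|t _].
    apply: measurable_funM; first exact: measurable_indic.
    apply: measurable_funM => //.
    apply: measurable_funB; last first.
      by apply: continuous_measurable_fun; exact: loclip_continuous.
    apply: continuous_measurable_fun => x.
    have cs : {for x, continuous (fun y : R => y + n.+1%:R^-1)}.
      by apply: cvgD => //; exact: cvg_cst.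
    have cf : {for x + n.+1%:R^-1, continuous (fun t : R => f (Num.max 0 t))}.
      exact: loclip_continuous.
    exact: (continuous_comp cs cf).
  have [At|nAt] := pselect (A t); last first.
    rewrite nA// /u; apply: cvg_near_cst; apply: nearW => n.
    by rewrite indicE memNset// mul0r.
  have [t0 _] := Ad t At; have dg := gA t At.
  apply/cvgrPdist_le => eps eps0.
  have [e e0 he] := is_derive_approx dg (divr_gt0 eps0 (ltr0Sn _ 1)).
  near=> n.
  have n0 : 0 < n.+1%:R^-1 :> R by rewrite invr_gt0.
  rewrite /u indicE mem_set// mul1r !max_r ?ltW// ?addr_gt0//.
  have ne : n.+1%:R^-1 < e by near: n; exact: near_infty_natSinv_lt (PosNum e0).
  have n1 : n.+1%:R * n.+1%:R^-1 = 1 :> R by rewrite mulfV.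
  set dl : R := n.+1%:R^-1 in n0 ne n1 *.
  have dE : t + dl - t = dl by ring.
  have := he (t + dl); rewrite dE (gtr0_norm n0) => /(_ ne) h.
  have -> : g t - n.+1%:R * (f (t + dl) - f t) =
    - n.+1%:R * (f (t + dl) - f t - g t * dl) + g t * (1 - n.+1%:R * dl) by ring.
  rewrite n1 subrr mulr0 addr0 normrM normrN (ger0_norm (ler0n _ _)).
  apply: le_lt_trans (ler_wpM2l (ler0n _ _) h) _.
  by rewrite mulrCA n1 mulr1 ltr_pdivrMr// ltr_pMr// ltr1n.
have bg : locbdd g.
  move=> T; have [K K0 hK] := loclip_ge0 lf (T + 1).
  exists K => t /andP[t0 tT].
  have [At|nAt] := pselect (A t); last by rewrite nA// normr0.
  apply: (is_derive_bound ltr01 (gA t At)) => s ts s1.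
  by apply: hK => //; lra.
have dfg : {ae mu, forall t : R, 0 < t -> is_derive t 1 f (g t)}.
  exists N; split => // t /= /not_implyP[t0 nd].
  apply: contrapT => Nt; apply: nd; apply: gA; split => //=.
  by rewrite in_itv/= t0.
exists g; split => // t t0.
rewrite (@loclip_eq _ _ (primitive g) lf (primitive_loclip mg bg) _ 0 t)//.
  by rewrite primitive0 subr0.
apply: (ae_imply2 dfg (primitive_is_derive mg bg)) => s h1 h2 s0.
by exists (g s); [exact: h1 | exact: h2].
Unshelve. all: by end_near. Qed.

End primitive.

(** * Euclidean norm, normals and tangent cones *)

Section euclid.
Context {R : realType} {d : nat}.
Implicit Types (u v w : 'cV[R]_d) (c : R).

Lemma dotC u v : dot u v = dot v u.
Proof. by apply: eq_bigr => i _; rewrite mulrC. Qed.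

Lemma dotDl u v w : dot (u + v) w = dot u w + dot v w.
Proof. by rewrite -big_split; apply: eq_bigr => i _; rewrite mxE mulrDl. Qed.

Lemma dotNl u v : dot (- u) v = - dot u v.
Proof. by rewrite -sumrN; apply: eq_bigr => i _; rewrite mxE mulNr. Qed.

Lemma dotZl c u v : dot (c *: u) v = c * dot u v.
Proof. by rewrite mulr_sumr; apply: eq_bigr => i _; rewrite mxE mulrA. Qed.

Lemma dotBl u v w : dot (u - v) w = dot u w - dot v w.
Proof. by rewrite dotDl dotNl. Qed.

Lemma dotDr u v w : dot w (u + v) = dot w u + dot w v.
Proof. by rewrite ![dot w _]dotC dotDl. Qed.

Lemma dotNr u v : dot v (- u) = - dot v u.
Proof. by rewrite ![dot v _]dotC dotNl. Qed.

Lemma dotZr c u v : dot v (c *: u) = c * dot v u.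
Proof. by rewrite ![dot v _]dotC dotZl. Qed.

Lemma dotBr u v w : dot w (u - v) = dot w u - dot w v.
Proof. by rewrite dotDr dotNr. Qed.

Lemma dot0l u : dot 0 u = 0.
Proof. by rewrite -(subrr 0) dotBl subrr. Qed.

Lemma dot0r u : dot u 0 = 0.
Proof. by rewrite dotC dot0l. Qed.

Definition dotE := (dotDl, dotDr, dotBl, dotBr, dotNl, dotNr, dotZl, dotZr, dot0l, dot0r).

Lemma dot_ge0 u : 0 <= dot u u.
Proof. by apply: sumr_ge0 => i _; rewrite -expr2 sqr_ge0. Qed.

Lemma enorm_ge0 u : 0 <= enorm u.
Proof. exact: sqrtr_ge0. Qed.

Lemma enorm_sqr u : enorm u ^+ 2 = dot u u.
Proof. by rewrite sqr_sqrtr// dot_ge0. Qed.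

Lemma coord_sqr_le u i : u i 0 ^+ 2 <= dot u u.
Proof.
rewrite /dot (bigD1 i)//= expr2 lerDl.
by apply: sumr_ge0 => j _; rewrite -expr2 sqr_ge0.
Qed.

Lemma coord_le_enorm u i : `|u i 0| <= enorm u.
Proof.
by rewrite -sqrtr_sqr ler_sqrt ?coord_sqr_le// dot_ge0.
Qed.

Lemma enorm0 : enorm (0 : 'cV[R]_d) = 0.
Proof. by rewrite /enorm dot0l sqrtr0. Qed.

Lemma enorm_eq0 u : enorm u = 0 -> u = 0.
Proof.
move=> u0; apply/matrixP => i j; rewrite (ord1 j) mxE.
by apply/normr0_eq0/le_anti; rewrite normr_ge0 andbT -u0 coord_le_enorm.
Qed.

Lemma enorm_gt0 u : u != 0 -> 0 < enorm u.
Proof.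
by move=> u0; rewrite lt_neqAle enorm_ge0 andbT eq_sym; apply: contra u0 => /eqP/enorm_eq0 ->.
Qed.

Lemma enormZ c u : enorm (c *: u) = `|c| * enorm u.
Proof.
by rewrite /enorm !dotE mulrA -expr2 sqrtrM ?sqr_ge0// sqrtr_sqr.
Qed.

Lemma enormN u : enorm (- u) = enorm u.
Proof. by rewrite /enorm !dotE opprK. Qed.

Lemma enormBC u v : enorm (u - v) = enorm (v - u).
Proof. by rewrite -enormN opprB. Qed.

Lemma cauchy_schwarz u v : `|dot u v| <= enorm u * enorm v.
Proof.
suff h (x y : 'cV[R]_d) : dot x y <= enorm x * enorm y.
  by rewrite ler_norml h andbT lerNl -dotNl (le_trans (h _ _))// enormN.
have [->|x0] := eqVneq x 0; first by rewrite dot0l enorm0 mul0r.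
have [->|y0] := eqVneq y 0; first by rewrite dot0r enorm0 mulr0.
have := dot_ge0 (enorm y *: x - enorm x *: y).
rewrite !dotE (dotC y x) -!enorm_sqr.
have xy : 0 < enorm x * enorm y by rewrite mulr_gt0 ?enorm_gt0.
move=> h; rewrite -subr_ge0 -(pmulr_rge0 _ xy); nra.
Qed.

Lemma enorm_triangle u v : enorm (u + v) <= enorm u + enorm v.
Proof.
rewrite -(ler_pXn2r (n := 2)) ?nnegrE ?addr_ge0 ?enorm_ge0//.
rewrite enorm_sqr !dotE (dotC v u) sqrrD !enorm_sqr.
have := le_trans (ler_norm _) (cauchy_schwarz u v); lra.
Qed.

Lemma enorm_triangleB u v : enorm (u - v) <= enorm u + enorm v.
Proof. by rewrite (le_trans (enorm_triangle _ _))// enormN. Qed.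

Lemma enorm_le_sum u : enorm u <= \sum_(i < d) `|u i 0|.
Proof.
rewrite -(ler_pXn2r (n := 2)) ?nnegrE ?enorm_ge0 ?sumr_ge0//.
rewrite enorm_sqr expr2 mulr_suml; apply: ler_sum => i _.
rewrite (le_trans (ler_norm _))// normrM.
by rewrite ler_wpM2l// (bigD1 i)//= lerDl sumr_ge0.
Qed.

Lemma enorm_sum_le n (F : 'I_n -> 'cV[R]_d) :
  enorm (\sum_(i < n) F i) <= \sum_(i < n) enorm (F i).
Proof.
elim: n F => [F|n IH F]; first by rewrite !big_ord0 enorm0.
by rewrite !big_ord_recr/= (le_trans (enorm_triangle _ _))// lerD2r.
Qed.

Lemma mxnorm_le_enorm u : `|u| <= enorm u.
Proof.
rewrite /Num.Def.normr/= mx_normrE; apply: bigmax_le; first exact: enorm_ge0.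
by move=> [i j] _ /=; rewrite (ord1 j) coord_le_enorm.
Qed.

Lemma coord_le_mxnorm u i : `|u i 0| <= `|u|.
Proof.
rewrite [leRHS]/Num.Def.normr/= mx_normrE.
exact: (le_bigmax_cond _ (fun ij : 'I_d * 'I_1 => `|u ij.1 ij.2|) (j := (i, 0))).
Qed.

Lemma enorm_le_mxnorm u : enorm u <= d%:R * `|u|.
Proof.
rewrite (le_trans (enorm_le_sum _))//.
apply: (@le_trans _ _ (\sum_(i < d) `|u|)).
  by apply: ler_sum => i _; exact: coord_le_mxnorm.
by rewrite sumr_const card_ord mulr_natl.
Qed.

(** Transposition carries the Heine-Borel theorem over from row vectors. *)
Lemma closed_bounded_compact (A : set 'cV[R]_d) : closed A -> bounded_set A ->
  compact A.
Proof.
move=> cA bA.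
have cT m n : continuous (fun M : 'M[R]_(m, n) => M^T).
  move=> M s /= /nbhs_ballP[e e0 es]; apply/nbhs_ballP; exists e => //= N [? MN].
  by apply: es; split => // i j; rewrite !mxE; exact: MN.
have -> : A = trmx @` [set v : 'rV[R]_d | A v^T].
  apply/seteqP; split => [x Ax|x [v Av <-]//]; exists x^T => //=; by rewrite trmxK.
apply: continuous_compact; first exact/continuous_subspaceT/cT.
apply: bounded_closed_compact.
  move: bA => [M [Mr hM]]; exists M; split => // N MN v /= Av.
  have := hM N MN _ Av; rewrite /Num.Def.normr/= !mx_normrE => h.
  apply: bigmax_le => [|[i j] _ /=].
    by apply: le_trans h; exact: bigmax_ge_id.
  apply: le_trans h.
  have -> : v i j = v^T j i by rewrite mxE.
  exact: (le_bigmax_cond _ (fun ij : 'I_d * 'I_1 => `|v^T ij.1 ij.2|) (j := (j, i))).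
by apply: (@preimage_closed _ _ (fun v : 'rV[R]_d => v^T)) => // v _; exact: cT.
Qed.

End euclid.

Section euclid_topology.
Context {R : realType} {d : nat}.
Implicit Types (u v x y z : 'cV[R]_d) (A D : set 'cV[R]_d).

Lemma nbhs_enormP x A : nbhs x A <->
  exists2 e : R, 0 < e & forall y, enorm (y - x) < e -> A y.
Proof.
split.
- move=> /nbhs_ballP[e /= e0 he]; exists e => // y ye; apply: he.
  rewrite -ball_normE/= distrC; exact: le_lt_trans (mxnorm_le_enorm _) ye.
- move=> [e e0 he]; apply/nbhs_ballP; exists (e / (d%:R + 1)) => /=.
    by rewrite divr_gt0// ltr_wpDl.
  move=> y; rewrite -ball_normE/= distrC => ye; apply: he.
  apply: le_lt_trans (enorm_le_mxnorm _) _.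
  apply: (@le_lt_trans _ _ ((d%:R + 1) * `|y - x|)).
    by rewrite ler_wpM2r// lerDl.
  by rewrite mulrC -ltr_pdivlMr// ltr_wpDl.
Qed.

Lemma enorm_lip_continuous (f : 'cV[R]_d -> R) (K : R) :
  (forall x y, `|f x - f y| <= K * enorm (x - y)) -> continuous f.
Proof.
move=> h x A /nbhs_ballP[e /= e0 he].
apply/nbhs_enormP; exists (e / (`|K| + 1)) => [|y yx].
  by rewrite divr_gt0// ltr_wpDl.
apply: he; rewrite /ball/=; apply: le_lt_trans (h _ _) _; rewrite enormBC.
apply: (@le_lt_trans _ _ ((`|K| + 1) * enorm (y - x))).
  by rewrite ler_wpM2r ?enorm_ge0//; have := ler_norm K; lra.
by rewrite mulrC -ltr_pdivlMr ?ltr_wpDl.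
Qed.

Lemma enorm_dist x y : `|enorm x - enorm y| <= enorm (x - y).
Proof.
rewrite ler_norml; apply/andP; split.
  have := enorm_triangle (y - x) x; rewrite subrK enormBC; lra.
by have := enorm_triangle (x - y) y; rewrite subrK; lra.
Qed.

Lemma continuous_enormB y : continuous (fun x => enorm (x - y)).
Proof.
apply: (@enorm_lip_continuous _ 1) => u v; rewrite mul1r.
by apply: le_trans (enorm_dist _ _) _; rewrite opprB addrA subrK.
Qed.

Lemma continuous_dotB y z : continuous (fun x => dot (x - y) z).
Proof.
apply: (@enorm_lip_continuous _ (enorm z)) => u v.
by rewrite -dotBl opprB addrA subrK mulrC cauchy_schwarz.
Qed.

Lemma closure_enormP A x : closure A x <->
  forall e : R, 0 < e -> exists2 y, A y & enorm (y - x) < e.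
Proof.
split=> [cA e e0|h B /nbhs_enormP[e /h[y Ay yx] he]].
  have [|y [Ay ye]] := cA [set y | enorm (y - x) < e].
    by apply/nbhs_enormP; exists e.
  by exists y.
by exists y; split => //; exact: he.
Qed.

Lemma nearest_point D z : D !=set0 -> closed D -> bounded_set D ->
  exists2 p, D p & forall y, D y -> enorm (p - z) <= enorm (y - z).
Proof.
move=> D0 cD bD.
have cpt := closed_bounded_compact cD bD.
have [p pD hp] := compact_EVT_min D0 cpt (continuous_subspaceT (@continuous_enormB z)).
by exists p; [rewrite inE in pD | move=> y yD; apply: hp; rewrite inE].
Qed.

Lemma edist_to_ge0 D z : 0 <= edist_to D z.
Proof.
have [[y Dy]|D0] := pselect (D !=set0).
  apply: lb_le_inf; first by exists (enorm (y - z)), y.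
  by move=> _ [x _ <-]; exact: enorm_ge0.
rewrite /edist_to (_ : [set _ | _ in _] = set0) ?inf0//.
by apply/seteqP; split => // t [x Dx _]; exfalso; apply: D0; exists x.
Qed.

(** The lower limit is 0 exactly when ratios below every [eps] occur for arbitrarily small [h];
    [D !=set0] turns the infimum into a point of [D], since the infimum of the empty set is 0. *)
Lemma tangent_coneP D z v : D !=set0 -> tangent_cone D z v <->
  forall eps delta : R, 0 < eps -> 0 < delta -> exists2 h : R, 0 < h < delta &
    exists2 y, D y & enorm (y - (z + h *: v)) < eps * h.
Proof.
move=> D0; rewrite /tangent_cone /= limf_einfE.
set f := fun h : R => (edist_to D (z + h *: v) / h)%:E.
have near_delta (delta : R) : 0 < delta -> (0 : R)^'+ [set h : R | 0 < h < delta].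
  move=> delta0; exists delta; first exact: delta0.
  move=> h /=; rewrite sub0r normrN => hd h0.
  by rewrite h0/=; rewrite gtr0_norm in hd.
split=> [sup0 eps delta eps0 delta0|h].
  have : (ereal_inf (f @` [set h : R | (0 < h < delta)%R]) < eps%:E)%E.
    apply: (@le_lt_trans _ _ 0%E); last by rewrite lte_fin.
    rewrite -sup0; apply: ereal_sup_ubound.
    by exists [set h : R | 0 < h < delta] => //; exact: near_delta.
  move=> /ereal_inf_lt[_ [h hd <-]]; rewrite lte_fin => fh.
  have h0 : 0 < h by case/andP: hd.
  exists h => //; move: fh; rewrite ltr_pdivrMr// => /inf_lt[].
    by case: D0 => y Dy; exists (enorm (y - (z + h *: v))), y.
  by move=> _ [y Dy <-] lt; exists y.
apply/le_anti/andP; split.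
  apply: ge_ereal_sup => _ [V /= VF <-].
  apply/lee_addgt0Pr => eps eps0; rewrite add0e.
  have [delta /= delta0 hdelta] := VF.
  have [s /andP[s0 sd] [y Dy yz]] := h _ _ eps0 delta0.
  apply: (@le_trans _ _ (f s)).
    apply: ereal_inf_lbound; exists s => //; apply: hdelta => //=.
    by rewrite sub0r normrN gtr0_norm.
  rewrite lee_fin ler_pdivrMr// (le_trans _ (ltW yz))//.
  apply: ge_inf; last by exists y.
  by exists 0 => _ [x _ <-]; exact: enorm_ge0.
apply: (@le_trans _ _ (ereal_inf (f @` [set h : R | (0 < h < 1)%R]))).
  apply: le_ereal_inf_tmp => _ [s /= /andP[s0 _] <-].
  by rewrite lee_fin divr_ge0 ?edist_to_ge0// ltW.
apply: ereal_sup_ubound.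
by exists [set h : R | 0 < h < 1] => //; exact: near_delta.
Qed.

End euclid_topology.

(** Limit [eta -> 0] in an affine inequality. The restriction [eta <= 1] lets quadratic errors in
    [eta] be bounded by linear ones. *)
Lemma ge0_small (R : realType) (a M : R) :
  (forall eta, 0 < eta -> eta <= 1 -> 0 <= a + eta * M) -> 0 <= a.
Proof.
move=> h; apply/ler_addgt0Pl => eps eps0.
have M1 : 0 < `|M| + 1 by rewrite ltr_wpDl.
pose eta := Num.min 1 (eps / (`|M| + 1)).
have eta0 : 0 < eta by rewrite lt_min ltr01 divr_gt0.
have eta1 : eta <= 1 by rewrite ge_min lexx.
have etaM : eta * M <= eps.
  apply: (@le_trans _ _ (eta * (`|M| + 1))).
    by rewrite ler_wpM2l ?(ltW eta0)//; have := ler_norm M; lra.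
  by rewrite -ler_pdivlMr// ge_min lexx orbT.
have := h _ eta0 eta1; lra.
Qed.

(** * Proximal normals, polar cones and projections *)

Section proximal.
Context {R : realType} {d : nat}.
Implicit Types (u v x y z q m : 'cV[R]_d) (D O : set 'cV[R]_d).

(* The cone generated by [normals], together with 0. *)
Definition prox_normal D q m := exists C : R, forall x, D x ->
  0 <= dot (x - q) m + C * enorm (x - q) ^+ 2.

Lemma prox_normal0 D q : prox_normal D q 0.
Proof. by exists 0 => x _; rewrite dot0r mul0r addr0. Qed.

Lemma prox_normalD D q m m' : prox_normal D q m -> prox_normal D q m' ->
  prox_normal D q (m + m').
Proof.
move=> [C hC] [C' hC']; exists (C + C') => x Dx.
by rewrite dotDr mulrDl addrACA addr_ge0 ?hC ?hC'.
Qed.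

Lemma prox_normalZ D q m (s : R) : 0 <= s -> prox_normal D q m ->
  prox_normal D q (s *: m).
Proof.
move=> s0 [C hC]; exists (s * C) => x Dx.
by rewrite dotZr -mulrA -mulrDr mulr_ge0 ?hC.
Qed.

Lemma prox_normal_normals O q m : m != 0 -> prox_normal (closure O) q m ->
  normals O q ((enorm m)^-1 *: m).
Proof.
move=> m0 [C hC]; have em := enorm_gt0 m0; split.
  by rewrite /usphere/= enormZ ger0_norm ?invr_ge0 ?enorm_ge0// mulVf// gt_eqF.
exists (`|C| * (enorm m)^-1 + 1).
  by rewrite ltr_wpDl// mulr_ge0 ?invr_ge0 ?enorm_ge0.
move=> x Dx; rewrite enormBC dotZr mulrDl mul1r addrA addr_ge0 ?sqr_ge0//.
rewrite (mulrC `|C|) -mulrA -mulrDr mulr_ge0 ?invr_ge0 ?enorm_ge0//.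
apply: (le_trans (hC _ Dx)); rewrite lerD2l.
by rewrite ler_wpM2r ?sqr_ge0// ler_norm.
Qed.

(** Testing the proximal inequality at a point of [D] close to [q + h v] and dividing by [h] leaves
    [dot v m] and a quadratic term of order [h]. *)
Lemma tangent_prox D q v m : D q -> tangent_cone D q v -> prox_normal D q m ->
  0 <= dot v m.
Proof.
move=> Dq; rewrite tangent_coneP; last by exists q.
move=> tv [C hC]; apply/ler_addgt0Pl => eps eps0.
(* [e1 <= 1] gives [|y - q| <= h (|v| + 1)], and [e1 (|m| + 1) <= eps / 2] bounds the error of the
   linear term; the upper bound imposed on [h] below makes the quadratic term the other
   [eps / 2]. *)
pose e1 := Num.min 1 (eps / (2 * (enorm m + 1))).
have m1 : 0 < enorm m + 1 by rewrite ltr_wpDl ?enorm_ge0.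
have e10 : 0 < e1 by rewrite lt_min ltr01 divr_gt0// mulr_gt0.
have B0 : 0 < `|C| * (enorm v + 1) ^+ 2 + 1 by rewrite ltr_wpDl// mulr_ge0// sqr_ge0.
have [h /andP[h0 hd] [y Dy yh]] := tv e1 (eps / 2 / (`|C| * (enorm v + 1) ^+ 2 + 1)) e10
  (divr_gt0 (divr_gt0 eps0 (ltr0Sn _ 1)) B0).
have yq : enorm (y - q) <= h * (enorm v + 1).
  rewrite (_ : y - q = (y - (q + h *: v)) + h *: v); last by rewrite opprD addrA subrK.
  rewrite (le_trans (enorm_triangle _ _))// enormZ gtr0_norm//.
  have : e1 * h <= 1 * h by rewrite ler_wpM2r// ?ge_min ?lexx// ltW.
  lra.
have := hC _ Dy.
rewrite {1}(_ : y - q = (y - (q + h *: v)) + h *: v); last by rewrite opprD addrA subrK.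
rewrite dotDl dotZl => h1.
have h2 : dot (y - (q + h *: v)) m <= h * (eps / 2).
  apply: (le_trans (ler_norm _)); apply: (le_trans (cauchy_schwarz _ _)).
  apply: (@le_trans _ _ (e1 * h * (enorm m + 1))).
    by apply: ler_pM; rewrite ?enorm_ge0//; [exact: ltW | rewrite lerDl].
  rewrite mulrAC mulrC ler_wpM2l ?(ltW h0)// -ler_pdivlMr//.
  by rewrite -mulrA -invfM ge_min lexx orbT.
have h3 : C * enorm (y - q) ^+ 2 <= h * (eps / 2).
  apply: (@le_trans _ _ (`|C| * (h * (enorm v + 1)) ^+ 2)).
    apply: (@le_trans _ _ (`|C| * enorm (y - q) ^+ 2)).
      by rewrite ler_wpM2r ?sqr_ge0 ?ler_norm.
    rewrite ler_wpM2l// ler_pXn2r ?nnegrE ?enorm_ge0//.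
    by rewrite mulr_ge0 ?addr_ge0 ?enorm_ge0// ltW.
  move: hd; rewrite ltr_pdivlMr// => hd.
  have -> : `|C| * (h * (enorm v + 1)) ^+ 2 = h * (h * (`|C| * (enorm v + 1) ^+ 2)).
    by ring.
  rewrite ler_wpM2l ?(ltW h0)//; apply: le_trans (ltW hd).
  by rewrite ler_wpM2l ?(ltW h0)// lerDl.
have : 0 <= h * (eps + dot v m) by lra.
by rewrite pmulr_rge0// addrC.
Qed.

(** With [k = p - z], [|y - z|^2 = |y - p|^2 + 2 dot y k + |k|^2] because [dot p k = 0]; the middle
    term is nonnegative by polarity. *)
Lemma is_proj_prox D q z p : D q -> tangent_cone D q p ->
  prox_normal D q (p - z) -> dot p (p - z) = 0 -> is_proj (tangent_cone D q) z p.
Proof.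
move=> Dq Tp Npz pz; split => // y Ty.
rewrite -(ler_pXn2r (n := 2)) ?nnegrE ?enorm_ge0// !enorm_sqr.
have yk := tangent_prox Dq Ty Npz.
have := dot_ge0 (y - p).
rewrite (_ : y - z = (y - p) + (p - z)); last by rewrite addrA subrK.
move: pz yk; set k := p - z => pz yk.
rewrite (dotDl (y - p)) !(dotDr (y - p)) (dotC k (y - p)) (dotBl y p k) pz; lra.
Qed.

Section admissible.
Variables (O : set 'cV[R]_d) (C0 : R).
Hypotheses (oO : open O) (bO : bounded_set O) (C00 : 0 <= C0).
Hypothesis hC0 : forall x' x n, O x' -> boundary O x -> normals O x n ->
  0 <= dot (x' - x) n + C0 * enorm (x - x') ^+ 2.
Local Notation D := (closure O).

Lemma boundaryE x : boundary O x <-> D x /\ ~ O x.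
Proof. by rewrite /boundary (interior_id _).1. Qed.

Lemma closed_D : closed D. Proof. exact: closed_closure. Qed.

(** The points satisfying the inequality form a closed set, so it extends from [O] to its
    closure. *)
Lemma normals_boundary_le x' x n : D x' -> boundary O x -> normals O x n ->
  0 <= dot (x' - x) n + C0 * enorm (x' - x) ^+ 2.
Proof.
move=> Dx' bx nx.
pose f y := dot (y - x) n + C0 * enorm (y - x) ^+ 2.
suff : closed [set y | 0 <= f y].
  move=> /closure_id e; suff : closure [set y | 0 <= f y] x' by rewrite -e.
  apply: closure_subset Dx' => y Oy /=.
  by rewrite /f (enormBC y); exact: hC0.
apply: (@preimage_closed _ _ f [set s | 0 <= s]) => [y _|]; last exact: closed_ge.
apply: (@continuousD R R^o _ (fun y => dot (y - x) n) (fun y => C0 * enorm (y - x) ^+ 2)).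
  exact: continuous_dotB.
apply: (@continuousM R _ (fun=> C0) (fun y => enorm (y - x) ^+ 2)).
  exact: cst_continuous.
rewrite (_ : (fun y => enorm (y - x) ^+ 2) = (fun y => enorm (y - x) * enorm (y - x))).
  by apply: continuousM; exact: continuous_enormB.
by apply/funext => s; rewrite expr2.
Qed.

(** Normalizing [m] replaces the constant of [prox_normal], about which nothing is known, by
    [C0 |m|]; this is what makes the cone of proximal normals closed. *)
Lemma prox_normal_uniform q m x : boundary O q -> prox_normal D q m -> D x ->
  0 <= dot (x - q) m + C0 * enorm m * enorm (x - q) ^+ 2.
Proof.
move=> bq Nm Dx; have [->|m0] := eqVneq m 0.
  by rewrite dot0r enorm0 mulr0 mul0r addr0.
have em := enorm_gt0 m0.
have := normals_boundary_le Dx bq (prox_normal_normals m0 Nm).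
rewrite dotZr -(pmulr_rge0 _ em) mulrDr mulrA mulfV ?gt_eqF// mul1r.
by rewrite mulrA (mulrC C0).
Qed.

Lemma interior_ball x : O x -> exists2 e : R, 0 < e & forall y, enorm (y - x) < e -> O y.
Proof. by move=> Ox; apply/nbhs_enormP; exact: open_nbhs_nbhs. Qed.

Lemma interior_no_normals x n : O x -> ~ normals O x n.
Proof.
move=> Ox [n1 [C C_gt0 hC]].
have [e e0 he] := interior_ball Ox.
(* At [x - s n], a point of [O], the inequality would read [0 <= - s + C s^2], false as
   [s C < 1]. *)
pose s := Num.min (e / 2) (C^-1 / 2).
have s0 : 0 < s by rewrite lt_min !divr_gt0// invr_gt0.
have se : s < e by rewrite gt_min; apply/orP; left; lra.
have sC : s * C < 1.
  rewrite -ltr_pdivlMr// div1r gt_min; apply/orP; right.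
  by rewrite ltr_pdivrMr// ltr_pMr ?invr_gt0// ltr1n.
have n1' : dot n n = 1 by rewrite -enorm_sqr (n1 : enorm n = 1) expr1n.
have e1 : x - s *: n - x = - (s *: n) by rewrite addrAC subrr add0r.
have e2 : x - (x - s *: n) = s *: n by rewrite opprB addrC subrK.
have := hC (x - s *: n); rewrite e1 e2 enormZ dotNl dotZl n1' (n1 : enorm n = 1) !mulr1 gtr0_norm//.
have DO : D (x - s *: n).
  apply: subset_closure; apply: he.
  by rewrite e1 enormN enormZ (n1 : enorm n = 1) mulr1 gtr0_norm.
move=> /(_ DO); rewrite leNgt => /negP; apply.
have : 0 < s * (1 - s * C) by rewrite mulr_gt0// subr_gt0.
lra.
Qed.

Lemma normals_boundary x n : D x -> normals O x n -> boundary O x.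
Proof. by move=> Dx nx; apply/boundaryE; split => // Ox; exact: interior_no_normals nx. Qed.

Lemma interior_tangent q v : O q -> tangent_cone D q v.
Proof.
move=> Oq; rewrite tangent_coneP; last by exists q; exact: subset_closure.
move=> eps delta eps0 delta0.
have [e e0 he] := interior_ball Oq.
have v1 : 0 < enorm v + 1 by rewrite ltr_wpDl ?enorm_ge0.
pose h := Num.min delta (e / (enorm v + 1)) / 2.
have m0 : 0 < Num.min delta (e / (enorm v + 1)) by rewrite lt_min delta0 divr_gt0.
have h0 : 0 < h by rewrite divr_gt0.
have hm : h < Num.min delta (e / (enorm v + 1)) by rewrite ltr_pdivrMr// ltr_pMr// ltr1n.
move: hm; rewrite lt_min => /andP[hd he'].
exists h; first by rewrite h0.
exists (q + h *: v); last by rewrite subrr enorm0 mulr_gt0.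
apply: subset_closure; apply: he; rewrite addrAC subrr add0r enormZ gtr0_norm//.
move: he'; rewrite ltr_pdivlMr// => he'; apply: le_lt_trans he'.
by rewrite ler_wpM2l ?(ltW h0)// lerDl.
Qed.

Lemma bounded_D : bounded_set D.
Proof.
move: bO => [M [Mr hM]]; exists (M + 1); split; first exact: num_real.
move=> N MN x Dx.
have /closure_enormP /(_ (N - (M + 1)))[|y Oy yx] := Dx; first by rewrite subr_gt0.
have h0 := ler_normD (x - y) y; rewrite subrK in h0.
have h1 : `|y| <= M + 1 by apply: hM => //; rewrite ltrDl.
have h2 := mxnorm_le_enorm (x - y); rewrite enormBC in h2.
apply: (le_trans h0); rewrite -(subrK (M + 1) N); apply: lerD => //.
exact: le_trans (ltW yx).
Qed.

(** If [v] is not tangent, then for small [h] the point [q + h v] is at distance at least [eps h]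
    from [D], and its nearest point [p] carries a unit normal [n] with [dot v n <= - eps + O(h)]. A
    cluster point of these normals as [h -> 0] is a proximal normal at [q], because they all share
    the constant [C0]; it contradicts [hv]. *)
Lemma polar_tangent q v : boundary O q ->
  (forall m, prox_normal D q m -> 0 <= dot v m) -> tangent_cone D q v.
Proof.
move=> bq hv; have [Dq nOq] := (boundaryE q).1 bq.
rewrite tangent_coneP; last by exists q.
move=> eps delta eps0 delta0; apply: contrapT => nex.
have near_pt (h : R) : 0 < h -> h < delta -> exists p n, [/\ D p, enorm n = 1,
    enorm (p - q) <= 2 * h * enorm v,
    (forall x, D x -> 0 <= dot (x - p) n + C0 * enorm (x - p) ^+ 2) &
    dot v n <= - eps + 4 * C0 * h * enorm v ^+ 2].
  move=> h0 hd; pose z := q + h *: v.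
  have D0 : D !=set0 by exists q.
  have [p Dp hp] := nearest_point z D0 closed_D bounded_D.
  have epz : eps * h <= enorm (p - z).
    rewrite leNgt; apply/negP => lt; apply: nex; exists h; first by rewrite h0.
    by exists p.
  have pz0 : 0 < enorm (p - z) by apply: lt_le_trans epz; rewrite mulr_gt0.
  have pz : p - z != 0 by apply: contraTneq pz0 => ->; rewrite enorm0 ltxx.
  have zE : q - z = - (h *: v) by rewrite /z opprD addrA subrr add0r.
  have pq : enorm (p - q) <= 2 * h * enorm v.
    have -> : p - q = (p - z) - (q - z) by rewrite opprB addrA subrK.
    rewrite (le_trans (enorm_triangleB _ _))//.
    by have := hp _ Dq; rewrite zE enormN enormZ gtr0_norm//; lra.
  (* Minimality of [|p - z|] against [|x - z|], expanded around [p]. *)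
  have Npz : prox_normal D p (p - z).
    exists 1 => x Dx; have := hp _ Dx.
    rewrite -(ler_pXn2r (n := 2)) ?nnegrE ?enorm_ge0// !enorm_sqr.
    have -> : x - z = (x - p) + (p - z) by rewrite addrA subrK.
    move: (p - z) (x - p) => k y; rewrite !dotE (dotC k y).
    by have := dot_ge0 y; lra.
  have nn := prox_normal_normals pz Npz.
  have bp := normals_boundary Dp nn.
  exists p, ((enorm (p - z))^-1 *: (p - z)); split => //.
  - exact: nn.1.
  - by move=> x Dx; exact: normals_boundary_le.
  (* The inequality at [p] tested at [q]: as [q - p = - h v - (p - z)], it bounds [h (dot v n)] by
     [C0 |q - p|^2 - |p - z|]. *)
  - have := normals_boundary_le Dq bp nn.
    rewrite !dotZr (_ : q - p = - (h *: v) - (p - z)); last first.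
      by rewrite -zE opprB addrA subrK.
    rewrite enormBC in pq.
    have pq2 : enorm (- (h *: v) - (p - z)) ^+ 2 <= (2 * h * enorm v) ^+ 2.
      rewrite -zE opprB addrA subrK ler_pXn2r ?nnegrE ?enorm_ge0//.
      by rewrite mulr_ge0 ?enorm_ge0 ?mulr_ge0 ?ltW.
    have := ler_wpM2l C00 pq2.
    rewrite (dotBl (- _)) dotNl dotZl -(enorm_sqr (p - z)).
    set e := enorm (p - z) in epz pz0 *; set a := dot v (p - z).
    set X := enorm (_ - _) ^+ 2.
    have e_neq0 : e != 0 by rewrite gt_eqF.
    have -> : e^-1 * (- (h * a) - e ^+ 2) = - (h * (e^-1 * a)) - e by field.
    move=> h1 h2.
    suff : h * (e^-1 * a) <= h * (- eps + 4 * C0 * h * enorm v ^+ 2).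
      by rewrite ler_pM2l.
    move: h1 h2 epz; lra.
pose S : set 'cV[R]_d := [set n | enorm n = 1].
have cS : compact S.
  apply: closed_bounded_compact.
    apply: (@preimage_closed _ _ (@enorm R d) [set 1]) => [n _|]; last exact: closed_eq.
    apply: (@enorm_lip_continuous _ _ _ 1) => u u'; rewrite mul1r; exact: enorm_dist.
  exists 1; split; first exact: num_real.
  move=> M M1 n /= n1; apply: le_trans (mxnorm_le_enorm n) _.
  by rewrite (n1 : enorm n = 1) ltW.
have /choice[pn hpn] : forall h : R, exists pn : 'cV[R]_d * 'cV[R]_d,
    0 < h -> h < delta -> [/\ D pn.1, enorm pn.2 = 1,
    enorm (pn.1 - q) <= 2 * h * enorm v,
    (forall x, D x -> 0 <= dot (x - pn.1) pn.2 + C0 * enorm (x - pn.1) ^+ 2) &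
    dot v pn.2 <= - eps + 4 * C0 * h * enorm v ^+ 2].
  move=> h; have [h0|h0] := ltP 0 h; last by exists (0, 0).
  have [hd|hd] := ltP h delta; last by exists (0, 0).
  by have [p [n hpn]] := near_pt h h0 hd; exists (p, n).
have nearF (e : R) : 0 < e -> (0 : R)^'+ [set h : R | 0 < h < e].
  move=> e0; exists e; first exact: e0.
  by move=> h /=; rewrite sub0r normrN => hd h0; rewrite h0 -(gtr0_norm h0).
(* The unit normals lie in the compact sphere [S], hence cluster as [h] decreases to 0. *)
have [|n [Sn cln]] := cS ((fun h => (pn h).2) @ (0 : R)^'+) _.
  apply: filterS (nearF _ delta0) => h /andP[h0 hd].
  by have [] := hpn h h0 hd.
have small (eta : R) : 0 < eta -> exists h, [/\ 0 < h, h < delta, h < eta & enorm ((pn h).2 - n) < eta].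
  move=> eta0.
  have m0 : 0 < Num.min delta eta by rewrite lt_min delta0.
  have nb : nbhs n [set y | enorm (y - n) < eta] by apply/nbhs_enormP; exists eta.
  have fA : ((fun h => (pn h).2) @ (0 : R)^'+)
      [set (pn h).2 | h in [set h | 0 < h < Num.min delta eta]].
    by apply: filterS (nearF _ m0) => h hh; exists h.
  have [y /=] := cln _ _ fA nb.
  move=> [[h /= /andP[h0]]]; rewrite lt_min => /andP[hd he] <- hn.
  by exists h.
have Nn : prox_normal D q n.
  exists C0 => x Dx.
  (* The factor of [eta] collects the errors of replacing [pn h] by the pair of [q] and [n]: two in
     the linear term, one in the square. *)
  apply: (@ge0_small _ _ (enorm (x - q) + 2 * enorm v + C0 * (2 * enorm v * (2 * enorm (x - q) + 2 * enorm v)))).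
  move=> eta eta0 eta1.
  have [h [h0 hd he hn]] := small eta eta0.
  have [_ n1 pq hx _] := hpn h h0 hd.
  have := hx _ Dx.
  set p := (pn h).1 in pq *; set m := (pn h).2 in hn n1 *.
  have pq' : enorm (p - q) <= 2 * eta * enorm v.
    by rewrite (le_trans pq)// ler_wpM2r ?enorm_ge0//; lra.
  have pq1 : enorm (p - q) <= 2 * enorm v.
    by rewrite (le_trans pq')// ler_wpM2r ?enorm_ge0//; lra.
  have xp : x - p = (x - q) - (p - q) by rewrite opprB addrA subrK.
  have h1 : dot (x - p) m <= dot (x - q) n + enorm (x - q) * eta + 2 * eta * enorm v.
    have -> : dot (x - p) m = dot (x - q) n + dot (x - q) (m - n) - dot (p - q) m.
      by rewrite xp (dotBl (x - q)) (dotBr m); ring.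
    have := le_trans (ler_norm _) (cauchy_schwarz (x - q) (m - n)).
    have := le_trans (ler_norm _) (cauchy_schwarz (- (p - q)) m).
    rewrite dotNl enormN n1 mulr1.
    have := ler_wpM2l (enorm_ge0 (x - q)) (ltW hn).
    lra.
  have h2 : enorm (x - p) ^+ 2 <= enorm (x - q) ^+ 2 + eta * (2 * enorm v * (2 * enorm (x - q) + 2 * enorm v)).
    have t := enorm_triangleB (x - q) (p - q); rewrite -xp in t.
    have := enorm_ge0 (x - p); have := enorm_ge0 (x - q); have := enorm_ge0 (p - q).
    have := enorm_ge0 v; move: t pq' pq1.
    move: (enorm (x - p)) (enorm (x - q)) (enorm (p - q)) (enorm v) => X Y Z V.
    move=> t pq' pq1 V0 Z0 Y0 X0.
    apply: (@le_trans _ _ ((Y + Z) ^+ 2)); first by rewrite ler_pXn2r ?nnegrE ?addr_ge0.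
    have -> : (Y + Z) ^+ 2 = Y ^+ 2 + Z * (2 * Y + Z) by ring.
    rewrite lerD2l mulrA; apply: ler_pM => //; last lra.
      by rewrite addr_ge0// mulr_ge0.
    by rewrite mulrA (mulrC eta).
  have := ler_wpM2l C00 h2; move: h1; lra.
have := hv _ Nn; apply/negP; rewrite -ltNge.
have : 0 <= - eps - dot v n; last by lra.
apply: (@ge0_small _ _ (4 * C0 * enorm v ^+ 2 + enorm v)) => eta eta0 eta1.
have [h [h0 hd he hn]] := small eta eta0.
have [_ n1 _ _ hvn] := hpn h h0 hd.
have := le_trans (ler_norm _) (cauchy_schwarz v (n - (pn h).2)).
rewrite dotBr => l1.
have l2 := ler_wpM2l (enorm_ge0 v) (ltW hn); rewrite enormBC in l2.
have l3 : 4 * C0 * h * enorm v ^+ 2 <= 4 * C0 * eta * enorm v ^+ 2.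
  by rewrite ler_wpM2r ?sqr_ge0// ler_wpM2l ?mulr_ge0// ltW.
lra.
Qed.

(* Moreau decomposition: [z + k], with [k] the nearest point to [- z] of the
   cone of proximal normals, lies in the polar of that cone, hence is tangent;
   so it is the projection of [z]. *)
Lemma is_proj_prox_normal q z p : boundary O q ->
  is_proj (tangent_cone D q) z p -> prox_normal D q (p - z).
Proof.
move=> bq [Tp hp]; have [Dq nOq] := (boundaryE q).1 bq.
(* A vector of norm above [2 |z|] is no closer to [- z] than 0 is, so truncating the cone makes it
   compact and keeps the nearest point. *)
pose A := [set m | prox_normal D q m /\ enorm m <= 2 * enorm z].
have A0 : A 0 by split; [exact: prox_normal0 | rewrite enorm0 mulr_ge0 ?enorm_ge0].
have cA : closed A.
  have -> : A = \bigcap_(x in D) [set m | 0 <= dot (x - q) m + C0 * enorm m * enorm (x - q) ^+ 2]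
     `&` [set m | enorm m <= 2 * enorm z].
    apply/seteqP; split => m [h1 h2]; split => //.
      by move=> x Dx /=; exact: prox_normal_uniform.
    by exists (C0 * enorm m) => x Dx; exact: h1.
  have cen : continuous (@enorm R d).
    by apply: (@enorm_lip_continuous _ _ _ 1) => u u'; rewrite mul1r; exact: enorm_dist.
  apply: closedI; last first.
    by apply: (@preimage_closed _ _ (@enorm R d) [set s | s <= 2 * enorm z]) => [m _|]; [exact: cen | exact: closed_le].
  apply: closed_bigI => x Dx.
  apply: (@preimage_closed _ _ (fun m => dot (x - q) m + C0 * enorm m * enorm (x - q) ^+ 2) [set s | 0 <= s]) => [m _|]; last exact: closed_ge.
  apply: (@enorm_lip_continuous _ _ _ (enorm (x - q) + C0 * enorm (x - q) ^+ 2)) => u u'.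
  have -> : dot (x - q) u + C0 * enorm u * enorm (x - q) ^+ 2 -
     (dot (x - q) u' + C0 * enorm u' * enorm (x - q) ^+ 2) =
     dot (x - q) (u - u') + (C0 * enorm (x - q) ^+ 2) * (enorm u - enorm u').
    by rewrite dotBr; ring.
  rewrite (le_trans (ler_normD _ _))// mulrDl lerD ?cauchy_schwarz//.
  have c0 : 0 <= C0 * enorm (x - q) ^+ 2 by rewrite mulr_ge0// sqr_ge0.
  by rewrite normrM (ger0_norm c0) ler_wpM2l// enorm_dist.
have bA : bounded_set A.
  exists (2 * enorm z); split; first exact: num_real.
  move=> M hM m /= [_ hm]; apply: le_trans (mxnorm_le_enorm m) _.
  by rewrite (le_trans hm)// ltW.
have [k [Nk _] hk] := nearest_point (- z) (ex_intro _ _ A0) cA bA.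
have hk' m : prox_normal D q m -> enorm (k + z) <= enorm (m + z).
  move=> Nm; have [mz|mz] := leP (enorm m) (2 * enorm z).
    by have := hk m (conj Nm mz); rewrite !opprK.
  have := hk 0 A0; rewrite !opprK add0r => /le_trans; apply.
  have := enorm_triangleB (m + z) z; rewrite addrK; lra.
have [t tE] : exists t, t = k + z by exists (k + z).
rewrite -tE in hk'.
(* First variation: [k + s m] is no closer to [- z] than [k], and the difference of the squares is
   divided by [s]. *)
have var m (s : R) : 0 < s -> prox_normal D q (k + s *: m) -> 0 <= 2 * dot t m + s * dot m m.
  move=> s0 /hk'; rewrite -(ler_pXn2r (n := 2)) ?nnegrE ?enorm_ge0// !enorm_sqr.
  have -> : k + s *: m + z = t + s *: m by rewrite tE addrAC.
  rewrite !dotE (dotC m t) => h.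
  by rewrite -(pmulr_rge0 _ s0); move: h; lra.
have tpol m : prox_normal D q m -> 0 <= dot t m.
  move=> Nm; suff : 0 <= 2 * dot t m by rewrite pmulr_rge0.
  apply: (@ge0_small _ _ (dot m m)) => eta eta0 _; apply: var => //.
  by apply: prox_normalD => //; apply: prox_normalZ => //; exact: ltW.
have tk : dot t k = 0.
  apply/le_anti; rewrite tpol// andbT.
  (* In the direction [- k] the variation [k - s k = (1 - s) k] stays in the cone as long as
     [s <= 1]. *)
  suff : 0 <= 2 * dot t (- k) by rewrite dotNr mulrN oppr_ge0 pmulr_rle0.
  apply: (@ge0_small _ _ (dot (- k) (- k))) => eta eta0 eta1; apply: var => //.
  rewrite scalerN -[X in X - _]scale1r -scalerBl.
  by apply: prox_normalZ => //; rewrite subr_ge0.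
have Tt := polar_tangent bq tpol.
(* Minimality of [p] against [t] gives, for [w = p - t], [|w|^2 + 2 dot w k <= 0], while
   [dot w k = dot p k >= 0]; hence [p = t]. *)
have := hp _ Tt; have -> : t - z = k by rewrite tE addrK.
rewrite -(ler_pXn2r (n := 2)) ?nnegrE ?enorm_ge0// !enorm_sqr.
have -> : p - z = (p - t) + k by rewrite tE opprD addrA (addrAC _ (- k)) subrK.
move=> H.
have pk : 0 <= dot p k by exact: tangent_prox Nk.
have pw : dot (p - t) k = dot p k by rewrite dotBl tk subr0.
suff -> : p - t = 0 by rewrite add0r.
apply: enorm_eq0; apply/eqP; rewrite -sqrf_eq0 enorm_sqr eq_le dot_ge0 andbT.
move: H pw; move: (p - t) => w; rewrite !dotDl !dotDr (dotC k w); lra.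
Qed.

End admissible.
End proximal.

(** * Paths and Riemann-Stieltjes integrals *)

Section curves.
Context {R : realType}.
Implicit Types (f : R -> R).

Definition continuous_on_pos (V : normedModType R) (f : R -> V) :=
  forall t eps : R, 0 <= t -> 0 < eps -> exists2 e : R, 0 < e &
    forall s, 0 <= s -> `|s - t| < e -> `|f s - f t| <= eps.

Lemma within_continuous_on_pos (V : normedModType R) (f : R -> V) :
  {within `[0, +oo[, continuous f} -> continuous_on_pos f.
Proof.
move=> cf t eps t0 eps0.
have := cf t.
move/cvgrPdist_le => /(_ _ eps0).
rewrite /= {1}/nbhs/= /nbhs_subspace/= mem_set; last by rewrite /= in_itv/= t0.
move=> [e /= e0 he]; exists e => // s s0 st.
rewrite distrC; apply: he; first by rewrite /= distrC.
by rewrite /= in_itv/= s0.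
Qed.

Lemma uniformly_continuous_on_pos (V : normedModType R) (f : R -> V) (T eps : R) :
  continuous_on_pos f -> 0 <= T -> 0 < eps -> exists2 delta : R, 0 < delta &
    forall a b, 0 <= a <= T -> 0 <= b <= T -> `|a - b| < delta -> `|f a - f b| <= eps.
Proof.
move=> cf T0 eps0.
apply: (@real_induction _ (fun T => exists2 delta : R, 0 < delta &
    forall a b, 0 <= a <= T -> 0 <= b <= T -> `|a - b| < delta -> `|f a - f b| <= eps) 0 T) => //.
  exists 1 => // a b /andP[a0 a1] /andP[b0 b1] _.
  have -> : a = b by apply/le_anti; rewrite (le_trans a1 b0) (le_trans b1 a0).
  by rewrite subrr normr0 ltW.
move=> t /andP[t0 tT].
have [e e0 he] := cf t (eps / 2) t0 (divr_gt0 eps0 (ltr0Sn _ 1)).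
exists e => // u v /andP[u0 uT] /andP[v0 vT] tu ut tv ve [delta delta0 hd].
(* Either both points are at most [u], or the smaller one lies beyond [t - e] and both are within
   [e] of [t]. *)
have m0 : 0 < Num.min delta (u - (t - e)) by rewrite lt_min delta0 subr_gt0.
exists (Num.min delta (u - (t - e))) => // a b.
wlog ab : a b / a <= b.
  move=> wl ha hb; have [/wl|/ltW/wl] := leP a b; first exact.
  by rewrite distrC [in `|f _ - _|]distrC; apply.
move=> /andP[a0 av] /andP[b0 bv]; rewrite lt_min distrC ger0_norm ?subr_ge0// => /andP[h1 h2].
have [bu|ub] := leP b u.
  apply: hd; rewrite ?a0 ?b0 ?bu ?(le_trans ab)//.
  by rewrite distrC ger0_norm ?subr_ge0.
have la : `|f a - f t| <= eps / 2 by apply: he => //; rewrite ltr_distl; lra.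
have lb : `|f b - f t| <= eps / 2 by apply: he => //; rewrite ltr_distl; lra.
have -> : f a - f b = (f a - f t) - (f b - f t) by rewrite opprB addrA subrK.
by rewrite (le_trans (ler_normB _ _))//; lra.
Qed.

Lemma continuous_on_pos_bounded (V : normedModType R) (f : R -> V) (T : R) :
  continuous_on_pos f -> exists K : R, forall t, 0 <= t <= T -> `|f t| <= K.
Proof.
move=> cf; have [T0|T0] := leP 0 T; last first.
  by exists 0 => t /andP[t0 /(le_trans t0)]; rewrite leNgt T0.
apply: (@real_induction _ (fun T => exists K : R, forall t, 0 <= t <= T -> `|f t| <= K) 0 T) => //.
  by exists `|f 0| => t /le_anti <-.
move=> t /andP[t0 tT].
have [e e0 he] := cf t 1 t0 ltr01.
exists e => // u v /andP[u0 uT] /andP[v0 vT] tu ut tv ve [K hK].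
exists (Num.max K (`|f t| + 1)) => s /andP[s0 sv]; rewrite le_max.
have [su|us] := leP s u; first by rewrite hK ?s0.
apply/orP; right.
have : `|f s - f t| <= 1 by apply: he => //; rewrite ltr_distl; lra.
have := ler_normD (f s - f t) (f t); rewrite subrK; lra.
Qed.

Lemma continuous_on_pos_max (V : normedModType R) (f : R -> V) : continuous_on_pos f ->
  continuous (fun t : R => f (Num.max 0 t)).
Proof.
move=> cf x; apply/cvgrPdist_le => eps eps0.
have x0 : 0 <= Num.max 0 x by rewrite le_max lexx.
have [e e0 he] := cf _ _ x0 eps0.
exists e => //= y xy; rewrite distrC; apply: he; first by rewrite le_max lexx.
apply: le_lt_trans xy; rewrite (distrC x).
case: (leP 0 y) => ?; case: (leP 0 x) => ?; rewrite ?subrr ?normr0// ?subr0 ?sub0r ?normrN.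
  by rewrite (ger0_norm (_ : 0 <= y))//; have := ler_norm (y - x); lra.
by rewrite (ger0_norm (_ : 0 <= x))// distrC; have := ler_norm (x - y); lra.
Qed.

Lemma continuous_on_pos_within (V : normedModType R) (f : R -> V) :
  continuous_on_pos f -> {within `[0, +oo[, continuous f}.
Proof.
move=> /continuous_on_pos_max cf.
have eqf : {in `[0, +oo[%classic, (fun t : R => f (Num.max 0 t)) =1 f}.
  by move=> t; rewrite inE/= in_itv/= andbT => t0; rewrite max_r.
exact: (subspace_eq_continuous eqf (continuous_subspaceT cf)).
Qed.

Section vector.
Variable d : nat.
Implicit Types x : R -> 'cV[R]_d.

Definition vloclip x := forall i, loclip (fun t => x t i 0).

Lemma vector_is_derive x (t : R) (c : 'cV[R]_d) :
  (forall i, is_derive t 1 (fun s => x s i 0) (c i 0)) <->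
  derivable x t 1 /\ x^`()%classic t = c.
Proof.
split=> [h|[dx xc] i].
  have dx : derivable x t 1.
    by apply/derivable_mxP => i j; rewrite (ord1 j); have [] := h i.
  split => //; rewrite derive1E derive_mx//; apply/matrixP => i j.
  by rewrite (ord1 j) mxE; have [] := h i.
split; first by have /derivable_mxP/(_ i 0) := dx.
by rewrite -xc derive1E derive_mx// mxE.
Qed.

Lemma smooth_lipschitz x i (u v : R) : smooth x -> exists2 K : R, 0 <= K &
  forall a b, u <= a -> a <= b -> b <= v -> `|x b i 0 - x a i 0| <= K * (b - a).
Proof.
move=> sx.
have d0 t : derivable x t 1 by have := sx 0 t.
have d1 t : derivable x^`()%classic t 1 by have := sx 1 t.
pose h t := x^`()%classic t i 0.
have dx (t : R) : is_derive t 1 (fun s => x s i 0) (h t).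
  exact: (vector_is_derive x t (x^`()%classic t)).2.
have ch : continuous h.
  move=> t; apply/differentiable_continuous/derivable1_diffP.
  by have /derivable_mxP/(_ i 0) := d1 t.
have [uv|vu] := leP u v; last first.
  exists 0 => // a b ua ab bv; have := le_trans (le_trans ua ab) bv.
  by rewrite leNgt vu.
have cnh : {within `[u, v], continuous (fun t => `|h t|)}.
  apply: continuous_subspaceT => t; exact: (cvg_norm (ch t)).
have [c _ hc] := EVT_max uv cnh.
exists (`|h c| + 1); first by rewrite addr_ge0.
move=> a b ua ab bv; rewrite ler_norml lerNl.
have key (s : R) : `|s| = 1 -> s * x b i 0 - s * x a i 0 <= (`|h c| + 1) * b - (`|h c| + 1) * a.
  move=> s1; apply: (@local_to_global_le _ (fun t => s * x t i 0) (fun t => (`|h c| + 1) * t)) => //.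
  move=> t /andP[at_ tb].
  have [e e0 he] := is_derive_straddle (dx t) ltr01.
  exists e => // p q _ _ tp pt tq qe.
  have := he _ _ tp pt tq qe; rewrite mul1r => l1.
  have l2 : `|h t| <= `|h c| by apply: hc; rewrite in_itv/= (le_trans ua)//= (le_trans tb).
  have pq : 0 <= q - p by rewrite subr_ge0 (le_trans pt).
  rewrite -!mulrBr; apply: (le_trans (ler_norm _)); rewrite normrM s1 mul1r.
  have := ler_normD (x q i 0 - x p i 0 - h t * (q - p)) (h t * (q - p)).
  rewrite subrK normrM (ger0_norm pq).
  have := ler_wpM2r pq l2; rewrite mulrDl mul1r => l3 l4.
  apply: (le_trans l4); rewrite addrC; exact: lerD.
have := key 1 (normr1 _); have := key (-1) (normrN1 _); rewrite !mulrBr; lra.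
Qed.

Lemma piecewise_smooth_loclip x : piecewise_smooth x -> vloclip x.
Proof.
(* Partitions are provided for positive horizons, whereas [T] is arbitrary. *)
move=> psx i T; pose T' := Num.max 1 T.
have T'0 : 0 < T' by rewrite lt_max ltr01.
have TT' : T <= T' by rewrite le_max lexx orbT.
have [s sP hs] := psx T' T'0.
pose p := nth T' (0 :: s).
have key (k : nat) : (k <= size s)%N -> exists2 K : R, 0 <= K & forall a b,
    0 <= a -> a <= b -> b <= p k -> `|x b i 0 - x a i 0| <= K * (b - a).
  elim: k => [_|k IH ks].
    exists 0 => // a b a0 ab b0; have -> : a = b.
      by apply/le_anti; rewrite ab (le_trans b0 a0).
    by rewrite subrr normr0 mul0r.
  have [K K0 hK] := IH (ltnW ks).
  have [f sf hf] := hs k ks.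
  have [K' K'0 hK'] := smooth_lipschitz i (p k) (p k.+1) sf.
  have hK'' a b : p k <= a -> a <= b -> b <= p k.+1 -> `|x b i 0 - x a i 0| <= K' * (b - a).
    move=> pa ab bp; rewrite !hf; first exact: hK'.
      by rewrite pa (le_trans ab).
    by rewrite bp (le_trans pa).
  exists (K + K') => [|a b a0 ab bp]; first by rewrite addr_ge0.
  have ba : 0 <= b - a by rewrite subr_ge0.
  have m1 := mulr_ge0 K0 ba; have m2 := mulr_ge0 K'0 ba.
  have [bk|kb] := leP b (p k).
    by have := hK _ _ a0 ab bk; lra.
  have [ka|ak] := leP (p k) a.
    by have := hK'' _ _ ka ab bp; lra.
  have l1 := hK _ _ a0 (ltW ak) (lexx _).
  have l2 := hK'' _ _ (lexx _) (ltW kb) bp.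
  have := ler_normD (x b i 0 - x (p k) i 0) (x (p k) i 0 - x a i 0); rewrite subrKA.
  have : 0 <= K * (b - p k) by rewrite mulr_ge0// subr_ge0 ltW.
  have : 0 <= K' * (p k - a) by rewrite mulr_ge0// subr_ge0 ltW.
  lra.
have [K _ hK] := key (size s) (leqnn _).
exists K => a b a0 ab bT; apply: hK => //.
by rewrite /p (itv_partition_nth_size _ sP) (le_trans bT).
Qed.

End vector.
End curves.

(** * Riemann-Stieltjes integrals and their primitives *)

Section riemann_stieltjes.
Context {R : realType} {d r : nat}.
Implicit Types (F : R -> 'M[R]_(d, r)) (w : R -> 'cV[R]_r) (Y : R -> 'cV[R]_d).

(* [Y] has the local increments of an indefinite integral of [F] against [w]. *)
Definition RS_primitive F w Y := forall T eps : R, 0 < eps -> exists2 delta : R, 0 < delta &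
  forall a xi b, 0 <= a -> a <= xi -> xi <= b -> b <= T -> b - a < delta ->
    enorm (Y b - Y a - F xi *m (w b - w a)) <= eps * (b - a).

Lemma sum_partition (V : zmodType) (f : R -> V) (a b : R) s : itv_partition a b s ->
  let p := nth b (a :: s) in
  \sum_(0 <= i < size s) (f (p i.+1) - f (p i)) = f b - f a.
Proof.
move=> sP p; rewrite (@telescope_sumr _ 0 (size s) (fun i => f (p i)))//.
by rewrite /p (itv_partition_nth_size _ sP).
Qed.

Lemma RS_primitive_integral F w Y t : RS_primitive F w Y -> 0 <= t ->
  is_RS_integral F w 0 t (Y t - Y 0).
Proof.
move=> H t0 eps eps0.
have t1 : 0 < t + 1 by rewrite ltr_wpDl.
(* The errors [eps / (t + 1) * (p i.+1 - p i)] sum to [eps t / (t + 1) < eps]; the [+ 1] covers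
   [t = 0]. *)
have [delta delta0 hd] := H t (eps / (t + 1)) (divr_gt0 eps0 t1).
exists delta => // s xi sP p hp.
rewrite -(sum_partition Y sP) -sumrB big_mkord.
apply: le_lt_trans (enorm_sum_le _) _.
apply: (@le_lt_trans _ _ (\sum_(i < size s) eps / (t + 1) * (p i.+1 - p i))).
  apply: ler_sum => i _; have [/andP[h1 h2] h3] := hp i (ltn_ord i).
  rewrite enormBC; apply: hd => //.
    by apply: itv_partition_nth_ge sP; rewrite ltnS ltnW.
  by apply: itv_partition_nth_le sP; rewrite ltnS.
rewrite -mulr_sumr -(big_mkord xpredT (fun i => p i.+1 - p i)) (sum_partition idfun sP).
rewrite /= subr0 -mulrA gtr_pMr// mulrC ltr_pdivrMr//.
by rewrite mul1r ltrDl.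
Qed.

(** Without partitions of small mesh [is_RS_integral] would hold vacuously of every vector; their
    existence makes the integral unique. *)
Lemma fine_partition (t delta : R) : 0 <= t -> 0 < delta ->
  exists2 s, itv_partition 0 t s & forall i, (i < size s)%N ->
    nth t (0 :: s) i.+1 - nth t (0 :: s) i < delta.
Proof.
move=> t0 delta0.
apply: (@real_induction _ (fun t => exists2 s, itv_partition 0 t s &
  forall i, (i < size s)%N -> nth t (0 :: s) i.+1 - nth t (0 :: s) i < delta) 0 t) => //.
  by exists [::] => //; split.
move=> c /andP[c0 ct]; exists (delta / 2); first by rewrite divr_gt0.
move=> u v /andP[u0 ut] /andP[v0 vt] cu uc cv ve [s sP hs].
(* An [itv_partition] is strictly increasing, so [v] is appended only if it differs from [u]. *)
have [->|uv] := eqVneq v u; first by exists s.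
have luv : u < v by rewrite lt_neqAle eq_sym uv (le_trans uc).
case: (sP) => ps /eqP ls.
exists (rcons s v).
  by split; rewrite ?last_rcons// rcons_path ps ls.
move=> i; rewrite size_rcons ltnS leq_eqVlt => /orP[/eqP ->|is_].
  rewrite -rcons_cons !nth_rcons/= ltnn eqxx ltnS leqnn.
  rewrite (set_nth_default u)//= -[nth u _ _]/(nth u (0 :: s) (size s)).
  by rewrite (itv_partition_nth_size _ sP); lra.
rewrite -rcons_cons !nth_rcons/= ltnS is_ ltnS (ltnW is_).
have := hs i is_; rewrite (set_nth_default u v)// (set_nth_default u v)//=.
by rewrite ltnS ltnW.
Qed.

Lemma RS_integral_unique F w (t : R) I I' : 0 <= t ->
  is_RS_integral F w 0 t I -> is_RS_integral F w 0 t I' -> I = I'.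
Proof.
move=> t0 h h'; apply/eqP; rewrite -subr_eq0; apply/eqP/enorm_eq0/le_anti.
rewrite enorm_ge0 andbT; apply/ler_addgt0Pr => eps eps0; rewrite add0r.
have [e e0 he] := h _ (divr_gt0 eps0 (ltr0Sn _ 1)).
have [e' e'0 he'] := h' _ (divr_gt0 eps0 (ltr0Sn _ 1)).
have m0 : 0 < Num.min e e' by rewrite lt_min e0.
have [s sP hs] := fine_partition t0 m0.
pose xi i := nth t (0 :: s) i.
have incr i : (i < size s)%N -> xi i <= nth t (0 :: s) i.+1.
  move=> is_; case: (sP) => ps _.
  have /(pathP t)/(_ _ is_) := ps; exact: ltW.
have p1 i : (i < size s)%N -> xi i <= xi i <= nth t (0 :: s) i.+1 /\ nth t (0 :: s) i.+1 - nth t (0 :: s) i < e.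
  move=> is_; rewrite lexx incr//; split => //.
  by have := hs i is_; rewrite lt_min => /andP[].
have p2 i : (i < size s)%N -> xi i <= xi i <= nth t (0 :: s) i.+1 /\ nth t (0 :: s) i.+1 - nth t (0 :: s) i < e'.
  move=> is_; rewrite lexx incr//; split => //.
  by have := hs i is_; rewrite lt_min => /andP[].
have := he s xi sP p1; have := he' s xi sP p2.
set S := \sum_(_ <= _ < _) _ => l1 l2.
have -> : I - I' = (S - I') - (S - I) by rewrite opprB [RHS]addrC addrA subrK.
have := enorm_triangleB (S - I') (S - I); lra.
Qed.

(** The coordinates of [Y] are sums over [j] of Lebesgue primitives of [F i j * w_j']. The
    derivative of [y i j - F xi i j * w_j] is [(F t - F xi) i j * w_j'], small by uniform continuity
    of [F] and local boundedness of [w']. *)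
Lemma RS_primitive_exists F w : continuous_on_pos F -> vloclip w ->
  exists Y, [/\ vloclip Y, Y 0 = 0 & RS_primitive F w Y].
Proof.
move=> cF lw.
have /choice[g hg] : forall j, exists g : R -> R, [/\ measurable_fun setT g, locbdd g &
    {ae @lebesgue_measure R, forall t : R, 0 < t -> is_derive t 1 (fun t => w t j 0) (g t)}].
  by move=> j; have [g [? ? ? _]] := loclip_density (lw j); exists g.
pose f i j (t : R) := F (Num.max 0 t) i j * g j t.
have cFij i j : continuous_on_pos (fun t => F t i j : R^o).
  move=> t eps t0 eps0; have [e e0 he] := cF t eps t0 eps0; exists e => // s s0 st.
  apply: le_trans (he _ s0 st).
  rewrite [leRHS]/Num.Def.normr/= mx_normrE.
  have -> : F s i j - F t i j = (F s - F t) i j by rewrite !mxE.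
  exact: (le_bigmax_cond _ (fun ij : 'I_d * 'I_r => `|(F s - F t) ij.1 ij.2|) (j := (i, j))).
have mf i j : measurable_fun setT (f i j).
  have [mg _ _] := hg j.
  apply: measurable_funM => //.
  apply: continuous_measurable_fun.
  exact: (@continuous_on_pos_max _ R^o _ (cFij i j)).
have bf i j : locbdd (f i j).
  move=> T; have [_ bg _] := hg j; have [K hK] := bg T.
  have [K' hK'] := continuous_on_pos_bounded T (cFij i j).
  exists (K' * K) => t /[dup] tT /andP[t0 _].
  by rewrite /f (max_r t0) normrM ler_pM// ?hK// hK'.
pose y i j := primitive (f i j).
have ly i j : loclip (y i j) := primitive_loclip (mf i j) (bf i j).
exists (fun t => \col_i \sum_j y i j t); split.
- move=> i; rewrite (_ : (fun t => _) = fun t => \sum_j y i j t).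
    exact: loclip_sum.
  by apply/funext => t; rewrite mxE.
- by apply/matrixP => i j; rewrite !mxE big1// => k _; exact: primitive0.
move=> T eps eps0.
have [K K0 hK] : exists2 K : R, 0 <= K & forall j t, 0 <= t <= T -> `|g j t| <= K.
  have /choice[K hK] : forall j, exists K, forall t, 0 <= t <= T -> `|g j t| <= K.
    by move=> j; have [_ bg _] := hg j; exact: bg.
  exists (\sum_j `|K j|) => [|j t tT]; first exact: sumr_ge0.
  rewrite (le_trans (hK j t tT))// (le_trans (ler_norm _))//.
  by rewrite (bigD1 j)//= lerDl sumr_ge0.
have [T0|T0] := ltP T 0.
  exists 1 => // a xi b a0 axi xib bT _.
  by have := le_lt_trans (le_trans (le_trans (le_trans a0 axi) xib) bT) T0; rewrite ltxx.
pose N : R := (d * r)%:R + 1.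
have N0 : 0 < N by rewrite ltr_wpDl.
(* Each of the [d * r] entries may contribute [eps / N] per unit of time, and [K] bounds the
   derivatives of [w]. *)
pose e1 := eps / N / (K + 1).
have e10 : 0 < e1 by rewrite !divr_gt0// ltr_wpDl.
have [delta delta0 hd] := uniformly_continuous_on_pos cF T0 e10.
exists delta => // a xi b a0 axi xib bT ba.
have ab : a <= b := le_trans axi xib.
have bma : 0 <= b - a by rewrite subr_ge0.
have key i j : `|(y i j b - y i j a) - F xi i j * (w b j 0 - w a j 0)| <= eps / N * (b - a).
  have [_ _ dg] := hg j.
  have aed := ae_imply2 dg (primitive_is_derive (mf i j) (bf i j)).
  have lW := loclipZ (F xi i j) (lw j).
  have lE : loclip (fun t => eps / N * t).
    by apply: loclipZ => T'; exists 1 => u v _ uv _; rewrite mul1r ger0_norm ?subr_ge0.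
  have dE (t : R) : is_derive t 1 (fun t : R => eps / N * t) (eps / N).
    apply: approx_is_derive => q q0; exists 1 => // s _.
    by rewrite -mulrBr subrr normr0 mulr_ge0// ltW.
  have bnd (t : R) : a < t < b -> `|f i j t - F xi i j * g j t| <= eps / N.
    move=> /andP[at_ tb]; have t0 : 0 <= t by rewrite (le_trans a0)// ltW.
    have tT : t <= T by rewrite (le_trans _ bT)// ltW.
    rewrite /f (max_r t0) -mulrBl normrM.
    have l1 : `|F t i j - F xi i j| <= e1.
      apply: (le_trans _ (hd t xi _ _ _)).
      - rewrite [leRHS]/Num.Def.normr/= mx_normrE.
        have -> : F t i j - F xi i j = (F t - F xi) i j by rewrite !mxE.
        exact: (le_bigmax_cond _ (fun ij : 'I_d * 'I_r => `|(F t - F xi) ij.1 ij.2|) (j := (i, j))).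
      - by rewrite t0.
      - by rewrite (le_trans a0 axi) (le_trans xib bT).
      - by rewrite ltr_norml; lra.
    apply: (@le_trans _ _ (e1 * (K + 1))).
      apply: ler_pM => //; rewrite (le_trans (hK j t _)) ?t0//; lra.
    by rewrite /e1 divfK// gt_eqF// ltr_wpDl.
  have lY : loclip (fun t => y i j t - F xi i j * w t j 0) by exact: loclipB.
  rewrite ler_norml; apply/andP; split.
    have := @loclip_le_itv _ (fun t => - (y i j t - F xi i j * w t j 0)) (fun t => eps / N * t) a b
       (loclipN lY) lE a0 ab _.
    move=> /(_ _)/wrap[|h]; last by move: h; rewrite !mulrBr; lra.
    apply: aed => t h1 h2 tab; have t0 : 0 < t by case/andP: tab => at_ _; exact: le_lt_trans at_.
    exists (- (f i j t - F xi i j * g j t)), (eps / N); split => //.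
      by apply/is_deriveN/is_deriveB; [exact: h2|apply: is_deriveZ; exact: h1].
    by have := bnd t tab; rewrite ler_norml => /andP[]; lra.
  have := @loclip_le_itv _ (fun t => (y i j t - F xi i j * w t j 0)) (fun t => eps / N * t) a b
       lY lE a0 ab _.
  move=> /(_ _)/wrap[|h]; last by move: h; rewrite !mulrBr; lra.
  apply: aed => t h1 h2 tab; have t0 : 0 < t by case/andP: tab => at_ _; exact: le_lt_trans at_.
  exists ((f i j t - F xi i j * g j t)), (eps / N); split => //.
    by apply/is_deriveB; [exact: h2|apply: is_deriveZ; exact: h1].
  by have := bnd t tab; rewrite ler_norml => /andP[].
apply: le_trans (enorm_le_sum _) _.
apply: (@le_trans _ _ (\sum_(i < d) \sum_(j < r) eps / N * (b - a))).
  apply: ler_sum => i _; rewrite !mxE -sumrB -sumrB.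
  apply: le_trans (ler_norm_sum _ _ _) _; apply: ler_sum => j _.
  by have := key i j; rewrite !mxE.
rewrite !sumr_const !card_ord -mulrnA -mulr_natl mulrA ler_wpM2r//.
rewrite mulrA ler_pdivrMr// mulrC ler_wpM2l ?(ltW eps0)//.
by rewrite /N mulnC lerDl.
Qed.

End riemann_stieltjes.

Section integral_lower_bound.
Context dd (T : measurableType dd) (R : realType) (m : {measure set T -> \bar R}).
Variable D : set T.
Hypothesis mD : measurable D.

Lemma Rintegral_lincomb n (v : 'I_n -> R) (h : 'I_n -> T -> R) :
  (forall i, m.-integrable D (EFin \o h i)) ->
  m.-integrable D (EFin \o (fun t => \sum_(i < n) v i * h i t)) /\
  (\int[m]_(t in D) (\sum_(i < n) v i * h i t) = \sum_(i < n) v i * \int[m]_(t in D) h i t)%R.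
Proof.
elim: n v h => [|n IH] v h ih.
  have -> : (fun t => \sum_(i < 0) v i * h i t) = cst 0.
    by apply/funext => t; rewrite big_ord0.
  split; first exact: integrable0.
  by rewrite big_ord0 /Rintegral integral0.
have [iI eI] := IH (fun i => v (widen_ord (leqnSn n) i)) (fun i => h (widen_ord (leqnSn n) i))
   (fun i => ih _).
have iL : m.-integrable D (EFin \o (fun t => v ord_max * h ord_max t)).
  by apply: (eq_integrable mD _ _ _ (integrableZl mD (v ord_max) (ih ord_max))).
have -> : (fun t => \sum_(i < n.+1) v i * h i t) = (fun t =>
    (\sum_(i < n) v (widen_ord (leqnSn n) i) * h (widen_ord (leqnSn n) i) t) + v ord_max * h ord_max t).
  by apply/funext => t; rewrite big_ord_recr.
split.
  by apply: (eq_integrable mD _ _ _ (integrableD mD iI iL)).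
by rewrite RintegralD// eI RintegralZl// big_ord_recr.
Qed.

Lemma Rintegral_ae_ge (f : T -> R) (c M : R) : m.-integrable D (EFin \o f) ->
  m D = M%:E -> {ae m, forall t, D t -> c <= f t} ->
  c * M <= (\int[m]_(t in D) f t)%R.
Proof.
move=> fint DM cf.
have cint : m.-integrable D (EFin \o (cst c)).
  apply: measurable_bounded_integrable => //; first by rewrite DM ltry.
  by exists `|c|; split; [exact: num_real | move=> K /ltW cK t _].
have e1 : (\int[m]_(t in D) (f t - c) = \int[m]_(t in D) f t - c * M)%R.
  by rewrite (RintegralB mD fint cint) Rintegral_cst// DM.
rewrite -subr_ge0 -e1 /Rintegral; apply: fine_ge0.
(* Cutting off at 0 changes the integrand on a null set only and makes it nonnegative everywhere. *)
rewrite (ae_eq_integral (fun t => (Num.max (f t - c) 0)%:E))//.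
- by apply: integral_ge0 => t _; rewrite lee_fin le_max lexx orbT.
- exact: measurable_int (integrableB mD fint cint).
- apply/measurable_EFinP.
  apply: measurable_maxr => //.
  by apply/measurable_EFinP; exact: measurable_int (integrableB mD fint cint).
- apply: negligibleS cf => t /= h1 h2; apply: h1 => Dt.
  by rewrite max_l// subr_ge0 h2.
Qed.

End integral_lower_bound.

Section pushing.
Context {R : realType} {d : nat}.
Local Notation LS := lebesgue_stieltjes_measure.

(** [dot (l b - l a) v] is the integral of [dot (g s) v] over []a, b]]. In the forward direction the
    density and its almost everywhere normality are used only through this inequality, for various
    [v] and [c]. *)
Lemma density_increment (L : cumulative R R) (l g : R -> 'cV[R]_d)
    (N : R -> set 'cV[R]_d) (a b c : R) (v : 'cV[R]_d) :
  stieltjes_density (LS L) l g ->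
  {ae (LS L), forall t, 0 <= t -> N t (g t)} -> 0 <= a -> a <= b ->
  (forall tau n, a < tau <= b -> N tau n -> c <= dot n v) ->
  c * (L b - L a) <= dot (l b - l a) v.
Proof.
move=> dens aeN a0 ab hN.
have b0 : 0 <= b := le_trans a0 ab.
have sub : `]a, b]%classic `<=` `[0, b]%classic by apply: subset_itvr; rewrite bnd_simp.
have gint i : (LS L).-integrable `]a, b] (EFin \o (fun s => g s i 0)).
  have [ib _] := dens b i b0.
  exact: (@integrableS _ (measurableTypeR R) R (LS L) `[0, b]%classic) sub ib.
have incr i : l b i 0 - l a i 0 = (\int[LS L]_(s in `]a, b]) g s i 0)%R.
  have [ib eb] := dens b i b0; have [ia ea] := dens a i a0.
  have -> : l b i 0 - l a i 0 = (l b i 0 - l 0 i 0) - (l a i 0 - l 0 i 0) by ring.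
  have E : `[0, b]%classic = `[0, a]%classic `|` `]a, b]%classic :> set R.
    by apply: itv_bndbnd_setU; rewrite bnd_simp.
  rewrite eb ea E Rintegral_setU//; first by rewrite addrAC subrr add0r.
    by rewrite -E.
  apply/disj_set2P/seteqP; split => // t [] /=; rewrite !in_itv/= => /andP[_ ta] /andP[at_ _].
  by move: (lt_le_trans at_ ta); rewrite ltxx.
have [fint eI] := @Rintegral_lincomb _ (measurableTypeR R) R (LS L) `]a, b]%classic
    (measurable_itv `]a, b]) d (fun i => v i 0) _ gint.
have -> : dot (l b - l a) v = \sum_i v i 0 * (\int[LS L]_(s in `]a, b]) g s i 0)%R.
  by apply: eq_bigr => i _; rewrite -incr !mxE mulrC.
rewrite -eI; apply: Rintegral_ae_ge => //.
  by rewrite -(lebesgue_stieltjes_itv_oc L ab).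
apply: (ae_imply aeN) => t h /=; rewrite in_itv/= => tab.
have t0 : 0 <= t by case/andP: tab => /ltW at_ _; exact: le_trans at_.
have := hN t _ tab (h t0); rewrite /dot => cn.
by under eq_bigr do rewrite mulrC.
Qed.

End pushing.

Section coefficient.
Context {R : realType} {d r : nat}.
Variables (D : set 'cV[R]_d) (sigma : 'cV[R]_d -> 'M[R]_(d, r)).
Hypothesis hsigma : lipschitz_opnorm D sigma.

Let lipschitz_opnorm_ge0 : exists2 K : R, 0 <= K & forall x y v, D x -> D y ->
  enorm ((sigma x - sigma y) *m v) <= K * enorm (x - y) * enorm v.
Proof.
have [K hK] := hsigma; exists `|K| => // x y v Dx Dy.
apply: (le_trans (hK _ _ _ Dx Dy)).
by rewrite ler_wpM2r ?enorm_ge0// ler_wpM2r ?enorm_ge0// ler_norm.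
Qed.

Lemma enorm_mulmx_le (A : 'M[R]_(d, r)) (v : 'cV[R]_r) :
  enorm (A *m v) <= (\sum_i \sum_j `|A i j|) * enorm v.
Proof.
apply: (le_trans (enorm_le_sum _)); rewrite mulr_suml; apply: ler_sum => i _.
rewrite mxE mulr_suml (le_trans (ler_norm_sum _ _ _))//; apply: ler_sum => j _.
by rewrite normrM ler_wpM2l// coord_le_enorm.
Qed.

Lemma lipschitz_opnorm_continuous (x : R -> 'cV[R]_d) :
  continuous_on_pos x -> (forall t, 0 <= t -> D (x t)) ->
  continuous_on_pos (sigma \o x).
Proof.
move=> cx xD t eps t0 eps0; have [K K0 hK] := lipschitz_opnorm_ge0.
have K1 : 0 < K * d%:R + 1 by rewrite ltr_wpDl// mulr_ge0.
have [e e0 he] := cx t (eps / (K * d%:R + 1)) t0 (divr_gt0 eps0 K1).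
exists e => // s s0 st /=.
rewrite /Num.Def.normr/= mx_normrE; apply: bigmax_le; first exact: ltW.
move=> [i j] _ /=.
have -> : (sigma (x s) - sigma (x t)) i j =
    ((sigma (x s) - sigma (x t)) *m (delta_mx j 0 : 'cV[R]_r)) i 0.
  by rewrite -colE [RHS]mxE.
apply: (le_trans (coord_le_enorm _ _)).
apply: (le_trans (hK _ _ _ (xD _ s0) (xD _ t0))).
have -> : enorm (delta_mx j 0 : 'cV[R]_r) = 1.
  rewrite /enorm /dot (bigD1 j)//= big1 => [|k kj]; last by rewrite !mxE (negbTE kj) mulr0.
  by rewrite !mxE !eqxx mulr1 addr0 sqrtr1.
rewrite mulr1.
apply: (@le_trans _ _ (K * (d%:R * `|x s - x t|))).
  by rewrite ler_wpM2l// enorm_le_mxnorm.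
apply: (@le_trans _ _ ((K * d%:R + 1) * `|x s - x t|)).
  by rewrite mulrA ler_wpM2r// lerDl.
by rewrite mulrC -ler_pdivlMr// he.
Qed.

Lemma lipschitz_opnorm_bounded : bounded_set D -> exists2 S : R, 0 <= S &
  forall x v, D x -> enorm (sigma x *m v) <= S * enorm v.
Proof.
move=> [M [Mr hM]]; have [K K0 hK] := lipschitz_opnorm_ge0.
have [[x1 Dx1]|D0] := pselect (D !=set0); last first.
  by exists 0 => // x v Dx; exfalso; apply: D0; exists x.
pose B := d%:R * (2 * (M + 1)).
have bnd x : D x -> `|x| <= M + 1 by apply: hM; rewrite ltrDl.
have B0 x : D x -> enorm (x - x1) <= B.
  move=> Dx; apply: (le_trans (enorm_le_mxnorm _)); rewrite ler_wpM2l//.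
  by rewrite (le_trans (ler_normB _ _))// mulrDl mul1r lerD ?bnd.
have B00 : 0 <= B by apply: le_trans (B0 _ Dx1); exact: enorm_ge0.
exists (K * B + \sum_i \sum_j `|sigma x1 i j|).
  apply: addr_ge0; first exact: mulr_ge0.
  by apply: sumr_ge0 => i _; exact: sumr_ge0.
move=> x v Dx.
have -> : sigma x *m v = (sigma x - sigma x1) *m v + sigma x1 *m v by rewrite mulmxBl subrK.
apply: (le_trans (enorm_triangle _ _)); rewrite mulrDl; apply: lerD; last exact: enorm_mulmx_le.
apply: (le_trans (hK _ _ _ Dx Dx1)); rewrite ler_wpM2r ?enorm_ge0//.
by rewrite ler_wpM2l// B0.
Qed.

End coefficient.

Section RS_derivative.
Context {R : realType} {d r : nat}.

(** The tag is [t] itself, the left end point for [s >= t] and the right one for [s < t]; so [Y] has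
    the same first-order increment at [t] as the linear image [F t *m w]. *)
Lemma RS_primitive_is_derive (F : R -> 'M[R]_(d, r)) (w : R -> 'cV[R]_r) Y (t : R) (c : 'cV[R]_r) :
  RS_primitive F w Y -> 0 < t -> (forall j, is_derive t 1 (fun s => w s j 0) (c j 0)) ->
  forall i, is_derive t 1 (fun s => Y s i 0) ((F t *m c) i 0).
Proof.
move=> HY t0 dw i.
have dFw : is_derive t 1 (fun s => (F t *m w s) i 0) ((F t *m c) i 0).
  rewrite (_ : (fun s => _) = \sum_j (fun s => F t i j * w s j 0)); last first.
    by apply/funext => s; rewrite mxE fct_sumE.
  by rewrite mxE; exact: is_derive_sum.
apply: approx_is_derive => eps eps0.
have eps20 : 0 < eps / 2 by rewrite divr_gt0.
have [e e0 he] := is_derive_approx dFw eps20.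
have [e' e'0 he'] := HY (t + 1) _ eps20.
exists (Num.min (Num.min e e') (Num.min t 1)); first by rewrite !lt_min e0 e'0 t0/=.
move=> s; rewrite !lt_min => /andP[/andP[se se'] /andP[st s1]].
have s0 : 0 <= s by move: st; rewrite ltr_distl; lra.
have sT : s <= t + 1 by move: s1; rewrite ltr_distl; lra.
have l1 := he s se.
have l2 : `|(Y s - Y t - F t *m (w s - w t)) i 0| <= eps / 2 * `|s - t|.
  have [ts|/ltW ts] := leP t s.
    apply: (le_trans (coord_le_enorm _ _)).
    rewrite ger0_norm ?subr_ge0//; apply: he' => //; first exact: ltW.
    by rewrite -[ltLHS]ger0_norm ?subr_ge0.
  have -> : `|(Y s - Y t - F t *m (w s - w t)) i 0| = `|(Y t - Y s - F t *m (w t - w s)) i 0|.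
    rewrite -normrN; congr `|_|.
    have -> : Y t - Y s - F t *m (w t - w s) = - (Y s - Y t - F t *m (w s - w t)).
      rewrite opprD opprB opprK; congr (_ + _).
      by rewrite -mulmxN opprB.
    by rewrite [RHS]mxE.
  apply: (le_trans (coord_le_enorm _ _)).
  rewrite distrC ger0_norm ?subr_ge0//; apply: he' => //; first by rewrite lerDl.
  by rewrite -[ltLHS]ger0_norm ?subr_ge0// distrC.
rewrite !mxE in l2.
have -> : Y s i 0 - Y t i 0 - (F t *m c) i 0 * (s - t) =
  (Y s i 0 - Y t i 0 - \sum_j F t i j * (w s - w t) j 0) +
  ((F t *m w s) i 0 - (F t *m w t) i 0 - (F t *m c) i 0 * (s - t)).
  have -> : \sum_j F t i j * (w s - w t) j 0 = (F t *m w s) i 0 - (F t *m w t) i 0.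
    by rewrite !mxE -sumrB; apply: eq_bigr => j _; rewrite !mxE mulrBr.
  by ring.
by rewrite (le_trans (ler_normD _ _))//; lra.
Qed.

End RS_derivative.

(** * From the reflected equation to the projected one *)

Section vector_derivative.
Context {R : realType} {d : nat}.
Implicit Types (x : R -> 'cV[R]_d) (c : 'cV[R]_d).

Lemma ae_ord dd (T : measurableType dd) (m : {measure set T -> \bar R}) n
    (P : 'I_n -> T -> Prop) :
  (forall i, {ae m, forall t, P i t}) -> {ae m, forall t, forall i, P i t}.
Proof.
move=> h.
have : {ae m, forall t, forall k : nat, forall kn : (k < n)%N, P (Ordinal kn) t}.
  apply: ae_foralln => k; have [kn|kn] := pselect (is_true (k < n)%N).
    by apply: (ae_imply (h (Ordinal kn))) => t Pt kn'; rewrite (bool_irrelevance kn' kn).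
  by apply: aeW => t kn'; exfalso; exact: kn.
move=> h'; apply: (ae_imply h') => t ht [k kn]; exact: ht.
Qed.

Lemma enorm_continuous_on_pos x : continuous_on_pos x ->
  forall t eps : R, 0 <= t -> 0 < eps -> exists2 e : R, 0 < e &
    forall s, 0 <= s -> `|s - t| < e -> enorm (x s - x t) <= eps.
Proof.
move=> cx t eps t0 eps0.
have d1 : 0 < d%:R + 1 :> R by rewrite ltr_wpDl.
have [e e0 he] := cx t (eps / (d%:R + 1)) t0 (divr_gt0 eps0 d1).
exists e => // s s0 st; apply: (le_trans (enorm_le_mxnorm _)).
apply: (@le_trans _ _ ((d%:R + 1) * `|x s - x t|)); first by rewrite ler_wpM2r// lerDl.
by rewrite mulrC -ler_pdivlMr// he.
Qed.

Lemma vloclip_enorm x : vloclip x -> forall T : R, exists2 K : R, 0 <= K &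
  forall u v, 0 <= u -> u <= v -> v <= T -> enorm (x v - x u) <= K * (v - u).
Proof.
move=> lx T.
have /choice[K hK] : forall i, exists K : R, 0 <= K /\ forall u v,
    0 <= u -> u <= v -> v <= T -> `|x v i 0 - x u i 0| <= K * (v - u).
  by move=> i; have [K K0 hK] := loclip_ge0 (lx i) T; exists K.
exists (\sum_i K i); first by apply: sumr_ge0 => i _; have [] := hK i.
move=> u v u0 uv vT; apply: (le_trans (enorm_le_sum _)); rewrite mulr_suml.
by apply: ler_sum => i _; rewrite !mxE; have [_] := hK i; apply.
Qed.

Lemma vec_is_derive_approx x (t : R) c :
  (forall i, is_derive t 1 (fun s => x s i 0) (c i 0)) -> forall eps : R, 0 < eps ->
  exists2 e : R, 0 < e & forall s, `|s - t| < e ->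
    enorm (x s - x t - (s - t) *: c) <= eps * `|s - t|.
Proof.
move=> h eps eps0; have d1 : 0 < d%:R + 1 :> R by rewrite ltr_wpDl.
have /choice[e he] : forall i, exists e : R, 0 < e /\ forall s, `|s - t| < e ->
    `|x s i 0 - x t i 0 - c i 0 * (s - t)| <= eps / (d%:R + 1) * `|s - t|.
  move=> i; have [e e0 he] := is_derive_approx (h i) (divr_gt0 eps0 d1).
  by exists e.
exists (\big[Num.min/1]_i e i).
  apply: (big_ind (fun z : R => 0 < z)) => // [u v u0 v0|i _].
    by rewrite lt_min u0.
  by have [] := he i.
move=> s hs; apply: (le_trans (enorm_le_sum _)).
apply: (@le_trans _ _ (\sum_(i < d) eps / (d%:R + 1) * `|s - t|)).
  apply: ler_sum => i _; rewrite !mxE (mulrC _ (c i 0)); have [_] := he i; apply.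
  by apply: lt_le_trans hs _; exact: bigmin_le_cond.
rewrite sumr_const card_ord -[leLHS]mulr_natl mulrA ler_wpM2r//.
by rewrite mulrA ler_pdivrMr// mulrC ler_wpM2l ?(ltW eps0)// lerDl.
Qed.

Lemma is_derive_dot x (t : R) c v :
  (forall i, is_derive t 1 (fun s => x s i 0) (c i 0)) ->
  is_derive t 1 (fun s => dot (x s) v) (dot c v).
Proof.
move=> h; apply: approx_is_derive => eps eps0.
have v1 : 0 < enorm v + 1 by rewrite ltr_wpDl ?enorm_ge0.
have [e e0 he] := vec_is_derive_approx h (divr_gt0 eps0 v1).
exists e => // s hs.
rewrite mulrC -dotBl -dotZl -dotBl; apply: (le_trans (cauchy_schwarz _ _)).
apply: (@le_trans _ _ (eps / (enorm v + 1) * `|s - t| * (enorm v + 1))).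
  by apply: ler_pM; rewrite ?enorm_ge0 ?he// lerDl.
by rewrite mulrAC divfK// gt_eqF.
Qed.

Lemma is_derive_ge (f : R -> R) (t c K e : R) : 0 < e -> is_derive t 1 f c ->
  (forall s, t <= s -> s < t + e -> K * (s - t) <= f s - f t) -> K <= c.
Proof.
move=> e0 dc h; apply/ler_addgt0Pr => eps eps0.
have [d' d0 hd] := is_derive_approx dc eps0.
have m0 : 0 < Num.min e d' by rewrite lt_min e0.
have me : Num.min e d' <= e by rewrite ge_min lexx.
have md : Num.min e d' <= d' by rewrite ge_min lexx orbT.
pose s := t + Num.min e d' / 2.
have st : s - t = Num.min e d' / 2 by rewrite /s; ring.
have st0 : 0 < s - t by rewrite st divr_gt0.
have l1 : `|f s - f t - c * (s - t)| <= eps * (s - t).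
  by rewrite -{2}(gtr0_norm st0); apply: hd; rewrite gtr0_norm// st; lra.
have l2 : K * (s - t) <= f s - f t by apply: h; rewrite /s; lra.
rewrite -(ler_pM2r st0); move: l1; rewrite ler_norml => /andP[]; lra.
Qed.

Lemma tangent_derivative (D : set 'cV[R]_d) x (t : R) c : 0 < t ->
  (forall s, 0 <= s -> D (x s)) ->
  (forall i, is_derive t 1 (fun s => x s i 0) (c i 0)) ->
  tangent_cone D (x t) c /\ tangent_cone D (x t) (- c).
Proof.
move=> t0 xD h.
(* The sign [s] handles both directions at once; [k < t] keeps the time [t + k s] positive. *)
have key (s : R) : `|s| = 1 -> tangent_cone D (x t) (s *: c).
  move=> s1; rewrite tangent_coneP; last by exists (x t); apply: xD; exact: ltW.
  move=> eps delta eps0 delta0.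
  have [e e0 he] := vec_is_derive_approx h (divr_gt0 eps0 (ltr0Sn _ 1)).
  pose k := Num.min (Num.min e delta) t / 2.
  have m0 : 0 < Num.min (Num.min e delta) t by rewrite !lt_min e0 delta0.
  have k0 : 0 < k by rewrite divr_gt0.
  have : k < Num.min (Num.min e delta) t by rewrite ltr_pdivrMr// ltr_pMr// ltr1n.
  rewrite !lt_min => /andP[/andP[ke kd] kt].
  exists k; first by rewrite k0.
  have sk : `|k * s| = k by rewrite normrM s1 mulr1 gtr0_norm.
  exists (x (t + k * s)).
    by apply: xD; have := ler_norm (- (k * s)); rewrite normrN sk; lra.
  have -> : x (t + k * s) - (x t + k *: (s *: c)) = x (t + k * s) - x t - (t + k * s - t) *: c.
    by rewrite scalerA opprD addrA [t + _]addrC addrK.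
  apply: (@le_lt_trans _ _ (eps / 2 * `|t + k * s - t|)).
    by apply: he; rewrite [t + _]addrC addrK sk.
  by rewrite [t + _]addrC addrK sk ltr_pM2r// ltr_pdivrMr// ltr_pMr// ltr1n.
by split; [rewrite -[c]scale1r | rewrite -scaleN1r]; apply: key; rewrite ?normrN normr1.
Qed.

End vector_derivative.

Section reflected_to_projected.
Context {R : realType} {d r : nat}.
Variables (O : set 'cV[R]_d) (C0 : R).
Hypotheses (oO : open O) (C00 : 0 <= C0).
Hypothesis hC0 : forall x' x n, O x' -> boundary O x -> normals O x n ->
  0 <= dot (x' - x) n + C0 * enorm (x - x') ^+ 2.
Hypothesis hcone : exists (n : nat) (lam rad : R) (a y : 'I_n -> 'cV[R]_d),
  [/\ (1 <= n)%N, 0 < lam, 0 < rad,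
      forall i, usphere (a i) /\ boundary O (y i)
    & boundary O `<=` \bigcup_i eball (y i) rad /\
      forall i x nu, boundary O x -> eball (y i) (2 * rad) x ->
        normals O x nu -> lam <= dot nu (a i)].
Variables (x Y l g : R -> 'cV[R]_d) (x0 : 'cV[R]_d) (L : cumulative R R).
Hypotheses (cx : continuous_on_pos x) (xD : forall t, 0 <= t -> closure O (x t)).
Hypothesis cl : continuous_on_pos l.
Hypothesis lY : vloclip Y.
Hypothesis xE : forall t, 0 <= t -> x t = x0 + Y t + l t.
Hypothesis dens : stieltjes_density (lebesgue_stieltjes_measure L) l g.
Hypothesis aeN : {ae (lebesgue_stieltjes_measure L), forall t, 0 <= t -> normals O (x t) (g t)}.

Let Lnd u v : u <= v -> 0 <= L v - L u.
Proof. by move=> uv; rewrite subr_ge0; exact: cumulative_is_nondecreasing. Qed.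

(* Away from the boundary there are no normals, and near a boundary point all
   normals have a component at least [lam] in a common direction. *)
Lemma variation_le_increment t : 0 <= t -> exists M : R, [/\ 0 <= M & exists2 e : R, 0 < e &
  forall a b, 0 <= a -> a <= b -> t - e < a -> b < t + e ->
    L b - L a <= M * enorm (l b - l a)].
Proof.
move=> t0; have [Ox|nOx] := pselect (O (x t)).
  have [e1 e10 he1] := interior_ball oO Ox.
  have [e e0 he] := enorm_continuous_on_pos cx t0 (divr_gt0 e10 (ltr0Sn _ 1)).
  exists 0; split => //; exists e => // a b a0 ab ta be; rewrite mul0r.
  (* With no normals on []a, b]] the hypothesis is vacuous; [v = 0] and [c = 1] give
     [L b - L a <= 0]. *)
  have := @density_increment R d L l g (fun t => normals O (x t)) a b 1 0 dens aeN a0 ab.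
  rewrite mul1r dot0r; apply => tau n /andP[atau taub] nn; exfalso.
  apply: (interior_no_normals oO _ nn); apply: he1.
  apply: (@le_lt_trans _ _ (e1 / 2)); last by lra.
  by apply: he; [rewrite (le_trans a0)// ltW | rewrite ltr_distl; lra].
have bx : boundary O (x t) by apply/boundaryE => //; split => //; exact: xD.
have [n [lam [rad [a [y [_ lam0 rad0 hay [cov hn]]]]]]] := hcone.
have [i _ xi] := cov _ bx.
(* [x t] is within [rad] of [y i] and the path moves by at most [rad], so it stays in the ball of
   radius [2 * rad] where the cone condition holds. *)
have [e e0 he] := enorm_continuous_on_pos cx t0 rad0.
exists lam^-1; split; first by rewrite invr_ge0 ltW.
exists e => // s b s0 sb ts be.
rewrite -(ler_pM2l lam0) mulrA mulfV ?gt_eqF// mul1r.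
have [ai _] := hay i.
have : lam * (L b - L s) <= dot (l b - l s) (a i).
  apply: (@density_increment R d L l g (fun t => normals O (x t)) s b) => // tau m /andP[stau taub] nm.
  have tau0 : 0 <= tau by rewrite (le_trans s0)// ltW.
  have bt := normals_boundary oO (xD tau0) nm.
  apply: (hn i (x tau) m bt _ nm).
  rewrite /eball/= (_ : x tau - y i = (x tau - x t) + (x t - y i)); last by rewrite addrA subrK.
  apply: le_lt_trans (enorm_triangle _ _) _.
  have : enorm (x tau - x t) <= rad by apply: he => //; rewrite ltr_distl; lra.
  by move: xi; rewrite /eball/=; lra.
move=> /le_trans; apply; apply: (le_trans (ler_norm _)).
by apply: (le_trans (cauchy_schwarz _ _)); rewrite (ai : enorm (a i) = 1) mulr1.
Qed.

Lemma normals_dot_ge tau n s : 0 <= tau -> closure O s -> normals O (x tau) n ->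
  - (C0 * enorm (s - x tau) ^+ 2) <= dot n (s - x tau).
Proof.
move=> tau0 sD nn; have bx := normals_boundary oO (xD tau0) nn.
have := normals_boundary_le hC0 sD bx nn; rewrite dotC; lra.
Qed.

(* At the maximum [m] over [[s, u]] of [|x_v - x_s|], the energy estimate reads
   [m^2 <= 2 CY m (v - s) + 2 C0 m^2 (L v - L s)], and the last term is at most
   [m^2 / 2] on a short interval. *)
Lemma local_lipschitz CY t : 0 <= t -> 0 <= CY ->
  (forall u v, 0 <= u -> u <= v -> v <= t + 1 -> enorm (Y v - Y u) <= CY * (v - u)) ->
  exists2 e : R, 0 < e & forall s u, 0 <= s -> s <= u -> t - e < s -> u < t + e ->
    enorm (x u - x s) <= 4 * CY * (u - s).
Proof.
move=> t0 CY0 hCY.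
have [M [M0 [e1 e10 he1]]] := variation_le_increment t0.
(* While [l] stays this close to [l t], [L v - L s <= M |l v - l s| <= 1 / (4 (C0 + 1))]. *)
have cl1 : 0 < 8 * (C0 + 1) * (M + 1) by rewrite !mulr_gt0// ltr_wpDl.
have [e2 e20 he2] := enorm_continuous_on_pos cl t0 (divr_gt0 ltr01 cl1).
pose e := Num.min 1 (Num.min e1 e2).
have e0 : 0 < e by rewrite !lt_min ltr01 e10.
have ee : [/\ e <= 1, e <= e1 & e <= e2].
  by rewrite /e !ge_min !lexx !orbT.
have [ee1 ee2 ee3] := ee.
exists e => // s u s0 su ts ue.
have Lsm v : s <= v -> v <= u -> 4 * C0 * (L v - L s) <= 1.
  move=> sv vu.
  have l1 : L v - L s <= M * enorm (l v - l s) by apply: he1 => //; lra.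
  have l2 : enorm (l v - l s) <= 2 / (8 * (C0 + 1) * (M + 1)).
    have -> : l v - l s = (l v - l t) - (l s - l t) by rewrite opprB addrA subrK.
    apply: (le_trans (enorm_triangleB _ _)).
    have v0 : 0 <= v := le_trans s0 sv.
    have : enorm (l v - l t) <= 1 / (8 * (C0 + 1) * (M + 1)) by apply: he2 => //; rewrite ltr_distl; lra.
    have : enorm (l s - l t) <= 1 / (8 * (C0 + 1) * (M + 1)) by apply: he2 => //; rewrite ltr_distl; lra.
    rewrite (_ : 2 / _ = 1 / (8 * (C0 + 1) * (M + 1)) + 1 / (8 * (C0 + 1) * (M + 1))); last by ring.
    by move=> k2 k1; exact: lerD.
  have M1 : 0 < M + 1 by rewrite ltr_wpDl.
  have C1 : 0 < C0 + 1 by rewrite ltr_wpDl.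
  have l3 : L v - L s <= (M + 1) * (2 / (8 * (C0 + 1) * (M + 1))).
    apply: (le_trans l1); apply: ler_pM => //; [exact: enorm_ge0 | by rewrite lerDl].
  have l4 : (M + 1) * (2 / (8 * (C0 + 1) * (M + 1))) = (4 * (C0 + 1))^-1.
    by field; rewrite !gt_eqF.
  rewrite l4 in l3.
  apply: (@le_trans _ _ (4 * (C0 + 1) * (4 * (C0 + 1))^-1)).
    by apply: ler_pM => //; [rewrite mulr_ge0 | exact: Lnd | rewrite ler_pM2l// lerDl].
  by rewrite mulfV// mulf_neq0// gt_eqF.
have cdist : continuous (fun v : R => enorm (x (Num.max 0 v) - x s)).
  apply: (@continuous_on_pos_max _ R^o (fun v => enorm (x v - x s))) => v eps v0 eps0.
  have [e' e'0 he'] := enorm_continuous_on_pos cx v0 eps0.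
  exists e' => // z z0 zv; apply: le_trans (he' z z0 zv).
  by apply: le_trans (enorm_dist _ _) _; rewrite opprB addrA subrK.
have [v vsu hv0] := EVT_max su (continuous_subspaceT cdist).
move: vsu; rewrite in_itv/= => /andP[sv vu].
have hv z : s <= z <= u -> enorm (x z - x s) <= enorm (x v - x s).
  move=> zsu; have := hv0 z; rewrite in_itv/= => /(_ zsu).
  by rewrite !max_r// (le_trans s0)//; case/andP: zsu.
set m := enorm (x v - x s) in hv.
have m0 : 0 <= m := enorm_ge0 _.
have mmax z : s <= z -> z <= u -> enorm (x z - x s) <= m.
  by move=> sz zu; apply: hv; rewrite sz.
have key : m ^+ 2 <= 2 * CY * m * (v - s) + 2 * C0 * m ^+ 2 * (L v - L s).
  (* [eps] absorbs the oscillation of [x] on small intervals; it multiplies [L v - L s] and is sent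
     to 0. *)
  rewrite -subr_ge0; apply: (@ge0_small _ _ (L v - L s)) => eps eps0 _.
  suff : dot (x v - x s) (x v - x s) - dot (x s - x s) (x s - x s) <=
      (2 * CY * m * v + (2 * C0 * m ^+ 2 + eps) * L v) -
      (2 * CY * m * s + (2 * C0 * m ^+ 2 + eps) * L s).
    by rewrite subrr dot0l -enorm_sqr -/m; lra.
  apply: (@local_to_global_le _ (fun z => dot (x z - x s) (x z - x s))
    (fun z => 2 * CY * m * z + (2 * C0 * m ^+ 2 + eps) * L z)) => //.
  move=> z /andP[sz zv].
  have z0 : 0 <= z := le_trans s0 sz.
  have eps4 : 0 < eps / 4 by rewrite divr_gt0.
  have [e' e'0 he'] := enorm_continuous_on_pos cx z0 eps4.
  exists e' => // a b /andP[sa av] /andP[sb bv] za az zb be.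
  have a0 : 0 <= a := le_trans s0 sa.
  have b0 : 0 <= b := le_trans s0 sb.
  have ab : a <= b := le_trans az zb.
  (* Difference of squares: [|x b - x s|^2 - |x a - x s|^2 = dot (x b - x a) q]. *)
  set q := x b + x a - x s - x s.
  have expand : dot (x b - x s) (x b - x s) - dot (x a - x s) (x a - x s) =
      dot (Y b - Y a) q + dot (l b - l a) q.
    have -> : dot (Y b - Y a) q + dot (l b - l a) q = dot (x b - x a) q.
      rewrite -dotDl; congr dot; rewrite !xE//.
      by apply/matrixP => i j; rewrite !mxE; ring.
    rewrite /q !dotE (dotC (x s) (x a)) (dotC (x s) (x b)) (dotC (x b) (x a)); ring.
  have qm : enorm q <= 2 * m.
    have -> : q = (x b - x s) + (x a - x s) by apply/matrixP => i j; rewrite !mxE; ring.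
    apply: (le_trans (enorm_triangle _ _)).
    have := mmax b sb (le_trans bv vu); have := mmax a sa (le_trans av vu); lra.
  have h1 : dot (Y b - Y a) q <= CY * (b - a) * (2 * m).
    apply: (le_trans (ler_norm _)); apply: (le_trans (cauchy_schwarz _ _)).
    by apply: ler_pM; rewrite ?enorm_ge0//; apply: hCY => //; lra.
  have h2 : - (2 * C0 * m ^+ 2 + eps) * (L b - L a) <= dot (l b - l a) (- q).
    apply: (@density_increment R d L l g (fun t => normals O (x t)) a b) => // tau n /andP[atau taub] nn.
    have tau0 : 0 <= tau by rewrite (le_trans a0)// ltW.
    have n1 : enorm n = 1 by have [] := nn.
    (* The first term is controlled by the normal inequality at [x tau] tested at [x s]; the second
       has norm at most [eps], as all three times are near [z]. *)
    have -> : - q = 2 *: (x s - x tau) - ((x b - x tau) + (x a - x tau)).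
      by apply/matrixP => i j; rewrite !mxE; ring.
    rewrite (dotBr (2 *: _)) dotZr.
    have l1 := normals_dot_ge tau0 (xD s0) nn.
    have l2 : enorm (x s - x tau) ^+ 2 <= m ^+ 2.
      rewrite ler_pXn2r ?nnegrE ?enorm_ge0// enormBC; apply: mmax; lra.
    have l3 := ler_wpM2l C00 l2.
    have l4 := le_trans (ler_norm _) (cauchy_schwarz n ((x b - x tau) + (x a - x tau))).
    rewrite n1 mul1r in l4.
    have l5 : enorm ((x b - x tau) + (x a - x tau)) <= eps.
      have -> : (x b - x tau) + (x a - x tau) = (x b - x z) + (x a - x z) - (x tau - x z) - (x tau - x z).
        by apply/matrixP => i j; rewrite !mxE; ring.
      have k1 : enorm (x b - x z) <= eps / 4 by apply: he' => //; rewrite ltr_distl; lra.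
      have k2 : enorm (x a - x z) <= eps / 4 by apply: he' => //; rewrite ltr_distl; lra.
      have k3 : enorm (x tau - x z) <= eps / 4 by apply: he' => //; rewrite ltr_distl; lra.
      apply: (le_trans (enorm_triangleB _ _)).
      have := enorm_triangleB (x b - x z + (x a - x z)) (x tau - x z).
      have := enorm_triangle (x b - x z) (x a - x z); lra.
    lra.
  rewrite dotNr in h2; rewrite expand; move: h1 h2; lra.
have Lv := ler_wpM2r (sqr_ge0 m) (Lsm v sv vu).
apply: (@le_trans _ _ m); first by apply: mmax.
have vs : 0 <= v - s by rewrite subr_ge0.
have m2 : m * m <= m * (4 * CY * (v - s)) by move: key Lv; rewrite expr2; lra.
have [m00|m_gt0] := leP m 0.
  by apply: (le_trans m00); rewrite mulr_ge0 ?mulr_ge0// subr_ge0.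
rewrite (ler_pM2l m_gt0) in m2; apply: (le_trans m2).
by rewrite ler_wpM2l ?mulr_ge0// lerB.
Qed.

(** The constant [4 * CY] of the local estimate is the same at all points of [[0, T]], so the
    estimate chains over the whole interval. *)
Lemma reflected_loclip : vloclip x.
Proof.
move=> i T; have [T0|T0] := ltP T 0.
  exists 0 => u v u0 uv vT; have := le_trans (le_trans u0 uv) vT.
  by rewrite leNgt T0.
have [CY CY0 hCY] := vloclip_enorm lY (T + 1).
exists (4 * CY) => u v u0 uv vT.
have key (sg : R) : `|sg| = 1 -> sg * x v i 0 - sg * x u i 0 <= 4 * CY * v - 4 * CY * u.
  move=> sg1.
  apply: (@local_to_global_le _ (fun t => sg * x t i 0) (fun t => 4 * CY * t)) => // t /andP[ut tv].
  have t0 := le_trans u0 ut.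
  have [|e e0 he] := @local_lipschitz CY t t0 CY0.
    by move=> a b a0 ab bt; apply: hCY => //; lra.
  exists e => // a b /andP[ua av] /andP[ub bv] ta at_ tb be.
  rewrite -!mulrBr; apply: (le_trans (ler_norm _)); rewrite normrM sg1 mul1r.
  have -> : x b i 0 - x a i 0 = (x b - x a) i 0 by rewrite !mxE.
  apply: (le_trans (coord_le_enorm _ _)); apply: he => //; first exact: le_trans ua.
  exact: le_trans tb.
have := key 1 (normr1 _); have := key (-1) (normrN1 _).
by rewrite ler_norml => h1 h2; apply/andP; split; lra.
Qed.

Lemma reflected_l_loclip : vloclip l.
Proof.
move=> i; have [lxi lYi] := (reflected_loclip i, lY i).
have lb := loclipB (loclipB lxi lYi) (loclip_cst (x0 i 0)).
move=> T; have [K hK] := lb T; exists K => u v u0 uv vT.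
have := hK u v u0 uv vT; rewrite !xE ?(le_trans u0)// !mxE.
by rewrite (_ : _ - _ = l v i 0 - l u i 0)//; ring.
Qed.

(** The normal inequality is integrated over []t, s]] and divided by [s - t]. Since
    [L s - L t <= M K (s - t)], the limit is a proximal inequality with constant [C0 M K], at every
    time where [l] is differentiable. *)
Lemma derivative_prox_normal (t : R) (k : 'cV[R]_d) : 0 < t ->
  (forall i, is_derive t 1 (fun s => l s i 0) (k i 0)) ->
  prox_normal (closure O) (x t) k.
Proof.
move=> t0 dk.
have [M [M0 [e1 e10 he1]]] := variation_le_increment (ltW t0).
have [K K0 hK] := vloclip_enorm reflected_l_loclip (t + 1).
have [CX CX0 hCX] := vloclip_enorm reflected_loclip (t + 1).
exists (C0 * (M * K)) => y yD.
apply: (@ge0_small _ _ (M * K * (C0 * (2 * enorm (y - x t) + 1) + 1))) => eps eps0 eps1.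
pose e := Num.min (Num.min 1 e1) (eps / (CX + 1)).
have CX1 : 0 < CX + 1 by rewrite ltr_wpDl.
have e0 : 0 < e by rewrite !lt_min ltr01 e10 divr_gt0.
have ee1 : e <= 1 by rewrite /e !ge_min lexx.
have ee2 : e <= e1 by rewrite /e !ge_min lexx orbT.
have ee3 : e <= eps / (CX + 1) by rewrite /e ge_min lexx orbT.
pose E := enorm (y - x t).
have E0 : 0 <= E := enorm_ge0 _.
(* [- c] bounds [dot n (y - x t)] from below for normals [n] at times just after [t]: passing from
   [x tau] to [x t] costs [eps] in the linear term and [eps (2 E + 1)] in the square. *)
pose c := C0 * (E ^+ 2 + eps * (2 * E + 1)) + eps.
have c0 : 0 <= c.
  by rewrite addr_ge0 ?mulr_ge0 ?addr_ge0 ?sqr_ge0 ?mulr_ge0 ?addr_ge0 ?mulr_ge0// ltW.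
suff : - (c * (M * K)) <= dot k (y - x t).
  by rewrite /c (dotC k) -/E; lra.
have ld := is_derive_dot (y - x t) dk.
apply: (is_derive_ge e0 ld) => s ts ste.
have s0 : 0 <= s by rewrite (le_trans (ltW t0)).
rewrite -dotBl.
have h1 : - c * (L s - L t) <= dot (l s - l t) (y - x t).
  apply: (@density_increment R d L l g (fun t => normals O (x t)) t s) => //; first exact: ltW.
  move=> tau n /andP[ttau taus] nn.
  have tau0 : 0 <= tau by rewrite (le_trans (ltW t0))// ltW.
  have n1 : enorm n = 1 by have [] := nn.
  have dx : enorm (x tau - x t) <= eps.
    apply: (le_trans (hCX _ _ (ltW t0) (ltW ttau) _)); first by lra.
    apply: (@le_trans _ _ ((CX + 1) * (eps / (CX + 1)))); last by rewrite mulrC divfK ?gt_eqF.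
    apply: ler_pM => //; [by rewrite subr_ge0 ltW | by rewrite lerDl | lra].
  have yE : y - x t = (y - x tau) + (x tau - x t) by rewrite addrA subrK.
  have h3 := normals_dot_ge tau0 yD nn.
  have h4 : enorm (y - x tau) <= E + eps.
    have -> : y - x tau = (y - x t) - (x tau - x t) by rewrite opprB addrA subrK.
    by apply: (le_trans (enorm_triangleB _ _)); rewrite lerD.
  have h5 : enorm (y - x tau) ^+ 2 <= E ^+ 2 + eps * (2 * E + 1).
    apply: (@le_trans _ _ ((E + eps) ^+ 2)).
      by rewrite ler_pXn2r ?nnegrE ?enorm_ge0 ?addr_ge0// ltW.
    have : eps * eps <= eps * 1 by rewrite ler_pM2l.
    by rewrite sqrrD expr2; lra.
  have h6 := ler_wpM2l C00 h5.
  have := cauchy_schwarz n (x tau - x t); rewrite n1 mul1r ler_norml => /andP[h7 _].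
  by rewrite yE dotDr /c; lra.
have h2 : L s - L t <= M * K * (s - t).
  apply: (@le_trans _ _ (M * enorm (l s - l t))).
    by apply: he1 => //; [exact: ltW | lra | lra].
  by rewrite -mulrA ler_wpM2l// hK// ?ltW//; lra.
have := ler_wpM2l c0 h2; lra.
Qed.

End reflected_to_projected.

Lemma reflected_projected (R : realType) (d r : nat) (O : set 'cV[R]_d)
    (sigma : 'cV[R]_d -> 'M[R]_(d, r)) (x0 : 'cV[R]_d) (w : R -> 'cV[R]_r)
    (x l : R -> 'cV[R]_d) :
  open O -> admissible O -> lipschitz_opnorm (closure O) sigma -> vloclip w ->
  reflected_ode_solution O sigma w x0 x l -> projected_ode O sigma w x.
Proof.
move=> oO [[_ [C0 C00 hC0]] _ hcone] hsigma lw.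
move=> [[wcx xD] [wcl _] [x_0 hI] [L [_ _ [g dens aeN]]]].
have cx := within_continuous_on_pos wcx.
have cl := within_continuous_on_pos wcl.
have cF := lipschitz_opnorm_continuous hsigma cx xD.
have [Y [lY Y0 prY]] := RS_primitive_exists cF lw.
have xE t : 0 <= t -> x t = x0 + Y t + l t.
  move=> t0; have [I hIt ->] := hI t t0.
  by rewrite (RS_integral_unique t0 hIt (RS_primitive_integral prY t0)) Y0 subr0.
have lx := reflected_loclip oO C00 hC0 hcone cx xD cl lY xE dens aeN.
have aew := ae_ord (fun j => loclip_ae_derivable (lw j)).
have aex := ae_ord (fun i => loclip_ae_derivable (lx i)).
have aewx := ae_imply2 aew aex (fun _ h1 h2 => conj h1 h2).
apply: (ae_imply2 aewx (ae_neq 0)) => t [dw dx] tn0 t_ge0.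
have t0 : 0 < t by rewrite lt_neqAle eq_sym tn0.
pose cw := \col_j 'D_1 (fun s => w s j 0) t.
pose cxd := \col_i 'D_1 (fun s => x s i 0) t.
have hw j : is_derive t 1 (fun s => w s j 0) (cw j 0).
  by rewrite mxE; apply/derivableP; exact: dw.
have hx i : is_derive t 1 (fun s => x s i 0) (cxd i 0).
  by rewrite mxE; apply/derivableP; exact: dx.
pose z := sigma (x t) *m cw.
have hY i : is_derive t 1 (fun s => Y s i 0) (z i 0).
  exact: (RS_primitive_is_derive prY t0 hw).
have hl i : is_derive t 1 (fun s => l s i 0) ((cxd - z) i 0).
  have h1 : is_derive t 1 (fun s => x s i 0 - Y s i 0) ((cxd - z) i 0).
    by rewrite mxE [X in _ + X]mxE; exact: is_deriveB.
  have h2 : is_derive t 1 (fun s => x s i 0 - Y s i 0 - x0 i 0) ((cxd - z) i 0 - 0).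
    exact: is_deriveB.
  rewrite subr0 in h2.
  (* The neighborhood of radius [t] consists of positive times, where [xE] applies. *)
  apply: (is_derive_near t0 _ h2) => s; rewrite subrr => s0 _.
  by rewrite xE ?(ltW s0)// !mxE; ring.
have Nk := derivative_prox_normal oO C00 hC0 hcone cx xD cl lY xE dens aeN t0 hl.
have [T1 T2] := tangent_derivative t0 xD hx.
have Dx := xD _ t_ge0.
have pk : dot cxd (cxd - z) = 0.
  have := tangent_prox Dx T1 Nk; have := tangent_prox Dx T2 Nk.
  by rewrite dotNl oppr_ge0 => h1 h2; apply/le_anti; rewrite h1.
have [dxt xc] := (vector_is_derive x t cxd).1 hx.
have [dwt wc] := (vector_is_derive w t cw).1 hw.
split; first exact: dxt.
by rewrite xc wc; exact: is_proj_prox Nk pk.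
Qed.

(** * From the projected equation to the reflected one *)

Section projected_regularity.
Context {R : realType} {d r : nat}.
Variables (O : set 'cV[R]_d) (sigma : 'cV[R]_d -> 'M[R]_(d, r)) (w : R -> 'cV[R]_r).
Variable x : R -> 'cV[R]_d.
Hypotheses (acx : locally_abs_continuous x) (xD : forall t : R, 0 <= t -> closure O (x t)).

Lemma locally_abs_continuous_coord i (a b : R) : 0 <= a ->
  abs_continuous_on (fun t => x t i 0) a b.
Proof.
move=> a0 eps eps0; have [delta delta0 hd] := acx b eps0.
exists delta => // n p q pq tpq sd.
apply: le_lt_trans (hd n p q _ tpq sd).
  by apply: ler_sum => k _; have := coord_le_enorm (x (q k) - x (p k)) i; rewrite !mxE.
by move=> k /pq[? ? ?]; split => //; exact: le_trans a0 _.
Qed.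

Lemma locally_abs_continuous_pos : continuous_on_pos x.
Proof.
move=> t eps t0 eps0; have [delta delta0 hd] := acx (t + 1) eps0.
exists (Num.min 1 delta); first by rewrite lt_min ltr01.
move=> s s0; rewrite lt_min => /andP[s1 sd].
apply: (le_trans (mxnorm_le_enorm _)); apply: ltW.
have key a b : 0 <= a -> a <= b -> b <= t + 1 -> b - a < delta -> enorm (x b - x a) < eps.
  move=> a0 ab bt ba; have := hd 1%N (fun=> a) (fun=> b).
  rewrite !big_nat1; apply => //.
  by move=> [|i] [|j].
have [ts|/ltW st] := leP t s.
  by apply: key => //; move: s1 sd; rewrite ger0_norm ?subr_ge0//; lra.
rewrite enormBC; apply: key => //; first by rewrite lerDl.
by rewrite -[ltLHS]ger0_norm ?subr_ge0// distrC.
Qed.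

Lemma tangent_cone0 (D : set 'cV[R]_d) q : D q -> tangent_cone D q 0.
Proof.
move=> Dq; rewrite tangent_coneP; last by exists q.
move=> eps delta eps0 delta0; exists (delta / 2).
  by rewrite divr_gt0// ltr_pdivrMr// ltr_pMr// ltr1n.
exists q => //; rewrite scaler0 addr0 subrr enorm0.
by rewrite mulr_gt0// divr_gt0.
Qed.

(** The bound on [x'] holds only almost everywhere; absolute continuity turns it into a Lipschitz
    bound, one coordinate and one sign at a time. *)
Lemma projected_loclip (lw : vloclip w) (hsigma : lipschitz_opnorm (closure O) sigma)
  (bD : bounded_set (closure O)) : projected_ode O sigma w x -> vloclip x.
Proof.
move=> px i T.
have [S S0 hS] := lipschitz_opnorm_bounded hsigma bD.
have [K K0 hK] := vloclip_enorm lw (T + 1).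
(* [S] bounds the operator norm of [sigma] on the bounded closure, and [r%:R * K] the norm of
   [w']. *)
pose B := 2 * (S * (r%:R * K)).
have B0 : 0 <= B by rewrite !mulr_ge0.
exists B => a b a0 ab bT.
have aew := ae_ord (fun j => loclip_ae_derivable (lw j)).
have key (sg : R) : `|sg| = 1 -> sg * x b i 0 - sg * x a i 0 <= B * b - B * a.
  move=> sg1.
  apply: (@abs_continuous_local_to_global_le _ (fun t => sg * x t i 0) (fun t => B * t)) => //.
  - move=> eps eps0; have [delta delta0 hd] := locally_abs_continuous_coord i b a0 eps0.
    exists delta => // n p q pq tpq sd; apply: le_lt_trans (hd n p q pq tpq sd).
    by apply: ler_sum => k _; rewrite -mulrBr normrM sg1 mul1r.
  - by move=> u v uv; rewrite ler_wpM2l.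
  apply: (ae_imply2 (ae_imply2 px aew (fun _ h1 h2 => conj h1 h2)) (ae_neq 0)).
  move=> t [h dw] tn0 /andP[at_ tb] eps eps0.
  have t_ge0 : 0 <= t := le_trans a0 at_.
  have t0 : 0 < t by rewrite lt_neqAle eq_sym tn0.
  have [dx pr] := h t_ge0.
  have hx := (vector_is_derive x t _).2 (conj dx erefl).
  pose cw := \col_j 'D_1 (fun s => w s j 0) t.
  have hw j : is_derive t 1 (fun s => w s j 0) (cw j 0).
    by rewrite mxE; apply/derivableP; exact: dw.
  have [_ wc] := (vector_is_derive w t cw).1 hw.
  have Dx := xD t_ge0.
  have cwb : enorm cw <= r%:R * K.
    apply: (le_trans (enorm_le_sum _)).
    apply: (@le_trans _ _ (\sum_(j < r) K)); last by rewrite sumr_const card_ord mulr_natl.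
    apply: ler_sum => j _; apply: (is_derive_bound ltr01 (hw j)) => s ts st.
    have := coord_le_enorm (w s - w t) j; rewrite !mxE => /le_trans; apply.
    by apply: hK => //; lra.
  have pb : enorm (x^`()%classic t) <= B.
    move: pr; rewrite wc => -[_ /(_ _ (tangent_cone0 Dx))]; rewrite sub0r enormN => h1.
    have h2 := hS _ cw Dx.
    have := enorm_triangle (x^`()%classic t - sigma (x t) *m cw) (sigma (x t) *m cw).
    rewrite subrK => h3; have h4 := ler_wpM2l S0 cwb.
    rewrite /B; lra.
  have [e e0 he] := is_derive_straddle (hx i) eps0.
  exists e => // u v _ _ tu ut tv ve.
  have vu : 0 <= v - u by rewrite subr_ge0 (le_trans ut).
  rewrite -!mulrBr; apply: (le_trans (ler_norm _)); rewrite normrM sg1 mul1r.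
  have := he _ _ tu ut tv ve.
  have := ler_wpM2r vu (le_trans (coord_le_enorm _ i) pb).
  rewrite -{1}(ger0_norm vu) -normrM.
  have := ler_normD (x v i 0 - x u i 0 - x^`()%classic t i 0 * (v - u)) (x^`()%classic t i 0 * (v - u)).
  rewrite subrK; lra.
have := key 1 (normr1 _); have := key (-1) (normrN1 _).
by rewrite ler_norml => h1 h2; apply/andP; split; lra.
Qed.

End projected_regularity.

(** * Stieltjes measures with a density *)

Section primitive_measure.
Context {R : realType}.
Local Notation mu := (@lebesgue_measure R).
Local Notation LS := lebesgue_stieltjes_measure.
Variable q : R -> R.
Hypotheses (mq : measurable_fun setT q) (bq : locbdd q) (q0 : forall t, 0 <= q t).

Lemma primitive_nd : nondecreasing (primitive q).
Proof.
move=> u v uv; have [u0|u0] := leP 0 u.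
  have := @loclip_le _ (fun=> 0) (primitive q) (loclip_cst 0) (primitive_loclip mq bq) _ u v u0 uv.
  rewrite subrr subr_ge0; apply.
  apply: (ae_imply (primitive_is_derive mq bq)) => t h t0; exists 0, (q t).
  by split; [exact: is_derive_cst | exact: h | exact: q0].
rewrite primitive_lt0//; have [v0|v0] := leP 0 v; last by rewrite primitive_lt0.
rewrite /primitive; apply: Rintegral_ge0 => //.
Qed.

Lemma primitive_max0 t : primitive q (Num.max 0 t) = primitive q t.
Proof.
have [t0|t0] := leP 0 t; first by [].
by rewrite (primitive_lt0 q t0) primitive0.
Qed.

Lemma primitive_continuous : continuous (primitive q).
Proof.
have := loclip_continuous (primitive_loclip mq bq).
by rewrite (_ : (fun t => _) = primitive q)//; apply/funext => t; exact: primitive_max0.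
Qed.

Definition primitive_cumulative : cumulative R R :=
  HB.pack (primitive q) (isCumulative.Build R _ R (primitive q) primitive_nd
    (right_continuousW primitive_continuous)).

Let L := primitive_cumulative.

(** Primitives vanish up to time 0. This disposes of the time 0, which lies in no interval []0,
    t]]. *)
Lemma lsm_primitive_neg : LS L `]-1, 0]%classic = 0%E.
Proof.
by rewrite lebesgue_stieltjes_itv_oc// ?lerN10//= primitive0 primitive_lt0 ?subrr// ltrN10.
Qed.

Lemma lsm_primitive0 : LS L [set 0] = 0%E.
Proof.
apply/eqP; rewrite eq_le measure_ge0 andbT -lsm_primitive_neg.
apply: le_measure; rewrite ?inE//.
by move=> t /= ->; rewrite in_itv/= lexx andbT ltrN10.
Qed.

Lemma lsm_primitive_cc t : 0 <= t -> LS L `[0, t]%classic = (primitive q t)%:E.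
Proof.
move=> t0; have t1 : -1 <= t by rewrite (le_trans _ t0)// lerN10.
have l1 : LS L `]0, t]%classic = (primitive q t)%:E.
  by rewrite lebesgue_stieltjes_itv_oc//= primitive0 subr0.
have l2 : LS L `]-1, t]%classic = (primitive q t)%:E.
  by rewrite lebesgue_stieltjes_itv_oc//= (@primitive_lt0 _ q (-1)) ?ltrN10// subr0.
apply/eqP; rewrite eq_le; apply/andP; split; [rewrite -l2|rewrite -l1];
  apply: le_measure; rewrite ?inE// => s /=; rewrite !in_itv/= => /andP[h ->]; rewrite andbT.
  by rewrite (lt_le_trans _ h)// ltrN10.
exact: ltW.
Qed.

(** [rho] and [q] are both almost everywhere the derivative of [primitive q], hence equal: the
    measure is [q] times Lebesgue measure. *)
Lemma lsm_primitive_integral (T : R) : 0 < T ->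
  (forall E : set R, measurable E -> E `<=` `]0, T]%classic -> LS L E = (\int[mu]_(t in E) (q t)%:E)%E) /\
  (forall (E : set R) (f : R -> \bar R), measurable E -> E `<=` `]0, T]%classic ->
     (LS L).-integrable E f ->
     (\int[LS L]_(t in E) f t = \int[mu]_(t in E) (f t * (q t)%:E))%E).
Proof.
(* The horizon [T + 1] puts [T] in the interior, where [lsm_density] gives the derivative. *)
move=> T0; have T1 : 0 < T + 1 by rewrite addr_gt0.
have [K K0 hK] := loclip_ge0 (primitive_loclip mq bq) (T + 1).
have [|rho [irho rhoE rhoI ae]] := @lsm_density _ L (T + 1) K T1.
  by move=> u v u0 uv vT; apply: le_trans (hK u v u0 uv vT); exact: ler_norm.
have sT (E : set R) : E `<=` `]0, T]%classic -> E `<=` `]0, T + 1]%classic.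
  move=> ET; apply: (subset_trans ET); apply: subset_itvl.
  by rewrite bnd_simp lerDl.
have aeq (E : set R) : E `<=` `]0, T]%classic -> {ae mu, forall t, E t -> rho t = q t}.
  move=> ET; apply: (ae_imply2 ae (primitive_is_derive mq bq)) => t h1 h2 /ET /=.
  rewrite in_itv/= => /andP[t0 tT].
  have ht : 0 < t < T + 1 by rewrite t0 (le_lt_trans tT)// ltrDl.
  have [_ <-] := h1 ht.
  by have [_ <-] := h2 t0.
have mrho (E : set R) : measurable E -> E `<=` `]0, T]%classic -> measurable_fun E (EFin \o rho).
  move=> mE /sT ET; have := measurable_int _ irho; exact: measurable_funS.
have mqE (E : set R) : measurable E -> measurable_fun E (EFin \o q).
  by move=> mE; apply/measurable_EFinP; exact: measurable_funTS.
split=> [E mE ET|E f mE ET fint].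
  rewrite rhoE//; last exact: sT.
  apply: ae_eq_integral; [exact: mE | exact: mrho | exact: mqE |].
  by apply: (ae_imply (aeq _ ET)) => t h /h ->.
rewrite rhoI//; last exact: sT.
apply: ae_eq_integral; first exact: mE.
- by apply: emeasurable_funM; [exact: measurable_int fint | exact: mrho].
- by apply: emeasurable_funM; [exact: measurable_int fint | exact: mqE].
- by apply: (ae_imply (aeq _ ET)) => t h /h ->.
Qed.

(** For a measure with density [q], Lebesgue-null sets and the zero set of [q] are both null. *)
Lemma lsm_primitive_ae (P : R -> Prop) :
  {ae mu, forall t, 0 < t -> P t \/ q t = 0} -> {ae (LS L), forall t, 0 <= t -> P t}.
Proof.
move=> [N [mN N0 subN]].
have mZ : measurable (q @^-1` [set 0]) by rewrite -[_ @^-1` _]setTI; exact: mq.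
pose A n : set R := `]0, n.+1%:R]%classic `&` (N `|` q @^-1` [set 0]).
have A0 n : (LS L).-negligible (A n).
  have mA : measurable (A n) by apply: measurableI => //; exact: measurableU.
  exists (A n); split => //.
  have [h _] := lsm_primitive_integral (ltr0Sn R n).
  rewrite h//; last exact: subIsetl.
  rewrite (ae_eq_integral (cst 0%E))//; first exact: integral0.
    by apply/measurable_EFinP; exact: measurable_funTS.
  exists N; split => // t /= /not_implyP[[tn [//|/= ->]]].
  by [].
have Neg : (LS L).-negligible `]-1, 0]%classic.
  by exists `]-1, 0]%classic; split => //; exact: lsm_primitive_neg.
apply: negligibleS (negligibleU Neg (negligible_bigcup A0)) => t /= /not_implyP[t0 nP].
have [tz|tp] := leP t 0.
  by left; rewrite /= in_itv/= tz andbT (lt_le_trans _ t0)// ltrN10.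
right; exists (Num.trunc t) => //; split => /=.
  by rewrite in_itv/= tp/=; have /andP[_ /ltW] := Num.Theory.truncn_itv t0.
have [Nt|nNt] := pselect (N t); first by left.
right; apply: contrapT => qt; apply: nNt; apply: subN => /= /(_ tp)[//|]; exact: qt.
Qed.

End primitive_measure.

(** * Total variation as the integral of the speed *)

Section total_variation.
Context {R : realType} {d : nat}.
Local Notation mu := (@lebesgue_measure R).
Variables (l k : R -> 'cV[R]_d).
Hypothesis ll : vloclip l.
Hypothesis dl : {ae mu, forall t : R, 0 < t -> forall i, is_derive t 1 (fun s => l s i 0) (k t i 0)}.
Let q t := enorm (k t).
Hypotheses (mq : measurable_fun setT q) (bq : locbdd q).
Let U := primitive q.

Let q_ge0 t : 0 <= q t. Proof. exact: enorm_ge0. Qed.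

(** Paired with its own increment [e], the path becomes a scalar function with derivative at most
    [|e| q]; dividing by [|e|] gives the bound. *)
Lemma enorm_increment_le u v : 0 <= u -> u <= v -> enorm (l v - l u) <= U v - U u.
Proof.
move=> u0 uv; set e := l v - l u.
have [e0|e_neq0] := eqVneq e 0.
  by rewrite e0 enorm0 subr_ge0; exact: primitive_nd.
have ee := enorm_gt0 e_neq0.
rewrite -(ler_pM2l ee) -expr2 enorm_sqr mulrBr {1}/e dotBl.
apply: (@loclip_le _ (fun t => dot (l t) e) (fun t => enorm e * U t)) => //.
- by apply: loclip_sum => i; under eq_fun do rewrite mulrC; exact: loclipZ.
- by apply: loclipZ; exact: primitive_loclip.
apply: (ae_imply2 dl (primitive_is_derive mq bq)) => t h1 h2 t0.
exists (dot (k t) e), (enorm e * q t); split.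
- exact: is_derive_dot (h1 t0).
- have h := h2 t0; exact: is_deriveZ.
- by rewrite (le_trans (ler_norm _))// (le_trans (cauchy_schwarz _ _))// mulrC.
Qed.

Lemma partition_variation_le t s : itv_partition 0 t s ->
  \sum_(0 <= i < size s) enorm (l (nth t (0 :: s) i.+1) - l (nth t (0 :: s) i)) <= U t.
Proof.
move=> sP; have -> : U t = U t - U 0 by rewrite /U primitive0 subr0.
rewrite -(sum_partition U sP) big_seq_cond [leRHS]big_seq_cond; apply: ler_sum => i.
rewrite mem_index_iota andbT /= => is_.
apply: enorm_increment_le; first by apply: itv_partition_nth_ge sP; rewrite ltnS ltnW.
case: (sP) => ps _; have /(pathP t)/(_ _ is_) := ps; exact: ltW.
Qed.

(** The upper bound sums increments over a partition. For the lower bound, increments of [V]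
    dominate those of [l], whose norms are [q s (v - u)] up to a small error near almost every [s];
    the comparison principle then gives [U <= V]. *)
Lemma etotal_variation_primitive t : 0 <= t -> etotal_variation 0 t l = (U t)%:E.
Proof.
move=> t0; apply/le_anti/andP; split.
  apply: ge_ereal_sup => _ [s sP <-]; rewrite lee_fin; exact: partition_variation_le.
pose V s := fine (etotal_variation 0 s l).
have Vfin s : 0 <= s -> etotal_variation 0 s l = (V s)%:E.
  move=> s0; rewrite /V fineK// fin_real//; apply/andP; split.
    have [p pP _] := fine_partition s0 ltr01.
    apply: (@lt_le_trans _ _ (\sum_(0 <= i < size p) enorm (l (nth s (0 :: p) i.+1) - l (nth s (0 :: p) i)))%:E).
      exact: ltNyr.
    by apply: ereal_sup_ubound; exists p.
  apply: (@le_lt_trans _ _ (U s)%:E); last exact: ltry.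
  apply: ge_ereal_sup => _ [p pP <-]; rewrite lee_fin; exact: partition_variation_le.
have Vincr a b : 0 <= a -> a <= b -> enorm (l b - l a) <= V b - V a.
  move=> a0; rewrite le_eqVlt => /orP[/eqP <-|ab]; first by rewrite !subrr enorm0.
  rewrite lerBrDr -lerBrDl -lee_fin -Vfin//.
  apply: ge_ereal_sup => _ [s sP <-]; rewrite lee_fin lerBrDr -lee_fin -Vfin; last first.
    by rewrite (le_trans a0)// ltW.
  case: (sP) => ps /eqP ls.
  (* A partition of [[0, a]] followed by [b] is one of [[0, b]]. *)
  apply: ereal_sup_ubound; exists (rcons s b).
    by split; rewrite ?last_rcons// rcons_path ps ls.
  rewrite /= size_rcons big_nat_recr//=; congr (_ + _)%:E.
    apply: eq_big_nat => i /andP[_ is_].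
    rewrite !nth_rcons -rcons_cons nth_rcons /= is_ ltnS (ltnW is_).
    rewrite (set_nth_default a b is_) (set_nth_default a b)//=.
    by rewrite ltnS ltnW.
  rewrite nth_rcons ltnn eqxx -rcons_cons nth_rcons/= ltnS leqnn.
  by rewrite (set_nth_default a)//= -[nth a _ _]/(nth a (0 :: s) (size s)) (itv_partition_nth_size _ sP).
rewrite Vfin// lee_fin.
have V0 : V 0 = 0.
  rewrite /V (_ : etotal_variation 0 0 l = 0%E)//.
  rewrite /etotal_variation (_ : [set _ | _ in _] = [set 0%E]) ?ereal_sup1//.
  apply/seteqP; split => [_ [s sP <-]|_ ->].
    by rewrite (itv_partitionxx sP)/= big_nil.
  by exists [::] => //=; rewrite big_nil.
have : U t - U 0 <= V (Num.max 0 t) - V (Num.max 0 0).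
  (* [Num.max 0] makes the comparison function nondecreasing on the whole line, as the principle
     requires. *)
  apply: (@abs_continuous_local_to_global_le _ U (fun s => V (Num.max 0 s))) => //.
  - have [K hK] := primitive_loclip mq bq t.
    by apply: (@lipschitz_abs_continuous _ _ _ _ K) => u v; exact: hK.
  - move=> u v uv; rewrite -subr_ge0; apply: le_trans (enorm_ge0 _) (Vincr _ _ _ _).
      by rewrite le_max lexx.
    by rewrite ge_max le_max lexx/= le_max uv orbT.
  apply: (ae_imply2 (ae_imply2 dl (primitive_is_derive mq bq) (fun _ h1 h2 => conj h1 h2)) (ae_neq 0)).
  move=> s [h1 h2] sn /andP[s_ge0 st] eps eps0.
  have s0 : 0 < s by rewrite lt_neqAle eq_sym sn.
  have eps2 : 0 < eps / 2 by rewrite divr_gt0.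
  have [e1 e10 he1] := vec_is_derive_approx (h1 s0) eps2.
  have [e2 e20 he2] := is_derive_straddle (h2 s0) eps2.
  exists (Num.min e1 e2); first by rewrite lt_min e10.
  move=> u v /andP[u0 ut] /andP[v0 vt] su us sv ve.
  have m1 : Num.min e1 e2 <= e1 by rewrite ge_min lexx.
  have m2 : Num.min e1 e2 <= e2 by rewrite ge_min lexx orbT.
  have uv : u <= v := le_trans us sv.
  rewrite (max_r u0) (max_r v0).
  have /(le_trans (ler_norm _)) l1 : `|U v - U u - q s * (v - u)| <= eps / 2 * (v - u).
    by apply: he2 => //; lra.
  have l2 : q s * (v - u) <= enorm (l v - l u) + eps / 2 * (v - u).
    have k1 : enorm (l v - l s - (v - s) *: k s) <= eps / 2 * (v - s).
      rewrite -{2}(ger0_norm (_ : 0 <= v - s)) ?subr_ge0//; apply: he1.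
      by rewrite ger0_norm ?subr_ge0//; lra.
    have k2 : enorm (l u - l s - (u - s) *: k s) <= eps / 2 * (s - u).
      rewrite -{1}(ger0_norm (_ : 0 <= s - u)) ?subr_ge0// distrC; apply: he1.
      by rewrite distrC ger0_norm ?subr_ge0//; lra.
    have -> : q s * (v - u) = enorm ((v - u) *: k s).
      by rewrite enormZ ger0_norm ?subr_ge0// mulrC.
    have -> : (v - u) *: k s = (l v - l u) - (l v - l s - (v - s) *: k s) + (l u - l s - (u - s) *: k s).
      by apply/matrixP => i j; rewrite !mxE; ring.
    apply: (le_trans (enorm_triangle _ _)).
    have := enorm_triangleB (l v - l u) (l v - l s - (v - s) *: k s); lra.
  have := Vincr u v u0 uv; lra.
by rewrite (max_r t0) maxxx V0 subr0 /U primitive0 subr0.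
Qed.

End total_variation.

Lemma measurable_invr (R : realType) : measurable_fun setT (fun s : R => s^-1).
Proof.
rewrite -(setUv [set (0 : R)]); apply/measurable_funU => //; first exact: measurableC.
split; first exact: measurable_fun_set1.
apply: open_continuous_measurable_fun; first by rewrite openC; exact: closed_eq.
by move=> s; rewrite inE => /= /eqP s0; exact: inv_continuous.
Qed.

Lemma integral_cc_oc (R : realType) (m : {measure set (measurableTypeR R) -> \bar R})
    (f : R -> R) (t : R) :
  m [set 0] = 0%E -> m.-integrable `[0, t] (EFin \o f) ->
  (\int[m]_(s in `[0%R, t]) (f s)%:E = \int[m]_(s in `]0%R, t]) (f s)%:E)%E.
Proof.
move=> m0 fi.
have <- : `[0, t]%classic `\` [set 0] = `]0, t]%classic by exact: setDitv1l.
by apply: (@negligible_integral _ (measurableTypeR R) R m `[0, t]%classic [set 0]).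
Qed.

(** * Construction of the reflection term *)

Section projected_to_reflected.
Context {R : realType} {d r : nat}.
Local Notation mu := (@lebesgue_measure R).
Local Notation LS := lebesgue_stieltjes_measure.
Variables (O : set 'cV[R]_d) (C0 : R).
Hypotheses (oO : open O) (bO : bounded_set O) (C00 : 0 <= C0).
Hypothesis hC0 : forall x' x n, O x' -> boundary O x -> normals O x n ->
  0 <= dot (x' - x) n + C0 * enorm (x - x') ^+ 2.

Lemma measurable_enorm (k : R -> 'cV[R]_d) :
  (forall i, measurable_fun setT (fun t => k t i 0)) ->
  measurable_fun setT (fun t => enorm (k t)).
Proof.
move=> mk.
have ms : measurable_fun setT (Num.sqrt : R -> R).
  by apply: continuous_measurable_fun; exact: sqrt_continuous.
have md : measurable_fun setT (fun t => dot (k t) (k t)).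
  by apply: measurable_sum => i; apply: measurable_funM.
exact: (measurableT_comp ms md).
Qed.

Lemma locbdd_enorm (k : R -> 'cV[R]_d) :
  (forall i, locbdd (fun t => k t i 0)) -> locbdd (fun t => enorm (k t)).
Proof.
move=> bk T; have /choice[K hK] := fun i => bk i T.
exists (\sum_i K i) => t tT; rewrite ger0_norm ?enorm_ge0//.
by apply: (le_trans (enorm_le_sum _)); apply: ler_sum => i _; exact: hK.
Qed.

Lemma enorm_normalize (v : 'cV[R]_d) : v = enorm v *: ((enorm v)^-1 *: v).
Proof.
have [->|v0] := eqVneq v 0; first by rewrite !scaler0.
by rewrite scalerA mulfV ?scale1r// gt_eqF// enorm_gt0.
Qed.

(** In the interior every vector is tangent, so the projection is [z] itself; on the boundary
    Moreau's decomposition makes the displacement a proximal normal. *)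
Lemma proj_displacement q z p : closure O q ->
  is_proj (tangent_cone (closure O) q) z p ->
  p - z = 0 \/ normals O q ((enorm (p - z))^-1 *: (p - z)).
Proof.
move=> Dq pr; have [Oq|nOq] := pselect (O q).
  left; apply: enorm_eq0; apply/le_anti; rewrite enorm_ge0 andbT.
  by have := pr.2 z (interior_tangent oO z Oq); rewrite subrr enorm0.
have bq : boundary O q by apply/boundaryE.
have [->|pz] := eqVneq (p - z) 0; first by left.
right; apply: prox_normal_normals => //.
exact: (is_proj_prox_normal oO bO C00 hC0 bq pr).
Qed.

Lemma measurable_hits_boundary (x : R -> 'cV[R]_d) (t : R) : continuous_on_pos x ->
  measurable_fun `[0, t]%classic (fun s => (\1_(boundary O) (x s))%:E : \bar R).
Proof.
move=> cx; pose x' s := x (Num.max 0 s).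
have clB : closed [set s | boundary O (x' s)].
  (* As [O] is open, its boundary is [closure O] minus [O], a closed set. *)
  rewrite (_ : [set s | _] = x' @^-1` (closure O `&` ~` O)); last first.
    by apply/seteqP; split => s /=; rewrite boundaryE.
  apply: preimage_closed => [s _|].
    exact: (continuous_on_pos_max cx).
  by apply: closedI; [exact: closed_closure | exact: open_closedC].
apply: (eq_measurable_fun (EFin \o \1_[set s | boundary O (x' s)])).
  move=> s /set_mem; rewrite /= in_itv => /andP[s0 _].
  by rewrite -[in RHS](max_r s0).
apply/measurable_EFinP; apply: measurable_funTS; apply: measurable_indic.
exact: closed_measurable.
Qed.

Section density.
Variables (x l k : R -> 'cV[R]_d).
Hypotheses (cx : continuous_on_pos x) (xD : forall t, 0 <= t -> closure O (x t)).
Hypotheses (mk : forall i, measurable_fun setT (fun t => k t i 0))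
  (bk : forall i, locbdd (fun t => k t i 0)).
Hypothesis lk : forall i t, 0 <= t -> l t i 0 - l 0 i 0 = primitive (fun t => k t i 0) t.
Hypothesis kN : {ae mu, forall t, 0 < t -> normals O (x t) ((enorm (k t))^-1 *: k t) \/ k t = 0}.

Let q t := enorm (k t).
Let mq : measurable_fun setT q := measurable_enorm mk.
Let bq : locbdd q := locbdd_enorm bk.
Let q0 t : 0 <= q t. Proof. exact: enorm_ge0. Qed.
Let L := primitive_cumulative mq bq q0.
Let g t := (enorm (k t))^-1 *: k t.

(** Where [k t = 0], [g t] is 0 and not a unit vector; these times are null for [LS L], whose
    density is [|k|]. *)
Lemma reflection_ae_normal : {ae (LS L), forall t, 0 <= t -> normals O (x t) (g t)}.
Proof.
apply: lsm_primitive_ae; apply: (ae_imply kN) => t h t0.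
by have [|k0] := h t0; [left | right; rewrite /q k0 enorm0].
Qed.

(** As [k = |k| g], integrating [g] against [LS L] gives the Lebesgue integral of [k]. The point 0
    is null for both measures, which reduces [[0, t]] to []0, t]]. *)
Lemma reflection_density : stieltjes_density (LS L) l g.
Proof.
move=> t i t0.
have mg : measurable_fun setT (fun s => g s i 0).
  rewrite (_ : (fun s => _) = fun s => (q s)^-1 * k s i 0); last first.
    by apply/funext => s; rewrite mxE.
  apply: measurable_funM; last exact: mk.
  exact: (measurableT_comp (@measurable_invr R) mq).
have gb s : `|g s i 0| <= 1.
  rewrite mxE normrM ger0_norm ?invr_ge0 ?enorm_ge0//.
  have [k0|kn0] := eqVneq (k s) 0; first by rewrite k0 mxE normr0 mulr0.
  by rewrite mulrC ler_pdivrMr ?enorm_gt0// mul1r coord_le_enorm.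
have kE s : k s i 0 = g s i 0 * q s.
  by rewrite {1}(enorm_normalize (k s)) mxE mulrC.
have int0 : (LS L).-integrable `[0, t] (EFin \o (fun s => g s i 0)).
  apply: (@measurable_bounded_integrable _ (measurableTypeR R) R (LS L)).
  - exact: measurable_itv.
  - have h : (LS L `[0%R, t]%classic < +oo)%E by rewrite lsm_primitive_cc// ltry.
    exact: h.
  - exact: measurable_funTS.
  - exists 1; split; first exact: num_real.
    by move=> M M1 s _ /=; rewrite (le_trans (gb s))// ltW.
have kint : mu.-integrable `[0, t] (EFin \o (fun s => k s i 0)).
  exact: (locbdd_integrable (T := t) (mk i) (bk i)).
split; first exact: int0.
apply: (etrans (lk i t0)).
suff h : (\int[mu]_(s in `]0%R, t]) (k s i 0)%:E =
    \int[LS L]_(s in `]0%R, t]) (g s i 0)%:E)%E.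
  apply: (congr1 fine).
  apply: (etrans (integral_cc_oc _ kint)); first exact: lebesgue_measure_set1.
  apply: (etrans h); apply/esym; apply: (integral_cc_oc _ int0).
  exact: lsm_primitive0.
have [tn0|tp] := leP t 0.
  by rewrite set_itv_ge ?integral_set0// bnd_simp -leNgt.
have intoc : (LS L).-integrable `]0, t] (EFin \o (fun s => g s i 0)).
  apply: (@integrableS _ (measurableTypeR R) R (LS L) `[0, t]%classic) int0.
  - exact: measurable_itv.
  - exact: measurable_itv.
  - by apply: subset_itvr; rewrite bnd_simp.
have [_ h] := lsm_primitive_integral mq bq q0 tp.
have e := h _ _ (measurable_itv _) (@subset_refl _ _) intoc.
apply/esym; refine (eq_trans e _).
apply: eq_integral => s _; exact: (congr1 EFin (esym (kE s))).
Qed.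

(** Almost every time carries a normal, and normals exist only at boundary points, so the indicator
    is 1 almost everywhere. *)
Lemma reflection_on_boundary t : 0 <= t ->
  (L t)%:E = (\int[LS L]_(s in `[0%R, t]) (\1_(boundary O) (x s))%:E)%E.
Proof.
move=> t0.
have mB := measurable_hits_boundary (t := t) cx.
rewrite -(lsm_primitive_cc mq bq q0 t0) -[LHS]mul1e -integral_cst//.
apply: ae_eq_integral => //.
apply: (ae_imply reflection_ae_normal) => s h /=.
rewrite in_itv/= => /andP[s0 _].
by rewrite indicE mem_set//; exact: (normals_boundary oO (xD s0) (h s0)).
Qed.

End density.
End projected_to_reflected.

Lemma projected_reflected (R : realType) (d r : nat) (O : set 'cV[R]_d)
    (sigma : 'cV[R]_d -> 'M[R]_(d, r)) (x0 : 'cV[R]_d) (w : R -> 'cV[R]_r)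
    (x : R -> 'cV[R]_d) :
  open O -> bounded_set O -> admissible O -> lipschitz_opnorm (closure O) sigma ->
  vloclip w -> locally_abs_continuous x -> (forall t : R, 0 <= t -> closure O (x t)) ->
  x 0 = x0 -> projected_ode O sigma w x ->
  exists l : R -> 'cV[R]_d, reflected_ode_solution O sigma w x0 x l.
Proof.
move=> oO bO [[_ [C0 C00 hC0]] _ _] hsigma lw acx xD x_0 px.
have bD := bounded_D bO.
have lx := projected_loclip acx xD lw hsigma bD px.
have cx := locally_abs_continuous_pos acx.
have cF := lipschitz_opnorm_continuous hsigma cx xD.
have [Y [lY Y0 prY]] := RS_primitive_exists cF lw.
pose l t := x t - x0 - Y t.
have ll : vloclip l.
  move=> i; rewrite (_ : (fun t => _) = fun t => x t i 0 - x0 i 0 - Y t i 0); last first.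
    by apply/funext => t; rewrite !mxE.
  exact: (loclipB (loclipB (lx i) (loclip_cst _)) (lY i)).
have l0 : l 0 = 0 by rewrite /l x_0 Y0 subrr subr0.
have /choice[kd hkd] : forall i, exists g : R -> R, [/\ measurable_fun setT g, locbdd g,
    {ae @lebesgue_measure R, forall t : R, 0 < t -> is_derive t 1 (fun s => l s i 0) (g t)} &
    forall t, 0 <= t -> l t i 0 - l 0 i 0 = primitive g t].
  by move=> i; exact: loclip_density (ll i).
pose k t : 'cV[R]_d := \col_i kd i t.
have kE i : (fun t => k t i 0) = kd i by apply/funext => t; rewrite mxE.
have mk i : measurable_fun setT (fun t => k t i 0) by rewrite kE; have [] := hkd i.
have bk i : locbdd (fun t => k t i 0) by rewrite kE; have [] := hkd i.
have lk i t : 0 <= t -> l t i 0 - l 0 i 0 = primitive (fun t => k t i 0) t.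
  by rewrite kE; have [_ _ _] := hkd i; apply.
have dl : {ae @lebesgue_measure R, forall t : R, 0 < t ->
    forall i, is_derive t 1 (fun s => l s i 0) (k t i 0)}.
  have h : forall i, {ae @lebesgue_measure R, forall t : R, 0 < t -> is_derive t 1 (fun s => l s i 0) (kd i t)}.
    by move=> i; have [] := hkd i.
  by apply: (ae_imply (ae_ord h)) => t ht t0 i; rewrite mxE; exact: ht.
have aew := ae_ord (fun j => loclip_ae_derivable (lw j)).
have kN : {ae @lebesgue_measure R, forall t, 0 < t ->
    normals O (x t) ((enorm (k t))^-1 *: k t) \/ k t = 0}.
  apply: (ae_imply2 (ae_imply2 px aew (fun _ h1 h2 => conj h1 h2)) dl) => t [h dw] hl t0.
  have [dx pr] := h (ltW t0).
  have hx := (vector_is_derive x t _).2 (conj dx erefl).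
  pose cw := \col_j 'D_1 (fun s => w s j 0) t.
  have hw j : is_derive t 1 (fun s => w s j 0) (cw j 0).
    by rewrite mxE; apply/derivableP; exact: dw.
  have [_ wc] := (vector_is_derive w t cw).1 hw.
  rewrite wc in pr.
  have hY := RS_primitive_is_derive prY t0 hw.
  have kk : k t = x^`()%classic t - sigma (x t) *m cw.
    apply/matrixP => i j; rewrite (ord1 j) [RHS]mxE [X in _ + X]mxE.
    have [_ <-] := hl t0 i.
    have h1 : is_derive t 1 (fun s => x s i 0 - x0 i 0 - Y s i 0)
        (x^`()%classic t i 0 - 0 - (sigma (x t) *m cw) i 0).
      exact: (is_deriveB (is_deriveB (hx i) (is_derive_cst _ _ _)) (hY i)).
    rewrite subr0 in h1.
    rewrite (_ : (fun s => l s i 0) = (fun s => x s i 0 - x0 i 0 - Y s i 0)); last first.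
      by apply/funext => s; rewrite !mxE.
    by have [_ ->] := h1.
  have [k0|kn] := proj_displacement oO bO C00 hC0 (xD _ (ltW t0)) pr.
    by right; rewrite kk.
  by left; rewrite kk.
have mq := measurable_enorm mk; have bq := locbdd_enorm bk.
have q0 t : 0 <= enorm (k t) by exact: enorm_ge0.
have etv t : 0 <= t -> etotal_variation 0 t l = (primitive (fun t => enorm (k t)) t)%:E.
  exact: (etotal_variation_primitive ll dl mq bq).
exists l; split.
- by split => //; exact: continuous_on_pos_within.
- split; last by move=> t t0; rewrite etv// ltry.
  apply: continuous_on_pos_within => t eps t0 eps0.
  have [K K0 hK] := vloclip_enorm ll (t + 1).
  have K1 : 0 < K + 1 by rewrite ltr_wpDl.
  exists (Num.min 1 (eps / (K + 1))); first by rewrite lt_min ltr01 divr_gt0.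
  move=> s s0; rewrite lt_min => /andP[s1 se]; apply: (le_trans (mxnorm_le_enorm _)).
  have key : enorm (l s - l t) <= K * `|s - t|.
    have [ts|/ltW st] := leP t s.
      rewrite ger0_norm ?subr_ge0//; apply: hK => //.
      by move: s1; rewrite ger0_norm ?subr_ge0//; lra.
    rewrite enormBC distrC ger0_norm ?subr_ge0//; apply: hK => //.
    by rewrite lerDl.
  apply: (le_trans key); apply: (@le_trans _ _ ((K + 1) * `|s - t|)).
    by rewrite ler_wpM2r// lerDl.
  by rewrite mulrC -ler_pdivlMr// ltW.
- split => // t t0; exists (Y t - Y 0); first exact: RS_primitive_integral.
  by rewrite Y0 subr0 /l -(addrA (x t)) -opprD [RHS]addrC subrK.
- exists (primitive_cumulative mq bq q0); split.
  (* On negative times both sides are 0, as [primitive] then integrates over an empty interval. *)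
  + move=> t; rewrite etv ?le_max ?lexx//; congr (_%:E).
    by rewrite /= primitive_max0.
  + by move=> t t0; exact: (reflection_on_boundary oO cx xD mk bk kN t0).
  + exists (fun t => (enorm (k t))^-1 *: k t).
      exact: (reflection_density mk bk lk).
    exact: (reflection_ae_normal mk bk kN).
Qed.

Theorem theorem2p3 (R : realType) (d r : nat) (O : set 'cV[R]_d)
    (sigma : 'cV[R]_d -> 'M[R]_(d, r)) (x0 : 'cV[R]_d) (w : R -> 'cV[R]_r)
    (hO : domain O) (hbdd : bounded_set O) (hadm : admissible O)
    (hsigma : lipschitz_opnorm (closure O) sigma)
    (hx0 : closure O x0)
    (hwc : {within `[0, +oo[, continuous w}) (hws : piecewise_smooth w) :
  (forall x l : R -> 'cV[R]_d,
     reflected_ode_solution O sigma w x0 x l -> projected_ode O sigma w x) /\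
  (forall x : R -> 'cV[R]_d,
     locally_abs_continuous x ->
     (forall t : R, 0 <= t -> closure O (x t)) ->
     x 0 = x0 ->
     projected_ode O sigma w x ->
     exists l : R -> 'cV[R]_d, reflected_ode_solution O sigma w x0 x l).
Proof.
have [_ _ oO] := hO.
have lw := piecewise_smooth_loclip hws.
split=> [x l|x acx xD x_0 px].
  exact: reflected_projected.
exact: (projected_reflected oO hbdd hadm hsigma lw acx xD x_0 px).
Qed.
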